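(* Let $\mathcal{L}$ be a real line arrangement in $\mathbb{CP}^2$ with $t$ collinear multiple points $P_1,\dots,P_t$ ($t\ge 1$) of multiplicities $k_1+1,\dots,k_t+1$ respectively. Let $\mathbb{C}^2\subset\mathbb{CP}^2$ be the complement of a line at infinity not belonging to $\mathcal{L}$ and such that all intersection points of lines of $\mathcal{L}$ lie in $\mathbb{C}^2$. Then $$\pi_1(\mathbb{C}^2-\mathcal{L})\cong\Big(\bigoplus_{i=1}^t\mathbb{F}^{k_i}\Big)\oplus\mathbb{Z}.$$
   Context: A real line arrangement is a finite union of distinct projective lines in $\mathbb{CP}^2$, each of which can be defined by a linear equation with real coefficients; $\mathcal{L}$ denotes both the set of lines and their union. A simple point is a point where exactly two lines of the arrangement meet; a multiple point is a point where more than two lines meet; the multiplicity of a point is the number of lines of the arrangement passing through it. An arrangement with $t$ collinear multiple points is an arrangement with exactly $t$ multiple points $P_1,\dots,P_t$ that contains a line $L$ on which all of them lie, and that is the union of $t$ subsets of lines, the $i$-th subset consisting of the $k_i+1$ lines passing through $P_i$; the line $L$ belongs to all the subsets, and lines of two different subsets, other than $L$, meet only in simple points outside $L$. $\mathbb{F}^k$ denotes the free group on $k$ generators, and $\oplus$ denotes the direct product of groups. *)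

(* Defs.v *)
From HB Require Import structures.
From mathcomp Require Import all_boot all_order all_algebra generic_quotient.
From mathcomp Require Import finmap complex lra.
From mathcomp Require Import all_classical all_reals topology normedtype homotopy.

Set Implicit Arguments.
Unset Strict Implicit.
Unset Printing Implicit Defensive.

Import Order.TTheory GRing.Theory Num.Theory ComplexField.
Import numFieldNormedType.Exports.

Local Open Scope classical_set_scope.
Local Open Scope ring_scope.
Local Open Scope quotient_scope.

Definition unit_interval (R : realType) : Type := set_type `[0%R : R, 1%R].

HB.instance Definition _ (R : realType) :=
  Topological.copy (unit_interval R) (set_type `[0%R : R, 1%R]).

Section unit_interval.
Variable R : realType.
Local Notation I := (unit_interval R).

Lemma clamp_subproof (r : R) : Num.max 0 (Num.min 1 r) \in `[0%R : R, 1%R]%classic.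
Proof.
by rewrite inE /= in_itv /= le_max lexx /= ge_max ler01 ge_min lexx.
Qed.

Definition clamp (r : R) : I :=
  exist (fun r => r \in `[0%R : R, 1%R]%classic) _ (clamp_subproof r).

Lemma unit_interval_zero_one : clamp 0 != clamp 1.
Proof.
apply/negP => /eqP /(congr1 val) /=.
rewrite minxx (min_idPr ler01) maxxx (max_idPr ler01).
by move/eqP; rewrite eq_sym oner_eq0.
Qed.

HB.instance Definition _ := isBiPointed.Build I unit_interval_zero_one.

Lemma val_clamp (r : R) : 0 <= r <= 1 -> val (clamp r) = r.
Proof. by case/andP => r0 r1 /=; rewrite (min_idPr r1) (max_idPr r0). Qed.

Lemma unit_intervalP (t : I) : 0 <= val t <= 1.
Proof. by case: t => r /=; rewrite inE /= in_itv. Qed.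

Lemma clampK (t : I) : clamp (val t) = t.
Proof. by apply: val_inj; rewrite val_clamp// unit_intervalP. Qed.

Lemma val_zero : val (zero : I) = 0.
Proof. by rewrite val_clamp// lexx ler01. Qed.

Lemma val_one : val (one : I) = 1.
Proof. by rewrite val_clamp// lexx ler01. Qed.

Lemma clamp0 (r : R) : r <= 0 -> clamp r = zero.
Proof.
move=> r0; apply: val_inj; rewrite val_zero /=.
by rewrite (min_idPr (le_trans r0 ler01)); exact/max_idPl.
Qed.

Lemma clamp1 (r : R) : 1 <= r -> clamp r = one.
Proof.
move=> r1; apply: val_inj; rewrite val_one /=.
by rewrite (min_idPl r1); exact/max_idPr/ler01.
Qed.

Lemma val_unit_continuous : continuous (val : I -> R).
Proof. exact: initial_continuous. Qed.

Lemma clamp_continuous : continuous clamp.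
Proof.
apply/continuousP => _ [B oB <-].
rewrite -comp_preimage; move: B oB; apply/continuousP => r.
apply: continuous_max; first exact: cst_continuous.
by apply: continuous_min; [exact: cst_continuous|by move=> ?; exact: cvg_id].
Qed.

End unit_interval.

Section paste.
Variables (R : realType) (Z T : topologicalType).

Lemma continuous_paste (c : Z -> R) (a : R) (f g : Z -> T) :
  continuous c -> continuous f -> continuous g ->
  (forall z, c z = a -> f z = g z) ->
  continuous (fun z => if c z <= a then f z else g z).
Proof.
move=> cc cf cg fg z U Uz.
have nf : nbhs (f z) U -> nbhs z (f @^-1` U) by move=> /cf.
have ng : nbhs (g z) U -> nbhs z (g @^-1` U) by move=> /cg.
suff : nbhs z [set w | U (if c w <= a then f w else g w)] by [].
move: Uz => /=; case: (ltgtP (c z) a) => [cza /nf Uf|cza /ng Ug|cza Uz].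
- have ca : nbhs z [set w | c w < a] by move: (lt_nbhsl cza) => /cc.
  by apply: filterS2 ca Uf => w /= /ltW ->.
- have ca : nbhs z [set w | a < c w] by move: (lt_nbhsr cza) => /cc.
  by apply: filterS2 ca Ug => w /=; rewrite ltNge => /negbTE ->.
- have := Uz; rewrite fg// => /ng Ug; move: Uz => /nf Uf.
  by apply: filterS2 Uf Ug => w /= ? ?; case: ifP.
Qed.

Lemma continuous_maxr_fun (f g : Z -> R) :
  continuous f -> continuous g -> continuous (fun u => Num.max (f u) (g u)).
Proof. by move=> cf cg u; apply: continuous_max; [exact: cf|exact: cg]. Qed.

Lemma continuous_minr_fun (f g : Z -> R) :
  continuous f -> continuous g -> continuous (fun u => Num.min (f u) (g u)).
Proof. by move=> cf cg u; apply: continuous_min; [exact: cf|exact: cg]. Qed.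

Lemma continuous_pair_fun (U V : topologicalType) (f : Z -> U) (g : Z -> V) :
  continuous f -> continuous g -> continuous (fun z => (f z, g z)).
Proof. by move=> cf cg z; apply: cvg_pair; [exact: cf|exact: cg]. Qed.

End paste.

Section homotopy_classes.
Variables (R : realType) (T : topologicalType).
Local Notation I := (unit_interval R).
Implicit Types x y z : T.

(* Homotopy relative to the endpoints. *)
Definition path_homotopic x y (p q : {path I from x to y in T}) : Prop :=
  exists h : I * I -> T,
    [/\ continuous h,
        forall t, h (zero, t) = p t,
        forall t, h (one, t) = q t &
        forall s, h (s, zero) = x /\ h (s, one) = y].

Definition path_concat_fun x y z (p : {path I from x to y in T})
    (q : {path I from y to z in T}) (t : I) : T :=
  if val t <= 2^-1 then p (clamp (2 * val t)) else q (clamp (2 * val t - 1)).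

Definition path_inverse_fun x y (p : {path I from x to y in T}) (t : I) : T :=
  p (clamp (1 - val t)).

Lemma mul2_half : 2 * 2^-1 = 1 :> R.
Proof. by rewrite mulfV// pnatr_eq0. Qed.

Lemma affine_continuous (Z : topologicalType) (f : Z -> R) (a b : R) :
  continuous f -> continuous (fun u => a * f u + b).
Proof.
move=> cf u; apply: cvgD; last exact: cvg_cst.
by apply: cvgM; [exact: cvg_cst|exact: cf].
Qed.

Lemma cst_mul_continuous (Z : topologicalType) (f : Z -> R) (a : R) :
  continuous f -> continuous (fun u => a * f u).
Proof. by move=> cf u; apply: cvgM; [exact: cvg_cst|exact: cf]. Qed.

Lemma cst_sub_continuous (Z : topologicalType) (f : Z -> R) (a : R) :
  continuous f -> continuous (fun u => a - f u).
Proof. by move=> cf u; apply: cvgB; [exact: cvg_cst|exact: cf]. Qed.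

Lemma val_fst_continuous : continuous (fun st : I * I => val st.1).
Proof.
move=> u; apply: (@continuous_comp _ _ _ (fun st : I * I => st.1) val).
  exact: cvg_fst.
exact: val_unit_continuous.
Qed.

Lemma val_snd_continuous : continuous (fun st : I * I => val st.2).
Proof.
move=> u; apply: (@continuous_comp _ _ _ (fun st : I * I => st.2) val).
  exact: cvg_snd.
exact: val_unit_continuous.
Qed.

Lemma clamp_fun_continuous (Z : topologicalType) (f : Z -> R) :
  continuous f -> continuous (fun u => clamp (f u)).
Proof.
move=> cf u; apply: (@continuous_comp _ _ _ f (@clamp R)); first exact: cf.
exact: clamp_continuous.
Qed.

Lemma clamp_comp_continuous (Z U : topologicalType) (p : I -> U) (f : Z -> R) :
  continuous p -> continuous f -> continuous (fun u => p (clamp (f u))).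
Proof.
move=> cp cf u; apply: (@continuous_comp _ _ _ (fun u => clamp (f u)) p).
  exact: clamp_fun_continuous.
exact: cp.
Qed.

Lemma homotopy_fst_continuous (U : topologicalType) (l : I * I -> U) (f : I * I -> R) :
  continuous l -> continuous f ->
  continuous (fun st => l (clamp (f st), st.2)).
Proof.
move=> cl cf st.
apply: (@continuous_comp _ _ _ (fun st : I * I => (clamp (f st), st.2)) l);
  last exact: cl.
apply: continuous_pair_fun; first exact: clamp_fun_continuous.
by move=> ?; exact: cvg_snd.
Qed.

Lemma homotopy_snd_continuous (U : topologicalType) (l : I * I -> U) (f : I * I -> R) :
  continuous l -> continuous f ->
  continuous (fun st => l (st.1, clamp (f st))).
Proof.
move=> cl cf st.
apply: (@continuous_comp _ _ _ (fun st : I * I => (st.1, clamp (f st))) l);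
  last exact: cl.
apply: continuous_pair_fun; last exact: clamp_fun_continuous.
by move=> ?; exact: cvg_fst.
Qed.

Section operations.
Variables (x y z : T) (p : {path I from x to y in T}) (q : {path I from y to z in T}).

Lemma path_concat_continuous : continuous (path_concat_fun p q).
Proof.
apply: (@continuous_paste R I T val 2^-1).
- exact: val_unit_continuous.
- apply: clamp_comp_continuous; first exact: cts_fun.
  by apply: cst_mul_continuous; exact: val_unit_continuous.
- apply: clamp_comp_continuous; first exact: cts_fun.
  by apply: affine_continuous; exact: val_unit_continuous.
- by move=> t ->; rewrite mul2_half subrr clamp1// clamp0// path_one path_zero.
Qed.

Lemma path_concat_zero : path_concat_fun p q zero = x.
Proof.
by rewrite /path_concat_fun val_zero invr_ge0 ler0n mulr0 clamp0// path_zero.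
Qed.

Lemma path_concat_one : path_concat_fun p q one = z.
Proof.
rewrite /path_concat_fun val_one invf_ge1 ?ltr0n// lern1 /= mulr1.
by rewrite clamp1 ?path_one//; lra.
Qed.

Definition path_concat : {path I from x to z in T} :=
  mk_path path_concat_continuous path_concat_zero path_concat_one.

Lemma path_inverse_continuous : continuous (path_inverse_fun p).
Proof.
apply: clamp_comp_continuous; first exact: cts_fun.
by apply: cst_sub_continuous; exact: val_unit_continuous.
Qed.

Lemma path_inverse_zero : path_inverse_fun p zero = y.
Proof. by rewrite /path_inverse_fun val_zero subr0 clamp1// path_one. Qed.

Lemma path_inverse_one : path_inverse_fun p one = x.
Proof. by rewrite /path_inverse_fun val_one subrr clamp0// path_zero. Qed.

Definition path_inverse : {path I from y to x in T} :=
  mk_path path_inverse_continuous path_inverse_zero path_inverse_one.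

End operations.

Lemma path_homotopic_refl x y (p : {path I from x to y in T}) : path_homotopic p p.
Proof.
exists (fun st => p st.2); split=> // [st|s]; last by rewrite path_zero path_one.
by apply: continuous_comp; [exact: cvg_snd|exact: cts_fun].
Qed.

Lemma path_homotopic_sym x y (p q : {path I from x to y in T}) :
  path_homotopic p q -> path_homotopic q p.
Proof.
case=> h [ch h0 h1 he].
exists (fun st => h (clamp (1 - val st.1), st.2)); split => [|t|t|s]; cbn [fst snd].
- apply: homotopy_fst_continuous => //.
  by apply: cst_sub_continuous; exact: val_fst_continuous.
- by rewrite val_zero subr0 clamp1.
- by rewrite val_one subrr clamp0.
- exact: he.
Qed.

Lemma path_homotopic_trans x y (q p r : {path I from x to y in T}) :
  path_homotopic p q -> path_homotopic q r -> path_homotopic p r.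
Proof.
case=> h [ch h0 h1 he] [k [ck k0 k1 ke]].
exists (fun st => if val st.1 <= 2^-1 then h (clamp (2 * val st.1), st.2)
                  else k (clamp (2 * val st.1 - 1), st.2)).
split => [|t|t|s]; cbn [fst snd].
- apply: continuous_paste => //.
  + exact: val_fst_continuous.
  + apply: homotopy_fst_continuous => //.
    by apply: cst_mul_continuous; exact: val_fst_continuous.
  + apply: homotopy_fst_continuous => //.
    by apply: affine_continuous; exact: val_fst_continuous.
  + by move=> u ->; rewrite mul2_half subrr clamp1// clamp0// h1 k0.
- by rewrite val_zero invr_ge0 ler0n mulr0 clamp0.
- rewrite val_one invf_ge1 ?ltr0n// lern1 /= mulr1.
  by rewrite clamp1//; lra.
- by case: ifP.
Qed.

Lemma path_concat_homotopic x y z (p p' : {path I from x to y in T})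
    (q q' : {path I from y to z in T}) :
  path_homotopic p p' -> path_homotopic q q' ->
  path_homotopic (path_concat p q) (path_concat p' q').
Proof.
case=> h [ch h0 h1 he] [k [ck k0 k1 ke]].
exists (fun st => if val st.2 <= 2^-1 then h (st.1, clamp (2 * val st.2))
                  else k (st.1, clamp (2 * val st.2 - 1))).
split => [|t|t|s]; cbn [fst snd].
- apply: continuous_paste => //.
  + exact: val_snd_continuous.
  + apply: homotopy_snd_continuous => //.
    by apply: cst_mul_continuous; exact: val_snd_continuous.
  + apply: homotopy_snd_continuous => //.
    by apply: affine_continuous; exact: val_snd_continuous.
  + move=> u ->; rewrite mul2_half subrr clamp1// clamp0//.
    by rewrite (he u.1).2 (ke u.1).1.
- by rewrite h0 k0.
- by rewrite h1 k1.
- rewrite val_zero val_one invr_ge0 ler0n mulr0 mulr1 clamp0//.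
  rewrite invf_ge1 ?ltr0n// lern1 /= clamp1; last by lra.
  by rewrite (he s).1 (ke s).2.
Qed.

Lemma path_inverse_homotopic x y (p p' : {path I from x to y in T}) :
  path_homotopic p p' -> path_homotopic (path_inverse p) (path_inverse p').
Proof.
case=> h [ch h0 h1 he].
exists (fun st => h (st.1, clamp (1 - val st.2))); split => [|t|t|s]; cbn [fst snd].
- apply: homotopy_snd_continuous => //.
  by apply: cst_sub_continuous; exact: val_snd_continuous.
- by rewrite h0.
- by rewrite h1.
- rewrite val_zero val_one subr0 subrr clamp1// clamp0//.
  by have [] := he s.
Qed.

Lemma path_reparam_homotopic x y x' y' (p : {path I from x to y in T})
    (f g : R -> R) (a b : {path I from x' to y' in T}) :
  continuous f -> continuous g -> f 0 = g 0 -> f 1 = g 1 ->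
  (forall t, a t = p (clamp (f (val t)))) ->
  (forall t, b t = p (clamp (g (val t)))) ->
  path_homotopic a b.
Proof.
move=> cf cg fg0 fg1 af bg.
exists (fun st => p (clamp (f (val st.2) + val st.1 * (g (val st.2) - f (val st.2))))).
have cc (l : R -> R) : continuous l -> continuous (fun st : I * I => l (val st.2)).
  move=> cl u; apply: (@continuous_comp _ _ _ (fun st : I * I => val st.2) l).
    exact: val_snd_continuous.
  exact: cl.
split => [|t|t|s]; cbn [fst snd].
- apply: clamp_comp_continuous; first exact: cts_fun.
  move=> u; apply: cvgD; first exact: cc.
  apply: cvgM; first exact: val_fst_continuous.
  by apply: cvgB; exact: cc.
- by rewrite val_zero mul0r addr0 -af.
- by rewrite val_one mul1r addrC subrK -bg.
- rewrite val_zero val_one -fg0 -fg1 !subrr mulr0 !addr0.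
  have := af zero; have := af one.
  by rewrite val_zero val_one path_zero path_one => <- <-.
Qed.

Lemma path_concat_clamp x y z (p : {path I from x to y in T})
    (q : {path I from y to z in T}) (u : R) : 0 <= u <= 1 ->
  path_concat p q (clamp u) =
  if u <= 2^-1 then p (clamp (2 * u)) else q (clamp (2 * u - 1)).
Proof. by move=> u01; rewrite /= /mk_path /path_concat_fun val_clamp. Qed.

Lemma path_inverse_clamp x y (p : {path I from x to y in T}) (u : R) : 0 <= u <= 1 ->
  path_inverse p (clamp u) = p (clamp (1 - u)).
Proof. by move=> u01; rewrite /= /mk_path /path_inverse_fun val_clamp. Qed.

Lemma path_concatA x y z w (p : {path I from x to y in T})
    (q : {path I from y to z in T}) (r : {path I from z to w in T}) :
  path_homotopic (path_concat p (path_concat q r)) (path_concat (path_concat p q) r).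
Proof.
pose f (u : R) := Num.min (2 * u) (Num.min (1 * u + 4^-1) (2^-1 * u + 2^-1)).
have ci : continuous (fun u : R => u) by move=> ?; exact: cvg_id.
apply: (@path_reparam_homotopic _ _ _ _ (path_concat p (path_concat q r)) id f).
- exact: ci.
- apply: continuous_minr_fun; first exact: cst_mul_continuous.
  by apply: continuous_minr_fun; exact: affine_continuous.
- by rewrite /f /id; case: (leP (1 * _ + 4^-1)) => ?; case: leP => ?; lra.
- by rewrite /f /id; case: (leP (1 * _ + 4^-1)) => ?; case: leP => ?; lra.
- by move=> t; rewrite clampK.
- move=> t; rewrite -[t in LHS]clampK; have := unit_intervalP t.
  move: (val t) => u u01; rewrite path_concat_clamp//.
  have [u2|u2] := leP u 2^-1; last first.
    have -> : f u = 2^-1 * u + 2^-1 by rewrite /f; case: (leP (1 * _ + 4^-1)) => ?; case: leP => ?; lra.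
    rewrite path_concat_clamp; last by lra.
    rewrite leNgt ifF; last by apply/negbF; lra.
    rewrite path_concat_clamp; last by lra.
    rewrite leNgt ifF; last by apply/negbF; lra.
    by congr (r (clamp _)); lra.
  rewrite path_concat_clamp; last by lra.
  have [u4|u4] := leP (2 * u) 2^-1.
    have -> : f u = 2 * u by rewrite /f; case: (leP (1 * _ + 4^-1)) => ?; case: leP => ?; lra.
    by rewrite path_concat_clamp ?u4//; lra.
  have -> : f u = u + 4^-1 by rewrite /f; case: (leP (1 * _ + 4^-1)) => ?; case: leP => ?; lra.
  rewrite path_concat_clamp; last by lra.
  rewrite leNgt ifF; last by apply/negbF; lra.
  rewrite path_concat_clamp; last by lra.
  rewrite ifT; last by lra.
  by congr (q (clamp _)); lra.
Qed.

Definition cst_path x : {path I from x to x in T} := (cst x : {path I from x to x in T}).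

Lemma path_concat1p x y (p : {path I from x to y in T}) :
  path_homotopic p (path_concat (cst_path x) p).
Proof.
pose f (u : R) := Num.max 0 (2 * u + -1).
have ci : continuous (fun u : R => u) by move=> ?; exact: cvg_id.
apply: (@path_reparam_homotopic _ _ _ _ p id f).
- exact: ci.
- apply: (@continuous_maxr_fun R R (fun=> 0) (fun u => 2 * u + -1)).
    exact: cst_continuous.
  exact: affine_continuous.
- by rewrite /f /id; (repeat case: leP => ?); lra.
- by rewrite /f /id; (repeat case: leP => ?); lra.
- by move=> t; rewrite clampK.
- move=> t; rewrite -[t in LHS]clampK; have := unit_intervalP t.
  move: (val t) => u u01; rewrite path_concat_clamp//.
  have [u2|u2] := leP u 2^-1.
    have -> : f u = 0 by rewrite /f; (repeat case: leP => ?); lra.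
    by rewrite (clamp0 (lexx 0)) path_zero.
  by congr (p (clamp _)); rewrite /f; (repeat case: leP => ?); lra.
Qed.

Lemma path_concatp1 x y (p : {path I from x to y in T}) :
  path_homotopic p (path_concat p (cst_path y)).
Proof.
pose f (u : R) := Num.min 1 (2 * u).
have ci : continuous (fun u : R => u) by move=> ?; exact: cvg_id.
apply: (@path_reparam_homotopic _ _ _ _ p id f).
- exact: ci.
- apply: (@continuous_minr_fun R R (fun=> 1) (fun u => 2 * u)).
    exact: cst_continuous.
  exact: cst_mul_continuous.
- by rewrite /f /id; (repeat case: leP => ?); lra.
- by rewrite /f /id; (repeat case: leP => ?); lra.
- by move=> t; rewrite clampK.
- move=> t; rewrite -[t in LHS]clampK; have := unit_intervalP t.
  move: (val t) => u u01; rewrite path_concat_clamp//.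
  have [u2|u2] := leP u 2^-1.
    by congr (p (clamp _)); rewrite /f; (repeat case: leP => ?); lra.
  have -> : f u = 1 by rewrite /f; (repeat case: leP => ?); lra.
  by rewrite (clamp1 (lexx 1)) path_one.
Qed.

Lemma path_concatpV x y (p : {path I from x to y in T}) :
  path_homotopic (cst_path x) (path_concat p (path_inverse p)).
Proof.
pose f (u : R) := Num.min (2 * u) (- 2 * u + 2).
have ci : continuous (fun u : R => u) by move=> ?; exact: cvg_id.
apply: (@path_reparam_homotopic _ _ _ _ p (fun=> 0) f).
- exact: cst_continuous.
- apply: continuous_minr_fun; first exact: cst_mul_continuous.
  exact: affine_continuous.
- by rewrite /f /id; (repeat case: leP => ?); lra.
- by rewrite /f /id; (repeat case: leP => ?); lra.
- by move=> t; rewrite (clamp0 (lexx 0)) path_zero.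
- move=> t; rewrite -[t in LHS]clampK; have := unit_intervalP t.
  move: (val t) => u u01; rewrite path_concat_clamp//.
  have [u2|u2] := leP u 2^-1.
    by congr (p (clamp _)); rewrite /f; (repeat case: leP => ?); lra.
  rewrite path_inverse_clamp; last by lra.
  by congr (p (clamp _)); rewrite /f; (repeat case: leP => ?); lra.
Qed.

Lemma path_concatVp x y (p : {path I from x to y in T}) :
  path_homotopic (cst_path y) (path_concat (path_inverse p) p).
Proof.
pose f (u : R) := Num.max (- 2 * u + 1) (2 * u + -1).
have ci : continuous (fun u : R => u) by move=> ?; exact: cvg_id.
apply: (@path_reparam_homotopic _ _ _ _ p (fun=> 1) f).
- exact: cst_continuous.
- by apply: continuous_maxr_fun; exact: affine_continuous.
- by rewrite /f /id; (repeat case: leP => ?); lra.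
- by rewrite /f /id; (repeat case: leP => ?); lra.
- by move=> t; rewrite (clamp1 (lexx 1)) path_one.
- move=> t; rewrite -[t in LHS]clampK; have := unit_intervalP t.
  move: (val t) => u u01; rewrite path_concat_clamp//.
  have [u2|u2] := leP u 2^-1; last first.
    by congr (p (clamp _)); rewrite /f; (repeat case: leP => ?); lra.
  rewrite path_inverse_clamp; last by lra.
  by congr (p (clamp _)); rewrite /f; (repeat case: leP => ?); lra.
Qed.

End homotopy_classes.

Section fundamental_group.
Variables (R : realType) (T : topologicalType) (x : T).
Local Notation loop := {path (unit_interval R) from x to x in T}.

Definition loop_rel (p q : loop) : bool := `[< path_homotopic p q >].

Lemma loop_rel_refl : reflexive loop_rel.
Proof. by move=> p; apply/asboolP; exact: path_homotopic_refl. Qed.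

Lemma loop_rel_sym : symmetric loop_rel.
Proof. by move=> p q; apply/asboolP/asboolP; exact: path_homotopic_sym. Qed.

Lemma loop_rel_trans : transitive loop_rel.
Proof.
move=> q p r /asboolP pq /asboolP qr; apply/asboolP.
exact: path_homotopic_trans pq qr.
Qed.

Canonical loop_equiv := EquivRel loop_rel loop_rel_refl loop_rel_sym loop_rel_trans.

Definition fundamental_group : Type := {eq_quot loop_equiv}.

HB.instance Definition _ := Choice.on fundamental_group.
HB.instance Definition _ := EqQuotient.on fundamental_group.

Definition loop_class (p : loop) : fundamental_group := \pi p.

Definition pi1_one : fundamental_group := loop_class (cst_path R x).
Definition pi1_mul (a b : fundamental_group) : fundamental_group :=
  loop_class (path_concat (repr a) (repr b)).
Definition pi1_inv (a : fundamental_group) : fundamental_group :=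
  loop_class (path_inverse (repr a)).

Lemma loop_classP (p q : loop) : loop_class p = loop_class q <-> path_homotopic p q.
Proof.
split => [/eqmodP /asboolP //|pq]; exact/eqmodP/asboolP.
Qed.

Lemma repr_loop_class (p : loop) : path_homotopic (repr (loop_class p)) p.
Proof. by apply/loop_classP; rewrite /loop_class reprK. Qed.

Lemma pi1_mul_class (p q : loop) :
  pi1_mul (loop_class p) (loop_class q) = loop_class (path_concat p q).
Proof.
by apply/loop_classP; apply: path_concat_homotopic; exact: repr_loop_class.
Qed.

Lemma pi1_inv_class (p : loop) :
  pi1_inv (loop_class p) = loop_class (path_inverse p).
Proof. by apply/loop_classP; apply: path_inverse_homotopic; exact: repr_loop_class. Qed.

Lemma loop_class_ind (P : fundamental_group -> Prop) :
  (forall p, P (loop_class p)) -> forall a, P a.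
Proof. by move=> Pp a; rewrite -[a]reprK; exact: Pp. Qed.

Lemma pi1_mulA : associative pi1_mul.
Proof.
elim/loop_class_ind=> p; elim/loop_class_ind=> q; elim/loop_class_ind=> r.
by rewrite !pi1_mul_class; apply/loop_classP; exact: path_concatA.
Qed.

Lemma pi1_mul1 : left_id pi1_one pi1_mul.
Proof.
elim/loop_class_ind=> p; rewrite pi1_mul_class; apply/esym/loop_classP.
exact: path_concat1p.
Qed.

Lemma pi1_mulr1 : right_id pi1_one pi1_mul.
Proof.
elim/loop_class_ind=> p; rewrite pi1_mul_class; apply/esym/loop_classP.
exact: path_concatp1.
Qed.

Lemma pi1_mulV : left_inverse pi1_one pi1_inv pi1_mul.
Proof.
elim/loop_class_ind=> p; rewrite pi1_inv_class pi1_mul_class.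
by apply/esym/loop_classP; exact: path_concatVp.
Qed.

Lemma pi1_mulrV : right_inverse pi1_one pi1_inv pi1_mul.
Proof.
elim/loop_class_ind=> p; rewrite pi1_inv_class pi1_mul_class.
by apply/esym/loop_classP; exact: path_concatpV.
Qed.

HB.instance Definition _ :=
  isGroup.Build fundamental_group pi1_mulA pi1_mul1 pi1_mulr1 pi1_mulV pi1_mulrV.

End fundamental_group.

Arguments fundamental_group R {T} x.

(* A letter [(i, true)] stands for the [i]-th generator and [(i, false)] for its
   inverse. *)
Inductive free_equiv (k : nat) : seq ('I_k * bool) -> seq ('I_k * bool) -> Prop :=
| free_equiv_cancel u v i b :
    free_equiv (u ++ [:: (i, b); (i, ~~ b)] ++ v) (u ++ v)
| free_equiv_refl u : free_equiv u u
| free_equiv_sym u v : free_equiv u v -> free_equiv v u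
| free_equiv_trans u v w : free_equiv u v -> free_equiv v w -> free_equiv u w.

Section free_group.
Variable k : nat.
Local Notation word := (seq ('I_k * bool)).

Definition free_rel (u v : word) : bool := `[< free_equiv u v >].

Lemma free_rel_refl : reflexive free_rel.
Proof. by move=> u; apply/asboolP; exact: free_equiv_refl. Qed.

Lemma free_rel_sym : symmetric free_rel.
Proof. by move=> u v; apply/asboolP/asboolP; exact: free_equiv_sym. Qed.

Lemma free_rel_trans : transitive free_rel.
Proof.
move=> v u w /asboolP uv /asboolP vw; apply/asboolP.
exact: free_equiv_trans uv vw.
Qed.

Canonical free_eqrel := EquivRel free_rel free_rel_refl free_rel_sym free_rel_trans.

Definition free_group : Type := {eq_quot free_eqrel}.

HB.instance Definition _ := Choice.on free_group.
HB.instance Definition _ := EqQuotient.on free_group.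

Definition word_class (u : word) : free_group := \pi u.

Definition word_inv (u : word) : word := rev [seq (a.1, ~~ a.2) | a <- u].

Definition free_one : free_group := word_class [::].
Definition free_mul (a b : free_group) : free_group := word_class (repr a ++ repr b).
Definition free_inv (a : free_group) : free_group := word_class (word_inv (repr a)).

Lemma word_classP (u v : word) : word_class u = word_class v <-> free_equiv u v.
Proof. split => [/eqmodP /asboolP //|uv]; exact/eqmodP/asboolP. Qed.

Lemma repr_word_class (u : word) : free_equiv (repr (word_class u)) u.
Proof. by apply/word_classP; rewrite /word_class reprK. Qed.

Lemma free_equiv_catl (w u v : word) : free_equiv u v -> free_equiv (w ++ u) (w ++ v).
Proof.
elim=> {u v} [u v i b|u|u v _|u v z _ uv _ vz].
- by rewrite [w ++ (u ++ _)]catA [w ++ (u ++ v)]catA; exact: free_equiv_cancel.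
- exact: free_equiv_refl.
- exact: free_equiv_sym.
- exact: free_equiv_trans uv vz.
Qed.

Lemma free_equiv_catr (w u v : word) : free_equiv u v -> free_equiv (u ++ w) (v ++ w).
Proof.
elim=> {u v} [u v i b|u|u v _|u v z _ uv _ vz].
- by rewrite -!catA; exact: free_equiv_cancel.
- exact: free_equiv_refl.
- exact: free_equiv_sym.
- exact: free_equiv_trans uv vz.
Qed.

Lemma free_equiv_inv (u v : word) : free_equiv u v -> free_equiv (word_inv u) (word_inv v).
Proof.
elim=> {u v} [u v i b|u|u v _|u v z _ uv _ vz].
- have -> : word_inv (u ++ [:: (i, b); (i, ~~ b)] ++ v) =
      word_inv v ++ [:: (i, b); (i, ~~ b)] ++ word_inv u.
    by rewrite /word_inv !map_cat !rev_cat -catA /= negbK.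
  have -> : word_inv (u ++ v) = word_inv v ++ word_inv u.
    by rewrite /word_inv map_cat rev_cat.
  exact: free_equiv_cancel.
- exact: free_equiv_refl.
- exact: free_equiv_sym.
- exact: free_equiv_trans uv vz.
Qed.

Lemma free_mul_class (u v : word) :
  free_mul (word_class u) (word_class v) = word_class (u ++ v).
Proof.
apply/word_classP; apply: (@free_equiv_trans _ _ (u ++ repr (word_class v))).
  by apply: free_equiv_catr; exact: repr_word_class.
by apply: free_equiv_catl; exact: repr_word_class.
Qed.

Lemma free_inv_class (u : word) : free_inv (word_class u) = word_class (word_inv u).
Proof. by apply/word_classP; apply: free_equiv_inv; exact: repr_word_class. Qed.

Lemma word_class_ind (P : free_group -> Prop) :
  (forall u, P (word_class u)) -> forall a, P a.
Proof. by move=> Pu a; rewrite -[a]reprK; exact: Pu. Qed.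

Lemma free_mulA : associative free_mul.
Proof.
elim/word_class_ind=> u; elim/word_class_ind=> v; elim/word_class_ind=> w.
by rewrite !free_mul_class catA.
Qed.

Lemma free_mul1 : left_id free_one free_mul.
Proof. by elim/word_class_ind=> u; rewrite free_mul_class. Qed.

Lemma free_mulr1 : right_id free_one free_mul.
Proof. by elim/word_class_ind=> u; rewrite free_mul_class cats0. Qed.

Lemma word_inv_cancel (u : word) : free_equiv (u ++ word_inv u) [::].
Proof.
elim: u => [|[i b] u IHu]; first exact: free_equiv_refl.
rewrite /word_inv /= rev_cons -cats1 /= -[rev _]/(word_inv u).
apply: (@free_equiv_trans _ _ ([::] ++ [:: (i, b); (i, ~~ b)] ++ [::])).
  rewrite -cat1s [u ++ _]catA /= -cat1s; apply: (free_equiv_catl [:: (i, b)]).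
  exact: (free_equiv_catr [:: (i, ~~ b)] IHu).
exact: free_equiv_cancel.
Qed.

Lemma word_invK : involutive word_inv.
Proof.
move=> u; rewrite /word_inv map_rev revK -map_comp -[RHS]map_id.
by apply: eq_map => -[i b] /=; rewrite negbK.
Qed.

Lemma free_mulrV : right_inverse free_one free_inv free_mul.
Proof.
elim/word_class_ind=> u; rewrite free_inv_class free_mul_class.
by apply/word_classP; exact: word_inv_cancel.
Qed.

Lemma free_mulV : left_inverse free_one free_inv free_mul.
Proof.
elim/word_class_ind=> u; rewrite free_inv_class free_mul_class.
by apply/word_classP; rewrite -{2}[u]word_invK; exact: word_inv_cancel.
Qed.

HB.instance Definition _ :=
  isGroup.Build free_group free_mulA free_mul1 free_mulr1 free_mulV free_mulrV.

End free_group.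

Section direct_product.
Local Open Scope group_scope.
Variables (J : finType) (G : J -> groupType).
Local Notation prod := {dffun forall j : J, G j}.

Definition dffun_one : prod := [ffun j : J => (1 : G j)].
Definition dffun_mul (f g : prod) : prod := [ffun j : J => f j * g j].
Definition dffun_inv (f : prod) : prod := [ffun j : J => (f j)^-1].

Lemma dffun_mulA : associative dffun_mul.
Proof. by move=> f g h; apply/ffunP => j; rewrite !ffunE mulgA. Qed.

Lemma dffun_mul1 : left_id dffun_one dffun_mul.
Proof. by move=> f; apply/ffunP => j; rewrite !ffunE mul1g. Qed.

Lemma dffun_mulr1 : right_id dffun_one dffun_mul.
Proof. by move=> f; apply/ffunP => j; rewrite !ffunE mulg1. Qed.

Lemma dffun_mulV : left_inverse dffun_one dffun_inv dffun_mul.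
Proof. by move=> f; apply/ffunP => j; rewrite !ffunE mulVg. Qed.

Lemma dffun_mulrV : right_inverse dffun_one dffun_inv dffun_mul.
Proof. by move=> f; apply/ffunP => j; rewrite !ffunE mulgV. Qed.

HB.instance Definition _ := isGroup.Build {dffun forall j : J, G j}
  dffun_mulA dffun_mul1 dffun_mulr1 dffun_mulV dffun_mulrV.

End direct_product.

(* Both groups carry a lawful group structure, so a multiplicative bijection is
   a group isomorphism. *)
Definition group_isomorphic (G H : groupType) : Prop :=
  exists f : {multiplicative G -> H}, bijective f.

(* The topology of the modulus on the complex numbers. *)
HB.instance Definition _ (R : rcfType) := PseudoPointedMetric.copy R[i] R[i]^o.

Section projective_plane.
Variable R : realType.
Local Notation C := R[i].

Definition homogeneous : Type := set_type [set v : 'rV[C]_3 | v != 0].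

HB.instance Definition _ :=
  Topological.copy homogeneous (set_type [set v : 'rV[C]_3 | v != 0]).

Definition proportional (u v : homogeneous) : bool :=
  `[< exists2 c : C, c != 0 & val u = c *: val v >].

Lemma proportional_refl : reflexive proportional.
Proof. by move=> u; apply/asboolP; exists 1; rewrite ?oner_neq0 ?scale1r. Qed.

Lemma proportional_sym : symmetric proportional.
Proof.
have H u v : proportional u v -> proportional v u.
  move=> /asboolP[c c0 uv]; apply/asboolP; exists c^-1; first by rewrite invr_eq0.
  by rewrite uv scalerA mulVf// scale1r.
by move=> u v; apply/idP/idP; exact: H.
Qed.

Lemma proportional_trans : transitive proportional.
Proof.
move=> v u w /asboolP[c c0 uv] /asboolP[d d0 vw]; apply/asboolP.
by exists (c * d); rewrite ?mulf_neq0// uv vw scalerA.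
Qed.

Canonical proportional_equiv :=
  EquivRel proportional proportional_refl proportional_sym proportional_trans.

Definition CP2 : Type := quotient_topology {eq_quot proportional_equiv}.

HB.instance Definition _ := Topological.on CP2.
HB.instance Definition _ := Quotient.on CP2.

Definition coordinates (p : CP2) : 'rV[C]_3 := val (repr p : homogeneous).

(* By [line_ofE] below, membership does not depend on the representative chosen
   by [coordinates]. *)
Definition line_of (a : 'rV[C]_3) : set CP2 :=
  [set p | \sum_(i < 3) a 0 i * coordinates p 0 i = 0].

Lemma line_ofE (a : 'rV[C]_3) (v : homogeneous) :
  line_of a (\pi v) <-> \sum_(i < 3) a 0 i * val v 0 i = 0.
Proof.
rewrite /line_of /= /coordinates.
have /eqmodP/asboolP[c c0 ->] : repr (\pi v : CP2) = v %[mod_eq proportional_equiv].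
  exact: (@reprK _ CP2).
under eq_bigr do rewrite mxE mulrCA.
rewrite -big_distrr /=; split=> [/eqP|->]; last by rewrite mulr0.
by rewrite mulf_eq0 (negbTE c0) /= => /eqP.
Qed.

Definition projective_line (l : set CP2) : Prop :=
  exists2 a : 'rV[C]_3, a != 0 & l = line_of a.

Definition real_projective_line (l : set CP2) : Prop :=
  exists2 a : 'rV[R]_3, a != 0 & l = line_of (map_mx (real_complex R) a).

(* An arrangement is its set of lines; the corresponding subset of the plane is
   [\bigcup_(l in A) l]. *)
Definition real_line_arrangement (A : set (set CP2)) : Prop :=
  finite_set A /\ (forall l, A l -> real_projective_line l).

Definition pencil (A : set (set CP2)) (p : CP2) : set (set CP2) :=
  [set l | A l /\ l p].

Definition multiplicity (A : set (set CP2)) (p : CP2) : nat :=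
  #|` fset_set (pencil A p)|.

Definition simple_point (A : set (set CP2)) (p : CP2) : Prop :=
  multiplicity A p = 2%N.

Definition multiple_point (A : set (set CP2)) (p : CP2) : Prop :=
  (2 < multiplicity A p)%N.

(* The [i]-th subset of lines is [pencil A (P i)]; it has [(k i).+1] elements
   and contains [L] since [L] passes through [P i]. *)
Definition collinear_multiple_points (A : set (set CP2)) (t : nat)
    (P : 'I_t -> CP2) (k : 'I_t -> nat) : Prop :=
  [/\ injective P,
      range P = multiple_point A,
      forall i, multiplicity A (P i) = (k i).+1 &
      exists L : set CP2,
        [/\ A L,
            forall i, L (P i),
            A = \bigcup_i pencil A (P i) &
            forall i j l m p, i <> j ->
              pencil A (P i) l -> pencil A (P j) m -> l <> L -> m <> L ->
              l p -> m p -> simple_point A p /\ ~ L p]].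

End projective_plane.

(* Main.v *)
(* The line [L] is taken as the line at infinity: [CP2] minus [L] is an affine
   plane in which the lines of the [i]-th pencil are parallel, say
   [form i = al] for [k i] real values [al], and [H] becomes one further line,
   of a family [form 0 = 0].  No two families are parallel and no three lines
   of distinct families meet, and the claim is that the maps [form i] induce an
   isomorphism from the fundamental group of the complement [X] to the product
   of the groups of the punctured planes [C \ {al}], which are free of rank
   [k i] (and of rank 1 for [H]).

   Surjectivity: a loop of the [i]-th punctured plane lifts along a section of
   [form i] that avoids the other families, and on this section the loop is
   null-homotopic in the complement of those families.

   Injectivity, by induction on the number of families: with [u = form i] as
   first coordinate, the other lines are graphs [v = g j u], and [X'] is their
   complement.  The section [u |-> (u, roof u)] passes above all graphs.  By
   transport of fibers, every loop of [X] is a product of the section over its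
   projection and of a loop in the fiber over a base point [u0]; the group of
   the section commutes with that of the fiber, because the punctures [al] are
   values over which the graphs do not meet, so that the fibration is trivial
   around them.  Hence the fiber component is an endomorphism of [pi_1 X]
   that kills the loops around the lines [u = al].  It thus factors through
   [pi_1 X'], and a loop of [X] which is trivial in [X'] and whose projection
   is trivial is trivial in [X]. *)
Require Import Defs.
From HB Require Import structures.
From mathcomp Require Import all_boot all_order all_algebra.
From mathcomp Require Import finmap interval_inference complex ring lra.
From mathcomp Require Import all_classical all_reals topology normedtype homotopy.

Set Implicit Arguments.
Unset Strict Implicit.
Unset Printing Implicit Defensive.

Import Order.TTheory GRing.Theory Num.Theory.
Import numFieldNormedType.Exports.

Local Open Scope classical_set_scope.
Local Open Scope ring_scope.

Local Notation Re := complex.Re.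
Local Notation Im := complex.Im.

(** * Paths and path functionals *)

Section continuity.
Variables (Z : topologicalType).

(** The fundamental groupoid is handled through weights: group-valued functionals on paths,
    invariant under homotopy and multiplicative under concatenation. In place of the Seifert-van
    Kampen theorem there is one gluing principle, [approx_homotopic]: a cocycle on the members of an
    open cover yields a homotopy invariant of paths. The cocycle is only asked on a dense subset
    [D]. With [D = O] this produces [winding], with values in a free group; with [D = X] inside
    [O = X'] it handles the fiber component, which is defined off the vertical lines only, along
    homotopies that cross them. The obstacle is that the graphs do meet, over a finite set [K],
    where fibers cannot be transported. Loops are therefore pushed off [K], and the base point is
    chosen so that the segments from it to the punctures avoid [K]. That no puncture is in [K] comes
    from the absence of triple points. Real equations place the punctures of each family on the real
    axis, where the gaps between them index the generators; [H] may be a complex line, since its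
    only level is 0. *)

Lemma contC (T : topologicalType) (a : T) : continuous (fun _ : Z => a).
Proof. by move=> z; exact: cvg_cst. Qed.

Lemma cont_id : continuous (fun z : Z => z).
Proof. by move=> z; exact: cvg_id. Qed.

Lemma cont_comp (T U : topologicalType) (f : Z -> T) (g : T -> U) :
  continuous f -> continuous g -> continuous (fun z => g (f z)).
Proof. by move=> cf cg z; apply: (@continuous_comp _ _ _ f g); [exact: cf|exact: cg]. Qed.

Lemma cont_fst (T U : topologicalType) (f : Z -> T * U) :
  continuous f -> continuous (fun z => (f z).1).
Proof. by move=> cf; apply: cont_comp cf _ => x; exact: cvg_fst. Qed.

Lemma cont_snd (T U : topologicalType) (f : Z -> T * U) :
  continuous f -> continuous (fun z => (f z).2).
Proof. by move=> cf; apply: cont_comp cf _ => x; exact: cvg_snd. Qed.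

Lemma contD (K : numFieldType) (V : normedModType K) (f g : Z -> V) :
  continuous f -> continuous g -> continuous (fun z => f z + g z).
Proof. by move=> cf cg z; apply: cvgD; [exact: cf|exact: cg]. Qed.

Lemma contN (K : numFieldType) (V : normedModType K) (f : Z -> V) :
  continuous f -> continuous (fun z => - f z).
Proof. by move=> cf z; apply: cvgN; exact: cf. Qed.

Lemma contM (K : numFieldType) (f g : Z -> K) :
  continuous f -> continuous g -> continuous (fun z => f z * g z).
Proof. by move=> cf cg z; apply: cvgM; [exact: cf|exact: cg]. Qed.

Lemma cont_norm (K : numFieldType) (f : Z -> K) :
  continuous f -> continuous (fun z => `|f z|).
Proof. by move=> cf z; apply: cvg_norm; exact: cf. Qed.

Lemma cont_max (R : realType) (f g : Z -> R) :
  continuous f -> continuous g -> continuous (fun z => Num.max (f z) (g z)).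
Proof. exact: continuous_maxr_fun. Qed.

Lemma cont_min (R : realType) (f g : Z -> R) :
  continuous f -> continuous g -> continuous (fun z => Num.min (f z) (g z)).
Proof. exact: continuous_minr_fun. Qed.

Lemma cont_pair (T U : topologicalType) (f : Z -> T) (g : Z -> U) :
  continuous f -> continuous g -> continuous (fun z => (f z, g z)).
Proof. exact: continuous_pair_fun. Qed.

End continuity.

(* Dispatching on the head symbol avoids the conversion tests that blind
   [apply] would trigger. *)
Ltac cont := repeat (cbv beta; lazymatch goal with
  | |- continuous (fun _ => ?a) => exact: contC
  | |- continuous (fun z => z) => exact: cont_id
  | |- continuous (fun _ => (_ + _)%R) => apply: contD
  | |- continuous (fun _ => (- _)%R) => apply: contN
  | |- continuous (fun _ => (_ * _)%R) => apply: contM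
  | |- continuous (fun _ => `|_|%R) => apply: cont_norm
  | |- continuous (fun _ => Num.max _ _) => apply: cont_max
  | |- continuous (fun _ => Num.min _ _) => apply: cont_min
  | |- continuous (fun _ => (_, _)) => apply: cont_pair
  | |- continuous (fun _ => fst _) => apply: cont_fst
  | |- continuous (fun _ => snd _) => apply: cont_snd
  | |- continuous ?f =>
      first [ assumption
            | lazymatch f with (fun _ => _) => fail | _ =>
                change (continuous (fun z => f z)) end ]
  end).

(* Paths and homotopies are total functions on [R] and [R * R]; only their
   restrictions to the unit interval and the unit square matter. *)
Section paths.
Variables (R : realType) (T : topologicalType).
Implicit Types (O : set T) (p q : R -> T).

(** Membership in [O] is asked at every real [t]: precomposing with any continuous real function
    then gives a path again, without range conditions. *)
Definition is_path O p := continuous p /\ forall t, O (p t).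

Definition homotopic O p q := exists H : R * R -> T,
  [/\ continuous H, forall z, O (H z),
      forall t, 0 <= t <= 1 -> H (0, t) = p t /\ H (1, t) = q t &
      forall s, 0 <= s <= 1 -> H (s, 0) = p 0 /\ H (s, 1) = p 1].

Definition pcat p q (t : R) := if t <= 2^-1 then p (2 * t) else q (2 * t - 1).
Definition preverse p (t : R) := p (1 - t).
Definition psub p (a b t : R) := p (a + (b - a) * t).

Lemma pcat0 p q : pcat p q 0 = p 0.
Proof. by rewrite /pcat invr_ge0 ler0n mulr0. Qed.

Lemma pcat1 p q : pcat p q 1 = q 1.
Proof. by rewrite /pcat ifF; [congr q; lra | apply/negbTE; rewrite -ltNge; lra]. Qed.

Lemma psub0 p a b : psub p a b 0 = p a.
Proof. by rewrite /psub; congr p; lra. Qed.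

Lemma psub1 p a b : psub p a b 1 = p b.
Proof. by rewrite /psub; congr p; lra. Qed.

Lemma preverse0 p : preverse p 0 = p 1. Proof. by rewrite /preverse subr0. Qed.
Lemma preverse1 p : preverse p 1 = p 0. Proof. by rewrite /preverse subrr. Qed.

Lemma is_path_sub O O' p : O `<=` O' -> is_path O p -> is_path O' p.
Proof. by move=> OO' [cp Op]; split=> // t; exact: OO'. Qed.

Lemma is_path_cst O x : O x -> is_path O (fun=> x).
Proof. by move=> Ox; split=> //; exact: contC. Qed.

Lemma is_path_pcat O p q : is_path O p -> is_path O q -> p 1 = q 0 ->
  is_path O (pcat p q).
Proof.
move=> [cp Op] [cq Oq] pq; split=> [|t]; last by rewrite /pcat; case: ifP.
apply: (@continuous_paste R R T id) => [||| t ->].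
- exact: cont_id.
- by apply: cont_comp cp; cont.
- by apply: cont_comp cq; cont.
- by rewrite mulfV ?pnatr_eq0// subrr.
Qed.

Lemma is_path_comp O p (f : R -> R) : is_path O p -> continuous f ->
  is_path O (fun t => p (f t)).
Proof. by move=> [cp Op] cf; split=> //; exact: cont_comp cf cp. Qed.

Lemma is_path_preverse O p : is_path O p -> is_path O (preverse p).
Proof. by move=> hp; apply: is_path_comp hp _; cont. Qed.

Lemma is_path_psub O p a b : is_path O p -> is_path O (psub p a b).
Proof. by move=> hp; apply: is_path_comp hp _; cont. Qed.

Lemma homotopic_refl O p : is_path O p -> homotopic O p p.
Proof.
move=> [cp Op]; exists (fun z => p z.2); split=> //.
by apply: cont_comp cp; cont.
Qed.

Lemma homotopic_sub O O' p q : O `<=` O' -> homotopic O p q -> homotopic O' p q.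
Proof. by move=> OO' [H [? h ? ?]]; exists H; split=> // z; exact: OO'. Qed.

Lemma homotopic_reparam O p (f g : R -> R) : is_path O p -> continuous f ->
  continuous g -> f 0 = g 0 -> f 1 = g 1 ->
  homotopic O (fun t => p (f t)) (fun t => p (g t)).
Proof.
move=> [cp Op] cf cg fg0 fg1.
exists (fun z => p ((1 - z.1) * f z.2 + z.1 * g z.2)); split=> //= [|t _|s _].
- apply: cont_comp cp; cont; first by apply: cont_comp cf; cont.
  by apply: cont_comp cg; cont.
- by rewrite subr0 mul1r mul0r addr0 subrr mul0r add0r mul1r.
- by rewrite fg0 fg1; split; congr p; lra.
Qed.

Lemma homotopic_ext O p q p' q' :
  (forall t, 0 <= t <= 1 -> p t = p' t) -> (forall t, 0 <= t <= 1 -> q t = q' t) ->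
  homotopic O p q -> homotopic O p' q'.
Proof.
move=> pp qq [H [cH HO H01 Hx]]; exists H; split=> //.
  by move=> t t01; rewrite -pp// -qq//; exact: H01.
by move=> s s01; rewrite -!pp ?lexx ?ler01//; exact: Hx.
Qed.

End paths.

Lemma homotopic_comp (R : realType) (T U : topologicalType) (O : set T) (V : set U)
    (f : T -> U) (p q : R -> T) :
  continuous f -> (forall x, O x -> V (f x)) ->
  homotopic O p q -> homotopic V (f \o p) (f \o q).
Proof.
move=> cf OV [H [cH HO H01 Hx]]; exists (f \o H); split.
- exact: cont_comp cH cf.
- by move=> z; exact/OV.
- by move=> t /H01[/= -> ->].
- by move=> s /Hx[/= -> ->].
Qed.

Lemma is_path_map (R : realType) (T U : topologicalType) (O : set T) (V : set U)
    (f : T -> U) (p : R -> T) :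
  continuous f -> (forall x, O x -> V (f x)) -> is_path O p -> is_path V (f \o p).
Proof.
by move=> cf OV [cp Op]; split=> [|t]; [exact: cont_comp cp cf|exact: OV].
Qed.

(* A path functional that factors through the fundamental groupoid. *)
Section weights.
Local Open Scope group_scope.
Variables (R : realType) (T : topologicalType) (O : set T) (G : groupType).
Implicit Types (p q : R -> T) (W : (R -> T) -> G).

Definition weight W :=
  (forall p q, is_path O p -> is_path O q -> homotopic O p q -> W p = W q) /\
  (forall p q, is_path O p -> is_path O q -> p 1%R = q 0%R ->
     W (pcat p q) = W p * W q).

Variable W : (R -> T) -> G.
Hypothesis wW : weight W.

Lemma weight_ext p q : is_path O p -> is_path O q ->
  (forall t, (0 <= t <= 1)%R -> p t = q t) -> W p = W q.
Proof.
move=> hp hq pq; apply: wW.1 => //.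
by apply: homotopic_ext (homotopic_refl hp) => // t t01; rewrite pq.
Qed.

(** The constant path is literally its own concatenation, so its weight is idempotent. *)
Lemma weight_cst x : O x -> W (fun=> x) = 1.
Proof.
move=> Ox; apply: (@mulgI _ (W (fun=> x))); rewrite mulg1 -wW.2//; try exact: is_path_cst.
by congr W; apply/funext => t; rewrite /pcat; case: ifP.
Qed.

Lemma weight_reparam p (f g : R -> R) : is_path O p -> continuous f ->
  continuous g -> f 0%R = g 0%R -> f 1%R = g 1%R ->
  W (fun t => p (f t)) = W (fun t => p (g t)).
Proof.
move=> hp cf cg fg0 fg1; apply: wW.1; try exact: is_path_comp.
exact: homotopic_reparam.
Qed.

(** Both sides come from [p] by reparametrizations with the same ends, whatever the order of [a],
    [b], [c]; the case [c = a] yields the weight of a reversed path. *)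
Lemma weight_psub p a b c : is_path O p ->
  W (psub p a c) = W (psub p a b) * W (psub p b c).
Proof.
move=> hp; rewrite -wW.2; try exact: is_path_psub; last by rewrite psub0 psub1.
pose f (t : R) := (a + (c - a) * t)%R.
pose g (t : R) := (a + (b - a) * Num.min (2 * t) 1 + (c - b) * Num.max (2 * t - 1) 0)%R.
rewrite (_ : pcat _ _ = fun t => p (g t)); last first.
  apply/funext => t; rewrite /pcat /psub /g; case: leP => t2; congr p.
    by rewrite min_l ?max_r; lra.
  by rewrite min_r ?max_l; lra.
apply: (@weight_reparam p f g hp); rewrite /f /g.
- by cont.
- by cont.
- by rewrite min_l ?max_r; lra.
- by rewrite min_r ?max_l; lra.
Qed.

Lemma weight_psub_refl p a : is_path O p -> W (psub p a a) = 1.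
Proof.
by move=> hp; apply: (@mulgI _ (W (psub p a a))); rewrite mulg1 -weight_psub.
Qed.

Lemma weight_psub01 p : W (psub p 0%R 1%R) = W p.
Proof. by congr W; apply/funext => t; rewrite /psub; congr p; lra. Qed.

Lemma weight_preverse p : is_path O p -> W (preverse p) = (W p)^-1.
Proof.
move=> hp; apply: (@mulgI _ (W p)); rewrite mulgV -(weight_psub01 p).
rewrite (_ : preverse p = psub p 1%R 0%R); last first.
  by apply/funext => t; rewrite /preverse /psub; congr p; lra.
by rewrite -weight_psub// weight_psub_refl.
Qed.

(* The subdivision points are [i/n]; they need not stay in [0, 1]. *)
Lemma weight_subdiv p n : is_path O p -> (0 < n)%N ->
  W p = \prod_(0 <= i < n) W (psub p (i%:R / n%:R)%R (i.+1%:R / n%:R)%R).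
Proof.
move=> hp n0; rewrite -weight_psub01.
suff H m : W (psub p 0%R (m%:R / n%:R)%R) =
    \prod_(0 <= i < m) W (psub p (i%:R / n%:R)%R (i.+1%:R / n%:R)%R).
  by rewrite -H divff// pnatr_eq0 -lt0n.
elim: m => [|m IHm]; first by rewrite big_geq// mul0r weight_psub_refl.
by rewrite big_nat_recr//= -IHm -weight_psub.
Qed.

Lemma weight_square (H : R * R -> T) : continuous H -> (forall z, O (H z)) ->
  W (fun t => H (0, t)%R) * W (fun s => H (s, 1)%R) =
  W (fun s => H (s, 0)%R) * W (fun t => H (1, t)%R).
Proof.
move=> cH HO.
(* [m] rises during the first half and [M] during the second, so [(M, m)] and [(m, M)] trace the two
   routes around the square; a straight-line homotopy of the parameters joins them. *)
pose m (t : R) : R := Num.min (2 * t)%R 1%R.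
pose M (t : R) : R := Num.max (2 * t - 1)%R 0%R.
have hH (f g : R -> R) : continuous f -> continuous g -> is_path O (fun t => H (f t, g t)).
  by move=> cf cg; split=> // t; apply: cont_comp cH _; cont.
have cm : continuous m by rewrite /m; cont.
have cM : continuous M by rewrite /M; cont.
rewrite -!wW.2//; try (by apply: hH; cont).
rewrite (@weight_ext _ (fun t => H (M t, m t))); last 3 first.
- by apply: (is_path_pcat (p := fun t => H (0, t)%R) (q := fun t => H (t, 1)%R)) => //;
    apply: hH; cont.
- exact: hH.
- move=> t t01; rewrite /pcat /M /m; case: leP => t2.
    by rewrite min_l ?max_r//; lra.
  by rewrite min_r ?max_l//; lra.
rewrite (@weight_ext (pcat _ _) (fun t => H (m t, M t))); last 3 first.
- by apply: (is_path_pcat (p := fun t => H (t, 0)%R) (q := fun t => H (1, t)%R)) => //;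
    apply: hH; cont.
- exact: hH.
- move=> t t01; rewrite /pcat /M /m; case: leP => t2.
    by rewrite min_l ?max_r//; lra.
  by rewrite min_r ?max_l//; lra.
apply: wW.1; try exact: hH.
exists (fun z => H ((1 - z.1) * M z.2 + z.1 * m z.2,
                    (1 - z.1) * m z.2 + z.1 * M z.2)%R); split=> //= [|t _|s _].
- by apply: cont_comp cH; cont; (apply: cont_comp; [|exact: cm || exact: cM]); cont.
- by split; congr (H (_, _)); ring.
- have [m0 m1 M0 M1] : [/\ m 0 = 0, m 1 = 1, M 0 = 0 & M 1 = 1]%R.
    by rewrite /m /M; split; [rewrite min_l|rewrite min_r|rewrite max_r|rewrite max_l]; lra.
  by rewrite m0 m1 M0 M1; split; congr (H (_, _)); ring.
Qed.

End weights.

(** * Fundamental groups through charts *)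

Section class_weight.
Variables (R : realType) (T X : topologicalType) (O : set T).
Local Notation I := (unit_interval R).

(* [e] embeds [X] in [T] with image [O]; continuity of its inverse [d] is only
   asked along maps with values in [O], as [d] is junk elsewhere. *)
Definition chart (e : X -> T) (d : T -> X) :=
  [/\ continuous e, forall x, O (e x), cancel e d, {in O, cancel d e} &
      forall (Z : topologicalType) (f : Z -> T),
        continuous f -> (forall z, O (f z)) -> continuous (fun z => d (f z))].

Lemma path_homotopic_catA (x y z w : X) (p : {path I from x to y in X})
    (q : {path I from y to z in X}) (r : {path I from z to w in X}) :
  path_homotopic (path_concat (path_concat p q) r) (path_concat p (path_concat q r)).
Proof. exact/path_homotopic_sym/path_concatA. Qed.

Lemma path_concat_cancel (x y z w : X) (p : {path I from x to y in X})
    (b : {path I from w to y in X}) (q : {path I from y to z in X}) :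
  path_homotopic (path_concat (path_concat p (path_inverse b)) (path_concat b q))
    (path_concat p q).
Proof.
apply: path_homotopic_trans (path_homotopic_catA _ _ _) _.
apply: path_concat_homotopic; first exact: path_homotopic_refl.
apply: path_homotopic_trans (path_concatA _ _ _) _.
apply: path_homotopic_trans (path_homotopic_sym (path_concat1p q)).
apply: path_concat_homotopic; last exact: path_homotopic_refl.
exact/path_homotopic_sym/path_concatVp.
Qed.

Variables (x0 : X) (beta : forall x : X, {path I from x0 to x in X}).
Local Notation G := (fundamental_group R x0).

(** The tails [beta] give a class to every path, not only to loops at [x0]. They are arbitrary:
    [beta x0] may be nontrivial, which costs a conjugation in [class_weight_surj]. *)
Definition path_class x y (p : {path I from x to y in X}) : G :=
  loop_class (path_concat (path_concat (beta x) p) (path_inverse (beta y))).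

Lemma path_class_homotopic x y (p q : {path I from x to y in X}) :
  path_homotopic p q -> path_class p = path_class q.
Proof.
move=> pq; apply/loop_classP.
by do !apply: path_concat_homotopic => //; exact: path_homotopic_refl.
Qed.

Lemma path_class_concat x y z (p : {path I from x to y in X})
    (q : {path I from y to z in X}) :
  path_class (path_concat p q) = (path_class p * path_class q)%g.
Proof.
rewrite /path_class [RHS]pi1_mul_class; apply/esym/loop_classP.
apply: path_homotopic_trans (path_concatA _ _ _) _.
apply: path_concat_homotopic; last exact: path_homotopic_refl.
apply: path_homotopic_trans (path_concat_cancel _ _ _) _.
exact: path_homotopic_catA.
Qed.

Lemma path_class_ext x y x' y' (p : {path I from x to y in X})
    (q : {path I from x' to y' in X}) : p =1 q -> path_class p = path_class q.
Proof.
move=> pq.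
have xx : x = x' by rewrite -(@path_zero _ _ _ _ p) -(@path_zero _ _ _ _ q) pq.
have yy : y = y' by rewrite -(@path_one _ _ _ _ p) -(@path_one _ _ _ _ q) pq.
by subst x' y'; congr path_class; apply/path_eqP.
Qed.

Lemma path_class_inj x y (p q : {path I from x to y in X}) :
  path_class p = path_class q -> path_homotopic p q.
Proof.
move=> /loop_classP pq.
have H (r : {path I from x to y in X}) : path_homotopic
    (path_concat (path_concat (path_inverse (beta x))
      (path_concat (path_concat (beta x) r) (path_inverse (beta y)))) (beta y)) r.
  apply: path_homotopic_trans (path_homotopic_sym (path_concatp1 r)).
  apply: path_homotopic_trans (path_homotopic_catA _ _ _) _.
  apply: (@path_homotopic_trans _ _ _ _ (path_concat (path_inverse (beta x))
     (path_concat (beta x) r))).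
    apply: path_concat_homotopic; first exact: path_homotopic_refl.
    apply: path_homotopic_trans (path_homotopic_catA _ _ _) _.
    apply: path_homotopic_trans (path_homotopic_sym (path_concatp1 _)).
    apply: path_concat_homotopic; first exact: path_homotopic_refl.
    exact/path_homotopic_sym/path_concatVp.
  apply: path_homotopic_trans (path_concatA _ _ _) _.
  apply: path_homotopic_trans (path_concatp1 r).
  apply: path_homotopic_trans (path_homotopic_sym (path_concat1p r)).
  apply: path_concat_homotopic; last exact: path_homotopic_refl.
  exact/path_homotopic_sym/path_concatVp.
apply: path_homotopic_trans (path_homotopic_sym (H p)) _.
apply: path_homotopic_trans (H q).
by do !apply: path_concat_homotopic => //; exact: path_homotopic_refl.
Qed.

Variables (e : X -> T) (d : T -> X).
Hypothesis ch : chart e d.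

Lemma bundle_continuous p : is_path O p -> continuous (fun t : I => d (p (val t))).
Proof.
move=> [cp Op]; have [_ _ _ _ cd] := ch.
apply: (cd _ (fun t : I => p (val t))) => //.
by apply: cont_comp cp; exact: val_unit_continuous.
Qed.

Definition bundle p (hp : is_path O p) : {path I from d (p 0%R) to d (p 1%R) in X} :=
  mk_path (bundle_continuous hp) (congr1 (d \o p) (val_zero R))
    (congr1 (d \o p) (val_one R)).

Definition class_weight p : G :=
  if pselect (is_path O p) is left hp then path_class (bundle hp) else 1%g.

Lemma class_weight_bundle p (hp : is_path O p) x y (q : {path I from x to y in X}) :
  (forall t, q t = d (p (val t))) -> class_weight p = path_class q.
Proof.
move=> qp; rewrite /class_weight; case: pselect => // hp'.
by apply: path_class_ext => t; rewrite qp.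
Qed.

Lemma hom_homotopic p q (hp : is_path O p) (hq : is_path O q) x y
    (P Q : {path I from x to y in X}) :
  (forall t, P t = d (p (val t))) -> (forall t, Q t = d (q (val t))) ->
  homotopic O p q -> path_homotopic P Q.
Proof.
move=> Pp Qq [H [cH HO H01 Hx]]; have [_ _ _ _ cd] := ch.
exists (fun st => d (H (val st.1, val st.2))); split => [|t|t|s]; cbn [fst snd].
- apply: (cd _ (fun st : I * I => H (val st.1, val st.2))) => //.
  apply: cont_comp cH; apply: cont_pair; [exact: val_fst_continuous|].
  exact: val_snd_continuous.
- by rewrite Pp val_zero (H01 _ (unit_intervalP t)).1.
- by rewrite Qq val_one (H01 _ (unit_intervalP t)).2.
- have [H0 H1] := Hx _ (unit_intervalP s).
  have := path_zero (s := P); have := path_one (s := P).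
  by rewrite !Pp val_zero val_one H0 H1 => -> ->.
Qed.

Lemma homotopic_hom p q (hp : is_path O p) (hq : is_path O q) x y
    (P Q : {path I from x to y in X}) :
  (forall t, P t = d (p (val t))) -> (forall t, Q t = d (q (val t))) ->
  path_homotopic P Q -> homotopic O p q.
Proof.
move=> Pp Qq [h [ch' h0 h1 hx]]; have [ce Oe eK dK _] := ch.
have eP t : (0 <= t <= 1)%R -> e (P (clamp t)) = p t.
  by move=> t01; rewrite Pp val_clamp// dK// inE; exact: hp.2.
have eQ t : (0 <= t <= 1)%R -> e (Q (clamp t)) = q t.
  by move=> t01; rewrite Qq val_clamp// dK// inE; exact: hq.2.
exists (fun z => e (h (clamp z.1, clamp z.2))); split=> [|z|t t01|s _] //; cbn [fst snd].
- apply: (@cont_comp _ _ _ (fun z : R * R => h (clamp z.1, clamp z.2))) => //.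
  apply: (@cont_comp _ _ _ (fun z : R * R => (clamp z.1, clamp z.2))) => //.
  by cont; apply: clamp_fun_continuous; cont.
- by rewrite (clamp0 (lexx 0)) (clamp1 (lexx 1)) h0 h1 eP// eQ.
- rewrite (clamp0 (lexx 0)) (clamp1 (lexx 1)) (hx _).1 (hx _).2.
  rewrite -eP ?lexx ?ler01// -eP ?lexx ?ler01//.
  by rewrite (clamp0 (lexx 0)) (clamp1 (lexx 1)) path_zero path_one.
Qed.

Lemma class_weightP : weight O class_weight.
Proof.
split=> p q hp hq.
  move=> pq; have [H [_ _ H01 Hx]] := pq.
  have h01 : (0 <= 1 :> R)%R by exact: ler01.
  have p0 : p 0%R = q 0%R.
    by rewrite -(H01 0%R _).2 ?lexx// (Hx 1%R _).1// lexx h01.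
  have p1 : p 1%R = q 1%R.
    by rewrite -(H01 1%R _).2 ?lexx ?h01// (Hx 1%R _).2// lexx h01.
  have cb := bundle_continuous hq.
  (* [q] is repackaged with the endpoints of [p], since [path_homotopic] compares two inhabitants of
     one path type. *)
  pose Q : {path I from d (p 0%R) to d (p 1%R) in X} := mk_path cb
    (etrans (congr1 (d \o q) (val_zero R)) (congr1 d (esym p0)))
    (etrans (congr1 (d \o q) (val_one R)) (congr1 d (esym p1))).
  rewrite (class_weight_bundle hp (q := bundle hp))//.
  rewrite (class_weight_bundle hq (q := Q))//.
  by apply: path_class_homotopic; exact: (hom_homotopic hp hq).
move=> pq; have hc := is_path_pcat hp hq pq.
have cb := bundle_continuous hq.
pose Q : {path I from d (p 1%R) to d (q 1%R) in X} := mk_path cb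
  (etrans (congr1 (d \o q) (val_zero R)) (congr1 d (esym pq)))
  (congr1 (d \o q) (val_one R)).
rewrite (class_weight_bundle hp (q := bundle hp))//.
rewrite (class_weight_bundle hq (q := Q))// -path_class_concat.
apply: class_weight_bundle => // t.
have t01 := unit_intervalP t.
have bE u : bundle hp u = d (p (val u)) by [].
have QE u : Q u = d (q (val u)) by [].
rewrite -[LHS]/(path_concat_fun (bundle hp) Q t) /path_concat_fun /pcat.
by case: leP => t2; rewrite ?bE ?QE val_clamp//; lra.
Qed.

Lemma class_weight_inj p q : is_path O p -> is_path O q -> p 0%R = q 0%R ->
  p 1%R = q 1%R -> class_weight p = class_weight q -> homotopic O p q.
Proof.
move=> hp hq p0 p1; have cb := bundle_continuous hq.
pose Q : {path I from d (p 0%R) to d (p 1%R) in X} := mk_path cb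
  (etrans (congr1 (d \o q) (val_zero R)) (congr1 d (esym p0)))
  (etrans (congr1 (d \o q) (val_one R)) (congr1 d (esym p1))).
rewrite (class_weight_bundle hp (q := bundle hp))//.
rewrite (class_weight_bundle hq (q := Q))// => /path_class_inj.
exact: homotopic_hom.
Qed.

Lemma class_weight_surj (g : G) :
  exists p, [/\ is_path O p, p 0%R = e x0, p 1%R = e x0 & class_weight p = g].
Proof.
have [ce Oe eK _ _] := ch.
pose b : G := loop_class (beta x0).
have kE (P : {path I from x0 to x0 in X}) : path_class P = (b * loop_class P * b^-1)%g.
  by rewrite /path_class [(_^-1)%g]pi1_inv_class [(b * _)%g]pi1_mul_class [RHS]pi1_mul_class.
(* [path_class] conjugates a loop at [x0] by [b]; this choice of class cancels the conjugation. *)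
have [P hP] : exists P, loop_class P = (b^-1 * g * b)%g.
  by elim/loop_class_ind: (b^-1 * g * b)%g => P; exists P.
have hp : is_path O (fun t => e (P (clamp t))).
  split=> [|t]; last exact: Oe.
  apply: (@cont_comp _ _ _ (fun t : R => P (clamp t))) => //.
  by apply: clamp_comp_continuous; [exact: cts_fun|exact: cont_id].
exists (fun t => e (P (clamp t))); split=> //.
- by rewrite clamp0// path_zero.
- by rewrite clamp1// path_one.
- rewrite (class_weight_bundle hp (q := P)) ?kE ?hP.
    by rewrite !mulgA mulgV mul1g mulgK.
  by move=> t; rewrite eK clampK.
Qed.

End class_weight.

(** Compactness of the unit square in its near-covering form: for large [n], around every point the
    square of radius [1/(n+1)] is mapped into one member of the cover. A cell of the grid lies in
    such a square around its lower left corner. *)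
Lemma lebesgue_grid (R : realType) (T : topologicalType) (UU : set (set T))
    (H : R * R -> T) :
  continuous H -> (forall U, UU U -> open U) ->
  (forall z, exists2 U, UU U & U (H z)) ->
  exists2 n : nat, (0 < n)%N & forall i j : nat, (i < n)%N -> (j < n)%N ->
    exists2 U, UU U & forall s t : R, i%:R / n%:R <= s <= i.+1%:R / n%:R ->
      j%:R / n%:R <= t <= j.+1%:R / n%:R -> U (H (s, t)).
Proof.
move=> cH oU cov.
pose P (n : nat) (z : R * R) := exists2 U, UU U & forall s t : R,
  `|s - z.1| <= n.+1%:R^-1 -> `|t - z.2| <= n.+1%:R^-1 -> U (H (s, t)).
have cK : compact (`[0%R : R, 1%R] `*` `[0%R : R, 1%R]).
  by apply: compact_setX; exact: segment_compact.
have /compact_near_coveringP/(_ nat \oo P _)[|N _ HN] := cK.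
  move=> [a b] _; have [U UU_U Uab] := cov (a, b).
  have : nbhs (a, b) (H @^-1` U) by apply: cH; apply: open_nbhs_nbhs; split=> //; exact: oU.
  move=> /nbhs_ballP[e /= e0 He].
  exists (ball (a, b) (e / 2), [set n | n.+1%:R^-1 < e / 2]).
    split; first by apply: nbhsx_ballx; rewrite divr_gt0.
    have e2 : 0 < e / 2 by rewrite divr_gt0.
    exact: (near_infty_natSinv_lt (PosNum e2)).
  move=> [[a' b'] n] [[/= a'e b'e] ne]; exists U => // s t sa tb; apply: He.
  have close (x x' y : R) : ball x (e / 2) x' -> `|y - x'| <= n.+1%:R^-1 -> ball x e y.
    move=> xx' yx'; apply: (ball_splitl xx').
    by rewrite /ball/=; exact: le_lt_trans yx' ne.
  by split; [exact: close sa|exact: close tb].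
have n0 : 0 < N.+1%:R :> R by rewrite ltr0n.
exists N.+1 => // i j iN jN.
have cell k : (k < N.+1)%N -> 0 <= (k%:R / N.+1%:R : R) <= 1.
  by move=> kN; rewrite divr_ge0//= ler_pdivrMr// mul1r ler_nat ltnW.
have [|U UU_U HU] := HN N (leqnn N) (i%:R / N.+1%:R, j%:R / N.+1%:R).
  by split; rewrite /= in_itv/= cell.
exists U => // s t /andP[s1 s2] /andP[t1 t2]; apply: HU => /=.
  rewrite ger0_norm ?subr_ge0// lerBlDl; apply: le_trans s2 _.
  by rewrite -natr1 mulrDl mul1r.
rewrite ger0_norm ?subr_ge0// lerBlDl; apply: le_trans t2 _.
by rewrite -natr1 mulrDl mul1r.
Qed.

(** * Subdivision of paths and homotopies *)

Section grid.
Local Open Scope group_scope.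
Variables (R : realType) (T : topologicalType) (O D : set T) (G : groupType).
Variables (UU : set (set T)) (c : T -> T -> G).
Hypothesis UU_open : forall U, UU U -> open U.
Hypothesis UU_cover : forall x, O x -> exists2 U, UU U & U x.
Hypothesis D_dense : forall V, open V -> V `&` O !=set0 -> V `&` D !=set0.
Hypothesis c_cocycle : forall U x y z, UU U -> (U `&` D) x -> (U `&` D) y ->
  (U `&` D) z -> c x y * c y z = c x z.
Implicit Types (p q : R -> T).

Definition subordinate n p (U : nat -> set T) := forall i, (i < n)%N ->
  UU (U i) /\ forall t, (i%:R / n%:R <= t <= i.+1%:R / n%:R)%R -> U i (p t).

(** The vertices lie in [D] because [c] is a cocycle there only. Each use picks its dense [D]: all
    of [O], the points of [X] inside [X'], or the points off the exceptional fibers. *)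
Definition chain n (U : nat -> set T) (y : nat -> T) :=
  (forall i, (i <= n)%N -> D (y i)) /\
  forall i, (i < n)%N -> U i (y i) /\ U i (y i.+1).

Definition chain_value n (y : nat -> T) := \prod_(0 <= i < n) c (y i) (y i.+1).

(* The vertices [y i] of the chain lie in [D] but need not lie on [p]. *)
Definition approx n p g := exists U y,
  [/\ (0 < n)%N, subordinate n p U, chain n U y,
      y 0%N = p 0%R /\ y n = p 1%R & g = chain_value n y].

Lemma cocycle1 (U : set T) x : UU U -> (U `&` D) x -> c x x = 1.
Proof.
by move=> UUU Ux; apply: (@mulgI _ (c x x)); rewrite (c_cocycle UUU)// mulg1.
Qed.

(** Ladder argument: the rungs [c (y m) (z m)] turn one product into the other, each square of the
    ladder having its vertices in a single [U m]. *)
Lemma chain_value_eq n p U (y z : nat -> T) : (0 < n)%N -> subordinate n p U ->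
  chain n U y -> chain n U z -> y 0%N = z 0%N -> y n = z n ->
  chain_value n y = chain_value n z.
Proof.
move=> n0 sU [Dy Uy] [Dz Uz] y0 yn.
(* Nothing is known of [U n], so the last rung, where the chains meet, is replaced by 1. *)
suff H m : (m <= n)%N ->
    chain_value m y * (if m == n then 1 else c (y m) (z m)) = chain_value m z.
  by have := H n (leqnn n); rewrite eqxx mulg1.
elim: m => [|m IHm] mn.
  rewrite /chain_value !big_geq// mul1g (ltn_eqF n0) -y0.
  apply: (@cocycle1 (U 0%N)); first exact: (sU 0%N n0).1.
  by split; [exact: (Uy 0%N n0).1|exact: Dy].
have := IHm (ltnW mn); rewrite (ltn_eqF mn).
rewrite /chain_value !big_nat_recr//= => <-; rewrite -!mulgA; congr (_ * _).
have UUm := (sU m mn).1; have [Uy1 Uy2] := Uy m mn; have [Uz1 Uz2] := Uz m mn.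
have [Dy1 Dy2] := (Dy m (ltnW mn), Dy m.+1 mn).
have [Dz1 Dz2] := (Dz m (ltnW mn), Dz m.+1 mn).
case: eqP => [mE|_]; last by rewrite !(c_cocycle UUm).
by rewrite mulg1 (c_cocycle UUm)// mE yn.
Qed.

(** At an inner subdivision point, the intersection of [F i.-1] and [F i] is open and contains a
    point of [p], so density supplies a vertex in [D]; the ends of [p] are kept as they are. *)
Lemma chain_exists n p (F : nat -> set T) : (0 < n)%N -> is_path O p ->
  (forall i, (i < n)%N -> open (F i)) ->
  (forall i t, (i < n)%N -> (i%:R / n%:R <= t <= i.+1%:R / n%:R)%R -> F i (p t)) ->
  D (p 0%R) -> D (p 1%R) ->
  exists y, [/\ chain n F y, y 0%N = p 0%R & y n = p 1%R].
Proof.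
move=> n0 [_ Op] oF Fp D0 D1.
have nn0 : (0 < n%:R :> R)%R by rewrite ltr0n.
have /choice[y yP] i : exists y, [/\ D y, (i < n)%N -> F i y,
    (0 < i <= n)%N -> F i.-1 y, i = 0%N -> y = p 0%R & i = n -> y = p 1%R].
  have [->|i0] := eqVneq i 0%N.
    exists (p 0%R); split=> // [_|n0']; last by rewrite -n0' in n0.
    by apply: Fp => //; rewrite mul0r lexx divr_ge0.
  have [->|iN] := eqVneq i n.
    exists (p 1%R); split; [exact: D1|by rewrite ltnn| |by move=> E; rewrite E in n0|by []].
    move=> _; apply: Fp; first by rewrite ltn_predL.
    rewrite prednK// divff ?lt0r_neq0// lexx andbT.
    by rewrite ler_pdivrMr// mul1r ler_nat leq_pred.
  have [ltin|] := ltnP i n; last first.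
    rewrite leq_eqVlt eq_sym (negbTE iN) /= => ni.
    exists (p 0%R); split; [exact: D0|by []| |by []|].
      by rewrite (leqNgt i) ni andbF.
    by move=> E; rewrite E ltnn in ni.
  have ppos : (i.-1 < n)%N by rewrite (leq_ltn_trans (leq_pred i)).
  have [] := @D_dense (F i.-1 `&` F i); first by apply: openI; exact: oF.
    exists (p (i%:R / n%:R)%R); split; last exact: Op.
    have iS k l : (k <= l)%N -> (k%:R / n%:R <= l%:R / n%:R :> R)%R.
      by move=> kl; rewrite ler_pM2r ?invr_gt0// ler_nat.
    split; apply: Fp => //; first by rewrite prednK ?lt0n// lexx iS// leq_pred.
    by rewrite lexx iS.
  move=> x [[F1 F2] Dx]; exists x; split=> // ii; first by rewrite ii eqxx in i0.
  by rewrite ii eqxx in iN.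
exists y; split.
- split=> i iN; first by have [] := yP i.
  split; first by have [_ /(_ iN)] := yP i.
  by have [_ _ /(_ iN)] := yP i.+1.
- by have [_ _ _ ->] := yP 0%N.
- by have [_ _ _ _ ->] := yP n.
Qed.

(** A third chain, subordinate to the pairwise intersections of the two families of open sets, is
    compared with both. *)
Lemma approx_unique n p g h : is_path O p -> approx n p g -> approx n p h -> g = h.
Proof.
move=> hp [U [y [n0 sU cy [y0 yn] ->]]] [V [z [_ sV cz [z0 zn] ->]]].
have D0 : D (p 0%R) by rewrite -y0; exact: cy.1.
have D1 : D (p 1%R) by rewrite -yn; exact: cy.1.
have [||w [[Dw Fw] w0 wn]] :=
    @chain_exists n p (fun i => U i `&` V i) n0 hp _ _ D0 D1.
- by move=> i iN; apply: openI; apply: UU_open; [exact: (sU i iN).1|exact: (sV i iN).1].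
- by move=> i t iN tN; split; [exact: (sU i iN).2|exact: (sV i iN).2].
rewrite (@chain_value_eq n p U y w)//; last 3 first.
- by split=> // i /Fw[[? _] [? _]].
- by rewrite y0.
- by rewrite yn.
rewrite -(@chain_value_eq n p V z w)//.
- by split=> // i /Fw[[_ ?] [_ ?]].
- by rewrite z0.
- by rewrite zn.
Qed.

Lemma approx_mul n m p g : (0 < m)%N -> approx n p g -> approx (n * m)%N p g.
Proof.
move=> m0 [U [y [n0 sU [Dy Uy] [y0 yn] ->]]].
(* Inside a block of [m] steps every vertex but the first is already the right end, so the first
   step carries the value of the coarse edge and the others are trivial. *)
pose z i := if (m %| i)%N then y (i %/ m)%N else y (i %/ m).+1.
have nm0 : (0 < n * m)%N by rewrite muln_gt0 n0.
have lt i : (i < n * m)%N -> (i %/ m < n)%N by rewrite ltn_divLR.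
have divS i : (i.+1 %/ m = (m %| i.+1) + i %/ m)%N by exact: divnS.
have zS i : z i.+1 = y (i %/ m).+1.
  by rewrite /z divS; case: (m %| i.+1)%N.
have Dz i : (i <= n * m)%N -> D (z i).
  case: i => [|i] iN; first by rewrite /z dvdn0 div0n; exact: Dy.
  by rewrite zS; apply: Dy; exact: lt.
have Uz i : (i < n * m)%N -> U (i %/ m)%N (z i) /\ U (i %/ m)%N (z i.+1).
  move=> /lt/Uy[U1 U2]; rewrite zS; split=> //.
  by rewrite /z; case: ifP.
exists (fun i => U (i %/ m)%N), z; split=> //.
- move=> i iN; split; first exact: (sU _ (lt i iN)).1.
  move=> t /andP[t1 t2]; apply: (sU _ (lt i iN)).2.
  have nR : (0 < n%:R :> R)%R by rewrite ltr0n.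
  have mR : (0 < m%:R :> R)%R by rewrite ltr0n.
  have K : (m%:R * (n * m)%:R^-1 = n%:R^-1 :> R)%R.
    by rewrite natrM invfM mulrCA divff ?mulr1// lt0r_neq0.
  rewrite -K !mulrA -!natrM; apply/andP; split.
    apply: le_trans t1; rewrite ler_pM2r ?invr_gt0 ?ltr0n// ler_nat.
    exact: leq_trunc_div.
  apply: le_trans t2 _; rewrite ler_pM2r ?invr_gt0 ?ltr0n// ler_nat.
  exact: ltn_ceil.
- by rewrite /z dvdn0 div0n dvdn_mull// mulnK.
suff H i : (i <= n * m)%N -> chain_value i z =
    chain_value (i %/ m) y * (if (m %| i)%N then 1 else c (y (i %/ m)%N) (z i)).
  by rewrite H// dvdn_mull// mulg1 mulnK.
elim: i => [|i IHi] iN; first by rewrite /chain_value dvdn0 div0n !big_geq// mulg1.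
have UUi := (sU _ (lt _ iN)).1; have [U1 U2] := Uz i iN.
have [U3 U4] := Uy _ (lt _ iN).
have D1 : D (z i) by apply: Dz; exact: ltnW.
have D2 : D (y (i %/ m)%N) by apply: Dy; exact/ltnW/lt.
have D3 : D (y (i %/ m).+1) by apply: Dy; exact: lt.
rewrite {1}/chain_value big_nat_recr//= -/(chain_value i z) IHi ?(ltnW iN)// -mulgA.
rewrite (_ : (if _ then _ else _) * _ = c (y (i %/ m)%N) (y (i %/ m).+1)); last first.
  rewrite zS; case: ifP => mi; last by rewrite (c_cocycle UUi).
  by rewrite mul1g /z mi.
rewrite divS zS; case: (m %| i.+1)%N => //=.
by rewrite mulg1 /chain_value big_nat_recr.
Qed.

Lemma approx_ext n p q g : (forall t, (0 <= t <= 1)%R -> p t = q t) ->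
  approx n p g -> approx n q g.
Proof.
move=> pq [U [y [n0 sU cy [y0 yn] ->]]]; exists U, y; split=> //; last first.
  by rewrite -!pq ?lexx ?ler01.
have nn0 : (0 < n%:R :> R)%R by rewrite ltr0n.
move=> i iN; split; first exact: (sU i iN).1.
move=> t tN; rewrite -pq; first exact: (sU i iN).2.
move: tN => /andP[t1 t2]; apply/andP; split.
  by apply: le_trans t1; rewrite divr_ge0.
by apply: (le_trans t2); rewrite ler_pdivrMr// mul1r ler_nat.
Qed.

(** Two consecutive rows of a Lebesgue grid are subordinate to the same sets, those of the cells
    between them, so one chain serves both. [approx_unique] passes from row to row, and [approx_mul]
    brings the given subdivisions and the grid to a common length. *)
Lemma approx_homotopic n m p q g h : is_path O p -> is_path O q -> homotopic O p q ->
  approx n p g -> approx m q h -> g = h.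
Proof.
move=> hp hq [H [cH HO H01 Hx]] ag ah.
have [N N0 HN] := lebesgue_grid cH UU_open (fun z => UU_cover (HO z)).
have NN0 : (0 < N%:R :> R)%R by rewrite ltr0n.
pose row i (t : R) := H (i%:R / N%:R, t)%R.
have hrow i : is_path O (row i).
  by split=> [|t]; [apply: cont_comp cH; cont|exact: HO].
have [D0 D1] : D (p 0%R) /\ D (p 1%R).
  by have [U [y [_ _ [Dy _] [<- <-] _]]] := ag; split; exact: Dy.
have row0 i : (i <= N)%N -> row i 0%R = p 0%R /\ row i 1%R = p 1%R.
  move=> iN; apply: Hx; rewrite divr_ge0//=.
  by rewrite ler_pdivrMr// mul1r ler_nat.
have step i : (i < N)%N -> exists k, approx N (row i) k /\ approx N (row i.+1) k.
  move=> iN.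
  have /choice[U UP] j : exists U, (j < N)%N -> UU U /\ forall s t : R,
      (i%:R / N%:R <= s <= i.+1%:R / N%:R)%R ->
      (j%:R / N%:R <= t <= j.+1%:R / N%:R)%R -> U (H (s, t)).
    case: (ltnP j N) => jN; last by exists setT.
    by have [U ? ?] := HN i j iN jN; exists U.
  have iiS : (i%:R / N%:R <= i.+1%:R / N%:R :> R)%R.
    by rewrite ler_pM2r ?invr_gt0// ler_nat.
  have sU k : k = i \/ k = i.+1 -> subordinate N (row k) U.
    move=> ki j jN; split; first by have [] := UP j jN.
    move=> t tj; apply: (UP j jN).2 => //.
    by case: ki => ->; rewrite lexx ?iiS.
  have [r0 r1] := row0 _ (ltnW iN); have [r0' r1'] := row0 _ iN.
  have [||||y [cy y0 yN]] := @chain_exists N (row i) U N0 (hrow i).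
  - by move=> j jN; apply: UU_open; exact: (UP j jN).1.
  - by move=> j t jN; apply: (sU i _ j jN).2; left.
  - by rewrite r0.
  - by rewrite r1.
  exists (chain_value N y); split; exists U, y; split=> //; try by apply: sU; auto.
  by rewrite r0' r1' y0 yN.
have [k [k0 kN]] : exists k, approx N (row 0%N) k /\ approx N (row N) k.
  suff S i : (0 < i <= N)%N -> exists k, approx N (row 0%N) k /\ approx N (row i) k.
    by apply: S; rewrite N0 leqnn.
  elim: i => // -[_ /step//|i IHi] /andP[_ iN].
  have /IHi[k [k0 ki]] : (0 < i.+1 <= N)%N by rewrite (ltnW iN).
  have [l [li lS]] := step _ iN.
  by rewrite (approx_unique (hrow _) ki li) in k0; exists l.
have kp : approx N p k.
  by apply: approx_ext k0 => t /H01[<- _]; rewrite /row mul0r.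
have kq : approx N q k.
  by apply: approx_ext kN => t /H01[_ <-]; rewrite /row divff// lt0r_neq0.
have [n0 m0] : (0 < n)%N /\ (0 < m)%N.
  by have [? [? []]] := ag; have [? [? []]] := ah.
rewrite (approx_unique hp (approx_mul N0 ag) (h := k)); last first.
  by rewrite mulnC; exact: approx_mul.
rewrite (approx_unique hq (approx_mul N0 ah) (h := k))//.
by rewrite mulnC; exact: approx_mul.
Qed.

Lemma approx_exists p : is_path O p -> D (p 0%R) -> D (p 1%R) ->
  exists n g, approx n p g.
Proof.
move=> hp D0 D1; have [cp Op] := hp.
have [||n n0 Hn] := @lebesgue_grid R T UU (fun z => p z.2) _ UU_open.
- by apply: cont_comp cp; cont.
- by move=> z; apply: UU_cover; exact: Op.
have /choice[U UP] j : exists U, (j < n)%N -> UU U /\ forall t : R,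
    (j%:R / n%:R <= t <= j.+1%:R / n%:R)%R -> U (p t).
  case: (ltnP j n) => jn; last by exists setT.
  have [U ? HU] := Hn 0%N j n0 jn; exists U => _; split=> // t tj.
  by apply: (HU 0%R) => //; rewrite mul0r lexx divr_ge0.
have [||y [cy y0 yn]] := @chain_exists n p U n0 hp _ _ D0 D1.
- by move=> j /UP[/UU_open].
- by move=> j t /UP[_]; exact.
exists n, (chain_value n y), U, y; split=> // j jn; exact: UP.
Qed.

Lemma approx_pcat n p q g h : is_path O p -> is_path O q -> p 1%R = q 0%R ->
  approx n p g -> approx n q h -> approx (n + n)%N (pcat p q) (g * h).
Proof.
move=> hp hq pq [U [y [n0 sU [Dy Uy] [y0 yn] ->]]] [V [z [_ sV [Dz Vz] [z0 zn] ->]]].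
have nn0 : (0 < n%:R :> R)%R by rewrite ltr0n.
have nn : ((n + n)%:R = 2 * n%:R :> R)%R by rewrite natrD mulr2n mulrDl mul1r.
have zy : z 0%N = y n by rewrite z0 yn.
pose x i := if (i <= n)%N then y i else z (i - n)%N.
exists (fun i => if (i < n)%N then U i else V (i - n)%N), x; split=> //.
- by rewrite addn_gt0 n0.
- move=> i iN; case: ifP => [ilt|/negbT]; last rewrite -leqNgt => ige.
    split=> [|t]; first exact: (sU i ilt).1.
    rewrite nn invfM !mulrA !(mulrAC _ 2^-1)%R => /andP[t1 t2].
    have t2n : (t <= 2^-1)%R.
      have : (i.+1%:R / n%:R <= 1 :> R)%R by rewrite ler_pdivrMr// mul1r ler_nat.
      lra.
    rewrite /pcat t2n; apply: (sU i ilt).2; lra.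
  have iN' : (i - n < n)%N by rewrite ltn_subLR.
  split=> [|t]; first exact: (sV _ iN').1.
  rewrite nn invfM !mulrA !(mulrAC _ 2^-1)%R => /andP[t1 t2].
  have iE : (i%:R = (i - n)%:R + n%:R :> R)%R by rewrite -natrD subnK.
  have iE' : (i.+1%:R = (i - n).+1%:R + n%:R :> R)%R by rewrite -natrD addSn subnK.
  move: t1 t2; rewrite iE iE' !mulrDl divff ?lt0r_neq0// mul1r => t1 t2.
  have i0 : (0 <= (i - n)%:R / n%:R :> R)%R by rewrite divr_ge0.
  have Vp : V (i - n)%N (q (2 * t - 1)%R) by apply: (sV _ iN').2; lra.
  rewrite /pcat; case: ifP => // th.
  (* The junction belongs to both halves, and [pcat] takes its value from [p] there. *)
  have tE : (t = 2^-1)%R by lra.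
  by move: Vp; rewrite tE divff// subrr -pq.
- split=> i iN.
    rewrite /x; case: ifP => [/Dy//|/negbT]; rewrite -ltnNge => ni.
    by apply: Dz; rewrite leq_subLR.
  rewrite /x; case: (ltnP i n) => ilt; first by rewrite (ltnW ilt); exact: Uy.
  have iN' : (i - n < n)%N by rewrite ltn_subLR.
  have := Vz _ iN'; rewrite -subSn//.
  by case: (ltngtP i n) ilt => // -> _; rewrite subnn zy.
- rewrite pcat0 pcat1 /x leq0n y0; split=> //; rewrite ifF ?addnK//.
  by apply/negbTE; rewrite -ltnNge -[X in (X < _)%N]addn0 ltn_add2l.
- rewrite /chain_value [RHS](@big_cat_nat _ _ _ n)//= ?leq_addr//; congr (_ * _).
    by apply: eq_big_nat => i /andP[_ iN]; rewrite /x iN (ltnW iN).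
  rewrite -{2}(add0n n) big_addn addnK; apply: eq_big_nat => i _.
  rewrite /x addnK -addSn addnK ltnNge leq_addl /=.
  by case: i => [|i]; rewrite ?add0n ?leqnn ?zy// leqNgt addSn ltnS leq_addl.
Qed.

Definition approx_value p : G := xget 1 [set g | exists n, approx n p g].

Lemma approx_valueE n p g : is_path O p -> approx n p g -> approx_value p = g.
Proof.
move=> hp ag; have : [set g | exists n, approx n p g] (approx_value p).
  by apply: (@xgetI _ 1 _ g); exists n.
move=> [m am]; exact: approx_homotopic (homotopic_refl hp) am ag.
Qed.

Lemma approx_value_homotopic p q : is_path O p -> is_path O q ->
  D (p 0%R) -> D (p 1%R) -> homotopic O p q -> approx_value p = approx_value q.
Proof.
move=> hp hq D0 D1 pq; have [H [_ _ H01 Hx]] := pq.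
have q0 : q 0%R = p 0%R.
  by rewrite -(H01 0%R _).2 ?lexx ?ler01// (Hx 1%R _).1// lexx ler01.
have q1 : q 1%R = p 1%R.
  by rewrite -(H01 1%R _).2 ?lexx ?ler01// (Hx 1%R _).2// lexx ler01.
have [n [g ag]] := approx_exists hp D0 D1.
have [|| m [h ah]] := approx_exists hq; rewrite ?q0 ?q1//.
rewrite (approx_valueE hp ag) (approx_valueE hq ah).
exact: approx_homotopic pq ag ah.
Qed.

Lemma approx_value_pcat p q : is_path O p -> is_path O q -> p 1%R = q 0%R ->
  D (p 0%R) -> D (p 1%R) -> D (q 1%R) ->
  approx_value (pcat p q) = approx_value p * approx_value q.
Proof.
move=> hp hq pq D0 D1 D2.
have [n [g ag]] := approx_exists hp D0 D1.
have [||m [h ah]] := approx_exists hq; rewrite -?pq//.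
have n0 : (0 < n)%N by have [? [? []]] := ag.
have m0 : (0 < m)%N by have [? [? []]] := ah.
rewrite (approx_valueE hp ag) (approx_valueE hq ah).
apply: approx_valueE (is_path_pcat hp hq pq) (approx_pcat hp hq pq (approx_mul m0 ag) _).
by rewrite mulnC; exact: approx_mul.
Qed.

End grid.

(** The case [D = O]: a local cocycle integrates to a morphism on the fundamental groupoid. This is
    the source of maps out of a fundamental group. *)
Lemma approx_value_weight (R : realType) (T : topologicalType) (O : set T)
    (G : groupType) (UU : set (set T)) (c : T -> T -> G) :
  (forall U, UU U -> open U) -> (forall x, O x -> exists2 U, UU U & U x) ->
  (forall U x y z, UU U -> (U `&` O) x -> (U `&` O) y -> (U `&` O) z ->
    (c x y * c y z = c x z)%g) ->
  weight O (approx_value (R := R) O UU c).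
Proof.
move=> oU cU cc; split=> p q hp hq.
  by apply: (approx_value_homotopic (O := O)) => //; [exact: hp.2|exact: hp.2].
move=> pq.
by apply: (approx_value_pcat (O := O)) => //; [exact: hp.2|exact: hp.2|exact: hq.2].
Qed.

(** * Topology and convexity of the complex plane *)

Section complex_topology.
Local Open Scope complex_scope.
Variables (R : realType).
Local Notation C := R[i].

Lemma contDC (Z : topologicalType) (f g : Z -> C) :
  continuous f -> continuous g -> continuous (fun z => f z + g z).
Proof. exact: (@contD _ C C^o). Qed.

Lemma contMC (Z : topologicalType) (f g : Z -> C) :
  continuous f -> continuous g -> continuous (fun z => f z * g z).
Proof. exact: (@contM _ C). Qed.

Lemma contNC (Z : topologicalType) (f : Z -> C) :
  continuous f -> continuous (fun z => - f z).
Proof. exact: (@contN _ C C^o). Qed.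

Lemma cont_sumC (Z : topologicalType) (J : Type) (r : seq J) (P : pred J)
    (f : J -> Z -> C) :
  (forall j, continuous (f j)) -> continuous (fun z => \sum_(j <- r | P j) f j z).
Proof.
move=> cf; elim: r => [|j r IH].
  by rewrite (_ : (fun z => _) = fun=> 0); [exact: contC|apply/funext => z; rewrite big_nil].
rewrite (_ : (fun z => _) = fun z => (if P j then f j z else 0) + \sum_(j <- r | P j) f j z).
  by apply: contDC; [case: (P j); [exact: cf|exact: contC]|exact: IH].
by apply/funext => z; rewrite big_cons; case: (P j) => //; rewrite add0r.
Qed.

(* A real-valued norm of [R[i]], as [`|z|] lives in [R[i]] itself. *)
Definition norm1 (z : C) : R := `|Re z| + `|Im z|.

Lemma norm1_ge0 z : 0 <= norm1 z.
Proof. by rewrite addr_ge0. Qed.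

Lemma norm1_eq0 z : (norm1 z == 0) = (z == 0).
Proof.
by case: z => a b; rewrite paddr_eq0// !normr_eq0 eq_complex.
Qed.

Lemma norm10 : norm1 0 = 0.
Proof. by apply/eqP; rewrite norm1_eq0. Qed.

Lemma norm1D z w : norm1 (z + w) <= norm1 z + norm1 w.
Proof.
case: z w => [a b] [c d]; rewrite /norm1 /= addrACA.
by apply: lerD; exact: ler_normD.
Qed.

Lemma norm1N z : norm1 (- z) = norm1 z.
Proof. by case: z => a b; rewrite /norm1 /= !normrN. Qed.

Lemma norm1B z w : norm1 (z - w) = norm1 (w - z).
Proof. by rewrite -norm1N opprB. Qed.

Lemma norm1_dist_triangle y z w : norm1 (z - w) <= norm1 (z - y) + norm1 (y - w).
Proof. by apply: le_trans (norm1D _ _); rewrite addrA subrK. Qed.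

Lemma norm1M (t : R) z : norm1 (t%:C * z) = `|t| * norm1 z.
Proof. by case: z => a b; rewrite /norm1 /= !mul0r subr0 addr0 !normrM mulrDr. Qed.

Lemma norm1_real (t : R) : norm1 t%:C = `|t|.
Proof. by rewrite /norm1 /= normr0 addr0. Qed.

Lemma le_norm_norm1 (z : C) : `|z| <= (norm1 z)%:C.
Proof.
case: z => a b; rewrite normc_def lecR /norm1 /=.
rewrite -[leRHS]ger0_norm ?addr_ge0// -sqrtr_sqr ler_sqrt ?sqr_ge0//.
have ab : 0 <= `|a| * `|b| by rewrite mulr_ge0.
by rewrite sqrrD !real_normK ?num_real// mulr2n; lra.
Qed.

Lemma norm1_le_norm (z : C) : (norm1 z)%:C <= `|z| *+ 2.
Proof.
case: z => a b; rewrite normc_def -rmorphMn lecR /norm1 /= mulr2n.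
rewrite -[in leLHS]sqrtr_sqr -[X in _ + X <= _]sqrtr_sqr.
by apply: lerD; apply: ler_wsqrtr; rewrite ?lerDl ?lerDr sqr_ge0.
Qed.

Lemma nbhs_norm1 (z0 : C) (U : set C) :
  nbhs z0 U <-> exists2 e : R, 0 < e & forall z, norm1 (z - z0) < e -> U z.
Proof.
split=> [/nbhs_ballP[e /= e0 He]|[e e0 He]].
  have eE : e = (Re e)%:C by case: e e0 {He} => a b; rewrite ltcE /= => /andP[/eqP->].
  exists (Re e); first by rewrite eE ltcR in e0.
  move=> z ze; apply: He; rewrite /ball/= eE distrC.
  by apply: le_lt_trans (le_norm_norm1 _) _; rewrite ltcR.
apply/nbhs_ballP; exists (e / 2)%:C; first by rewrite /= ltcR divr_gt0.
move=> z; rewrite /ball/= distrC => ze; apply: He.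
rewrite -ltcR; apply: le_lt_trans (norm1_le_norm _) _.
by rewrite [X in _ < X%:C]splitr rmorphD/= -mulr2n ltr_pMn2r.
Qed.

Lemma cont_norm1P (Z : topologicalType) (f : Z -> C) :
  (forall z (e : R), 0 < e -> nbhs z [set y | norm1 (f y - f z) < e]) -> continuous f.
Proof.
move=> H z U /nbhs_norm1[e e0 He].
by apply: filterS (H z e e0) => y; exact: He.
Qed.

Lemma cont_realP (f : C -> R) :
  (forall z w, `|f z - f w| <= norm1 (z - w)) -> continuous f.
Proof.
move=> Hf z U /nbhs_ballP[e /= e0 He]; apply/nbhs_norm1; exists e => // y ye.
by apply: He; rewrite /ball/= distrC; exact: le_lt_trans (Hf _ _) ye.
Qed.

Lemma cont_Re (Z : topologicalType) (f : Z -> C) :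
  continuous f -> continuous (fun z => Re (f z)).
Proof.
move=> cf; apply: cont_comp cf _; apply: cont_realP => -[a b] [c d].
by rewrite /norm1/= lerDl.
Qed.

Lemma cont_Im (Z : topologicalType) (f : Z -> C) :
  continuous f -> continuous (fun z => Im (f z)).
Proof.
move=> cf; apply: cont_comp cf _; apply: cont_realP => -[a b] [c d].
by rewrite /norm1/= lerDr.
Qed.

Lemma cont_norm1 (Z : topologicalType) (f : Z -> C) :
  continuous f -> continuous (fun z => norm1 (f z)).
Proof.
by move=> cf; apply: contD; apply: cont_norm; [exact: cont_Re|exact: cont_Im].
Qed.

Lemma cont_real_complex (Z : topologicalType) (f : Z -> R) :
  continuous f -> continuous (fun z => (f z)%:C).
Proof.
move=> cf; apply: cont_norm1P => z e e0.
apply: (cf z [set a | norm1 (a%:C - (f z)%:C) < e]).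
apply/nbhs_ballP; exists e => // y.
by rewrite /ball/= /norm1/= subr0 normr0 addr0 distrC.
Qed.

Lemma cont_Complex (Z : topologicalType) (f g : Z -> R) :
  continuous f -> continuous g -> continuous (fun z => f z +i* g z).
Proof.
move=> cf cg.
rewrite (_ : (fun z => _) = fun z => (f z)%:C + 'i * (g z)%:C).
  by apply: contDC; [|apply: contMC; first exact: contC]; exact: cont_real_complex.
by apply/funext => z; apply/eqP; rewrite eq_complex /=; apply/andP; split; apply/eqP; ring.
Qed.

End complex_topology.

Ltac contc := repeat (cbv beta; lazymatch goal with
  | |- continuous (fun _ => ?a) => exact: contC
  | |- continuous (fun z => z) => exact: cont_id
  | |- continuous (fun _ => (_ + _)%R) => first [apply: contDC | apply: contD]
  | |- continuous (fun _ => (- _)%R) => first [apply: contNC | apply: contN]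
  | |- continuous (fun _ => (_ * _)%R) => first [apply: contMC | apply: contM]
  | |- continuous (fun _ => complex.Re _) => apply: cont_Re
  | |- continuous (fun _ => complex.Im _) => apply: cont_Im
  | |- continuous (fun _ => norm1 _) => apply: cont_norm1
  | |- continuous (fun _ => real_complex_def _ _) => apply: cont_real_complex
  | |- continuous (fun _ => Complex _ _) => apply: cont_Complex
  | |- continuous (fun _ => `|_|%R) => apply: cont_norm
  | |- continuous (fun _ => Num.max _ _) => apply: cont_max
  | |- continuous (fun _ => Num.min _ _) => apply: cont_min
  | |- continuous (fun _ => (_, _)) => apply: cont_pair
  | |- continuous (fun _ => fst _) => apply: cont_fst
  | |- continuous (fun _ => snd _) => apply: cont_snd
  | |- continuous ?f =>
      first [ assumption
            | lazymatch f with (fun _ => _) => fail | _ =>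
                change (continuous (fun z => f z)) end ]
  end).

(** * Convex sets, segments and polygonal approximation *)

Section convexity.
Variables (R : realType) (T : topologicalType) (mix : R -> T -> T -> T).

(* Convex combinations, abstracted from the two carriers [R[i]] and [R[i] * R[i]]. *)
Definition mixing :=
  [/\ continuous (fun z : R * (T * T) => mix z.1 z.2.1 z.2.2),
      forall x y, mix 0 x y = x, forall x y, mix 1 x y = y &
      forall t x, mix t x x = x].

Hypothesis mixP : mixing.

Definition convexs (U : set T) :=
  forall x y t, U x -> U y -> 0 <= t <= 1 -> U (mix t x y).

Definition clip (t : R) : R := Num.max 0 (Num.min 1 t).
Definition seg (x y : T) (t : R) : T := mix (clip t) x y.

Lemma clip01 t : 0 <= clip t <= 1.
Proof. by rewrite /clip le_max lexx ge_max ler01 ge_min lexx. Qed.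

Lemma clip_id t : 0 <= t <= 1 -> clip t = t.
Proof. by move=> /andP[t0 t1]; rewrite /clip min_r// max_r. Qed.

Lemma clip0 : clip 0 = 0. Proof. by rewrite clip_id// lexx ler01. Qed.
Lemma clip1 : clip 1 = 1. Proof. by rewrite clip_id// lexx ler01. Qed.

Lemma cont_clip (Z : topologicalType) (f : Z -> R) :
  continuous f -> continuous (fun z => clip (f z)).
Proof. by move=> cf; rewrite /clip; contc. Qed.

Lemma cont_mix (Z : topologicalType) (f : Z -> R) (g h : Z -> T) :
  continuous f -> continuous g -> continuous h ->
  continuous (fun z => mix (f z) (g z) (h z)).
Proof.
move=> cf cg ch; have [cm _ _ _] := mixP.
by apply: (@cont_comp _ _ _ (fun z => (f z, (g z, h z))) _ _ cm); contc.
Qed.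

Lemma seg0 x y : seg x y 0 = x.
Proof. by have [_ m0 _ _] := mixP; rewrite /seg clip0 m0. Qed.

Lemma seg1 x y : seg x y 1 = y.
Proof. by have [_ _ m1 _] := mixP; rewrite /seg clip1 m1. Qed.

Lemma segxx x : seg x x = fun=> x.
Proof. by have [_ _ _ mm] := mixP; apply/funext => t; rewrite /seg mm. Qed.

Lemma is_path_seg U x y : convexs U -> U x -> U y -> is_path U (seg x y).
Proof.
move=> cU Ux Uy; split=> [|t]; last exact: cU (clip01 t).
by apply: cont_mix; [apply: cont_clip; exact: cont_id| |]; exact: contC.
Qed.

Lemma convex_homotopic U (p q : R -> T) : convexs U -> is_path U p -> is_path U q ->
  p 0 = q 0 -> p 1 = q 1 -> homotopic U p q.
Proof.
move=> cU [cp Up] [cq Uq] pq0 pq1; have [_ m0 m1 mm] := mixP.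
exists (fun z => mix (clip z.1) (p z.2) (q z.2)); split=> /= [|z|t _|s _].
- apply: cont_mix; first by apply: cont_clip; contc.
  + by apply: cont_comp cp; contc.
  + by apply: cont_comp cq; contc.
- exact: cU (clip01 _).
- by rewrite clip0 clip1 m0 m1.
- by rewrite pq0 pq1 !mm.
Qed.

Lemma convexsI U V : convexs U -> convexs V -> convexs (U `&` V).
Proof. by move=> cU cV x y t [? ?] [? ?] t01; split; [exact: cU|exact: cV]. Qed.

Section convex_weight.
Local Open Scope group_scope.
Variables (O : set T) (G : groupType) (W : (R -> T) -> G).
Hypothesis wW : weight O W.

Lemma weight_convex U (p q : R -> T) : convexs U -> U `<=` O -> is_path U p -> is_path U q ->
  p 0%R = q 0%R -> p 1%R = q 1%R -> W p = W q.
Proof.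
move=> cU UO hp hq p0 p1; apply: wW.1; try exact: is_path_sub UO _.
exact/(homotopic_sub UO)/convex_homotopic.
Qed.

Lemma weight_triangle U x y z : convexs U -> U `<=` O -> U x -> U y -> U z ->
  W (seg x y) * W (seg y z) = W (seg x z).
Proof.
move=> cU UO Ux Uy Uz.
have [hxy hyz hxz] : [/\ is_path U (seg x y), is_path U (seg y z) &
    is_path U (seg x z)] by split; exact: is_path_seg.
rewrite -wW.2 ?seg0 ?seg1//; try exact: is_path_sub UO _.
apply: (weight_convex cU UO) => //; first by apply: is_path_pcat; rewrite ?seg0 ?seg1.
  by rewrite pcat0 !seg0.
by rewrite pcat1 !seg1.
Qed.

Lemma weight_segxx x : O x -> W (seg x x) = 1.
Proof. by rewrite segxx; exact: (weight_cst wW). Qed.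

Lemma weight_segV U x y : convexs U -> U `<=` O -> U x -> U y ->
  W (seg x y) = (W (seg y x))^-1.
Proof.
move=> cU UO Ux Uy; apply: (@mulIg _ (W (seg y x))); rewrite mulVg.
by rewrite (weight_triangle cU UO)// weight_segxx//; exact: UO.
Qed.

Variable UU : set (set T).
Hypothesis UU_open : forall U, UU U -> open U.
Hypothesis UU_convex : forall U, UU U -> convexs U.
Hypothesis UU_cover : forall x, O x -> exists2 U, UU U & U x.
Hypothesis UU_sub : forall U, UU U -> U `<=` O.

(** Each piece of [p] is homotopic to its chord inside a convex member of the cover; the chain of
    points of [p] is then exchanged for the given chain by [chain_value_eq]. *)
Lemma weight_approx D n (p : R -> T) g : D `<=` O -> is_path O p ->
  approx D UU (fun x y => W (seg x y)) n p g -> W p = g.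
Proof.
move=> DO hp [U [y [n0 sU [Dy Uy] [y0 yn] ->]]].
have nn0 : (0 < n%:R :> R)%R by rewrite ltr0n.
rewrite /chain_value.
pose z i := p (i%:R / n%:R)%R.
transitivity (\prod_(0 <= i < n) W (seg (z i) (z i.+1))).
  rewrite (weight_subdiv wW hp n0); apply: eq_big_nat => i /andP[_ iN].
  have [UUi Ui] := sU i iN.
  have iS : (i%:R / n%:R <= i.+1%:R / n%:R :> R)%R.
    by rewrite ler_pM2r ?invr_gt0// ler_nat.
  pose q t := psub p (i%:R / n%:R)%R (i.+1%:R / n%:R)%R (clip t).
  have hq : is_path (U i) q.
    split=> [|t]; last first.
      apply: Ui; have /andP[c0 c1] := clip01 t.
      by apply/andP; split; [nra|nra].
    apply: cont_comp (is_path_psub (i%:R / n%:R)%R (i.+1%:R / n%:R)%R hp).1.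
    by apply: cont_clip; exact: cont_id.
  transitivity (W q).
    apply: (weight_ext wW); first exact: is_path_psub.
      exact: is_path_sub (UU_sub UUi) hq.
    by move=> t t01; rewrite /q clip_id.
  have z1 : U i (z i) by apply: Ui; rewrite lexx iS.
  have z2 : U i (z i.+1) by apply: Ui; rewrite lexx iS.
  apply: (weight_convex (UU_convex UUi) (UU_sub UUi)) => //.
  - by apply: is_path_seg => //; exact: UU_convex.
  - by rewrite /q clip0 psub0 seg0.
  - by rewrite /q clip1 psub1 seg1.
have cW V a b c : UU V -> (V `&` O) a -> (V `&` O) b -> (V `&` O) c ->
    W (seg a b) * W (seg b c) = W (seg a c).
  by move=> UV [Va _] [Vb _] [Vc _]; apply: (weight_triangle (UU_convex UV) (UU_sub UV)).
apply: (chain_value_eq cW n0 sU).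
- split=> i iN; first exact: hp.2.
  have iS : (i%:R / n%:R <= i.+1%:R / n%:R :> R)%R.
    by rewrite ler_pM2r ?invr_gt0// ler_nat.
  by split; apply: (sU i iN).2; rewrite lexx iS.
- by split=> // i /Dy/DO.
- by rewrite y0 /z mul0r.
- by rewrite yn /z divff// lt0r_neq0.
Qed.

(** For the purposes of [W], a path is a polygon whose vertices can be placed in any dense [D]. This
    serves to move paths off the fibers over [K]. *)
Lemma weight_chain D (p : R -> T) : D `<=` O ->
  (forall V, open V -> V `&` O !=set0 -> V `&` D !=set0) ->
  is_path O p -> D (p 0%R) -> D (p 1%R) ->
  exists n U (y : nat -> T), [/\ forall i, (i < n)%N -> UU (U i), chain D n U y,
    y 0%N = p 0%R /\ y n = p 1%R &
    W p = \prod_(0 <= i < n) W (seg (y i) (y i.+1))].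
Proof.
move=> DO dD hp D0 D1.
have [n [g ag]] := approx_exists (G := G) (fun x y => W (seg x y)) UU_open UU_cover dD hp D0 D1.
have := weight_approx DO hp ag.
case: ag => U [y [n0 sU cy ye ->]] ->.
by exists n, U, y; split=> // i iN; have [] := sU i iN.
Qed.

End convex_weight.
End convexity.

Section complex_convexity.
Local Open Scope complex_scope.
Variables (R : realType).
Local Notation C := R[i].

Definition mixC (t : R) (x y : C) : C := (1 - t)%:C * x + t%:C * y.
Definition mix2 (t : R) (x y : C * C) : C * C := (mixC t x.1 y.1, mixC t x.2 y.2).

Lemma mixC_mixing : mixing mixC.
Proof.
split=> [|x y|x y|t x]; rewrite /mixC; first by contc.
- by rewrite subr0 mul1r mul0r addr0.
- by rewrite subrr mul0r mul1r add0r.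
- by rewrite -mulrDl -rmorphD subrK mul1r.
Qed.

Lemma mix2_mixing : mixing mix2.
Proof.
have [_ m0 m1 mm] := mixC_mixing.
split=> [|[x1 x2] [y1 y2]|[x1 x2] [y1 y2]|t [x1 x2]]; rewrite /mix2/= ?m0 ?m1 ?mm//.
by rewrite /mixC; contc.
Qed.

Lemma Re_mixC t x y : Re (mixC t x y) = (1 - t) * Re x + t * Re y.
Proof. by case: x y => [a b] [c d] /=; ring. Qed.

Lemma Im_mixC t x y : Im (mixC t x y) = (1 - t) * Im x + t * Im y.
Proof. by case: x y => [a b] [c d] /=; ring. Qed.

Definition disk (z0 : C) (e : R) : set C := [set z | norm1 (z - z0) < e].
Definition box (x0 : C * C) (e : R) : set (C * C) :=
  [set x | disk x0.1 e x.1 /\ disk x0.2 e x.2].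

Lemma disk_center z e : 0 < e -> disk z e z.
Proof. by move=> e0; rewrite /disk/= subrr norm10. Qed.

Lemma box_center x e : 0 < e -> box x e x.
Proof. by move=> e0; split; exact: disk_center. Qed.

Lemma open_preimage_lt (T : topologicalType) (f g : T -> R) :
  continuous f -> continuous g -> open [set x | f x < g x].
Proof.
move=> cf cg; have ch : continuous (fun x => g x - f x) by contc.
have -> : [set x | f x < g x] = (fun x => g x - f x) @^-1` [set y | 0 < y].
  by apply/seteqP; split=> x /=; rewrite subr_gt0.
by apply: open_comp (@open_gt R 0) => x _; exact: ch.
Qed.

Lemma open_disk z e : open (disk z e).
Proof. by apply: open_preimage_lt; contc. Qed.

Lemma open_box x e : open (box x e).
Proof. by apply: openI; apply: open_preimage_lt; contc. Qed.

Lemma convex_comb_lt (a b e t : R) : a < e -> b < e -> 0 <= t <= 1 ->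
  (1 - t) * a + t * b < e.
Proof.
move=> ae be /andP[t0 t1]; apply: (@le_lt_trans _ _ (Num.max a b)); last by rewrite gt_max ae.
have -> : Num.max a b = (1 - t) * Num.max a b + t * Num.max a b by ring.
by apply: lerD; apply: ler_wpM2l; rewrite ?subr_ge0// le_max lexx ?orbT.
Qed.

Lemma convex_comb_gt (a b e t : R) : e < a -> e < b -> 0 <= t <= 1 ->
  e < (1 - t) * a + t * b.
Proof.
move=> ae be t01; rewrite -ltrN2 opprD -!mulrN.
by apply: convex_comb_lt => //; rewrite ltrN2.
Qed.

Lemma disk_convex z e : convexs mixC (disk z e).
Proof.
move=> x y t; rewrite /disk/= => xz yz t01.
rewrite (_ : _ - z = (1 - t)%:C * (x - z) + t%:C * (y - z)).
  apply: le_lt_trans (norm1D _ _) _; rewrite !norm1M !ger0_norm; [|lra|lra].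
  exact: convex_comb_lt.
by rewrite /mixC rmorphB/=; ring.
Qed.

Lemma convexs_prod U V : convexs mixC U -> convexs mixC V ->
  convexs mix2 [set x | U x.1 /\ V x.2].
Proof.
by move=> cU cV [x1 x2] [y1 y2] t [/= ? ?] [? ?] t01; split; [exact: cU|exact: cV].
Qed.

Lemma box_convex x e : convexs mix2 (box x e).
Proof. by apply: convexs_prod; exact: disk_convex. Qed.

Lemma open_disk_sub (O : set C) z : open O -> O z ->
  exists2 e, 0 < e & disk z e `<=` O.
Proof.
by move=> oO Oz; have /nbhs_norm1[e e0 He] := open_nbhs_nbhs (conj oO Oz); exists e.
Qed.

Lemma disk_le z e e' : e <= e' -> disk z e `<=` disk z e'.
Proof. by move=> ee x /lt_le_trans; exact. Qed.

Lemma box_le x e e' : e <= e' -> box x e `<=` box x e'.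
Proof. by move=> ee y [? ?]; split; exact: disk_le ee _ _. Qed.

Lemma open_box_sub (O : set (C * C)) x : open O -> O x ->
  exists2 e, 0 < e & box x e `<=` O.
Proof.
move=> oO Ox; have := open_nbhs_nbhs (conj oO Ox).
case: x {Ox} => u v [[/= U V] [/= /nbhs_norm1[e e0 He] /nbhs_norm1[d d0 Hd]] UV].
exists (Num.min e d) => [|[u' v'] [/= ue vd]]; first by rewrite lt_min e0.
apply: UV; split => /=.
  by apply: He; apply: lt_le_trans ue _; rewrite ge_min lexx.
by apply: Hd; apply: lt_le_trans vd _; rewrite ge_min lexx orbT.
Qed.

End complex_convexity.

(** * The punctured plane *)

Section plane_paths.
Local Open Scope complex_scope.
Variable R : realType.
Local Notation C := R[i].

Lemma real_avoid (s : seq R) (d : R) : 0 < d -> exists2 x, 0 < x < d & x \notin s.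
Proof.
elim: s d => [|a s IH] d d0; first by exists (d / 2) => //; lra.
have [d' d'0 [d'd ad']] : exists2 d', 0 < d' & d' <= d /\ (0 < a -> d' <= a).
  exists (if 0 < a then Num.min a d else d); case: ifP => a0 //.
    by rewrite lt_min a0.
  by rewrite !ge_min !lexx orbT.
have [x /andP[x0 xd] xs] := IH d' d'0; exists x; first by rewrite x0 (lt_le_trans xd).
rewrite inE negb_or xs andbT; apply/eqP => xa.
by move: xd; rewrite xa ltNge ad'// -xa.
Qed.

(** A path of two segments through [mid h], a point near the midpoint shifted sideways: each point
    of [F] blocks at most one value of [h] per segment. *)
Lemma plane_avoid (F : seq C) (D : set C) (z w : C) : open D -> convexs (@mixC R) D ->
  D z -> D w -> z \notin F -> w \notin F ->
  exists p : R -> C, [/\ is_path (D `&` [set x | x \notin F]) p, p 0 = z & p 1 = w].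
Proof.
move=> oD cD Dz Dw zF wF.
have [zw|zw] := eqVneq z w.
  by exists (fun=> z); split=> //; apply: is_path_cst.
pose mid (h : R) : C := z + (2^-1 +i* h) * (w - z).
have mid0 : mid 0 = mixC 2^-1 z w.
  by rewrite /mid /mixC [2^-1 +i* 0](_ : _ = 2^-1%:C)// rmorphB/=; ring.
have [d d0 Dmid] : exists2 d : R, 0 < d & forall h, 0 < h < d -> D (mid h).
  have cm : continuous mid by rewrite /mid; contc.
  have : nbhs (0 : R) (mid @^-1` D).
    apply: cm; apply: open_nbhs_nbhs; split=> //; rewrite mid0.
    by apply: cD => //; lra.
  move=> /nbhs_ballP[e /= e0 He]; exists e => // h /andP[h0 he]; apply: He.
  by rewrite /ball/= sub0r normrN gtr0_norm.
pose par (f : C) := (f - z) / (w - z).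
have wz0 : w - z != 0 by rewrite subr_eq0 eq_sym.
(* In the coordinate [par], where [z] is 0 and [w] is 1, the corner is [1/2 + i h]. The two
   quotients are the values of [h] for which the first, respectively the second, segment can pass
   through [f]. *)
have [h /andP[h0 hd] hF] := real_avoid ([seq Im (par f) / (2 * Re (par f)) | f <- F] ++
   [seq Im (par f) / (2 * (1 - Re (par f))) | f <- F]) d0.
move: hF; rewrite mem_cat negb_or => /andP[/mapP h1 /mapP h2].
have Dm : D (mid h) by apply: Dmid; rewrite h0.
have mixp := mixC_mixing R.
have parE (f m : C) : f = z + m * (w - z) -> par f = m.
  by move=> ->; rewrite /par addrAC subrr add0r mulfK.
have s1 t : 0 <= t <= 1 -> mixC t z (mid h) \notin F.
  move=> t01; apply/negP => tF.
  have pE : par (mixC t z (mid h)) = (t / 2) +i* (t * h).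
    apply: parE; rewrite /mixC /mid rmorphB/=.
    have -> : (t / 2) +i* (t * h) = t%:C * (2^-1 +i* h).
      by apply/eqP; rewrite eq_complex /=; apply/andP; split; apply/eqP; ring.
    by ring.
  have [t0|t0] := eqVneq t 0.
    by move: tF; rewrite t0; have [_ -> _ _] := mixp; rewrite (negbTE zF).
  by apply: h1; exists (mixC t z (mid h)) => //; rewrite pE /=; field.
have s2 t : 0 <= t <= 1 -> mixC t (mid h) w \notin F.
  move=> t01; apply/negP => tF.
  have pE : par (mixC t (mid h) w) = ((1 + t) / 2) +i* ((1 - t) * h).
    apply: parE; rewrite /mixC /mid.
    have -> : ((1 + t) / 2) +i* ((1 - t) * h) = (1 - t)%:C * (2^-1 +i* h) + t%:C.
      by apply/eqP; rewrite eq_complex /=; apply/andP; split; apply/eqP; field.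
    by rewrite rmorphB/=; ring.
  have [t1|t1] := eqVneq t 1.
    by move: tF; rewrite t1; have [_ _ -> _] := mixp; rewrite (negbTE wF).
  apply: h2; exists (mixC t (mid h) w) => //; rewrite pE /=; field.
  have : 1 - t != 0 by rewrite subr_eq0 eq_sym.
  by move=> t1'; rewrite (_ : 2 - (1 + t) = 1 - t)//; ring.
exists (pcat (seg (@mixC R) z (mid h)) (seg (@mixC R) (mid h) w)); split.
- apply: is_path_pcat; last by rewrite seg0// seg1.
    have [cs Ds] := is_path_seg mixp cD Dz Dm.
    by split=> // t; split; [exact: Ds|exact: s1 (clip01 t)].
  have [cs Ds] := is_path_seg mixp cD Dm Dw.
  by split=> // t; split; [exact: Ds|exact: s2 (clip01 t)].
- by rewrite pcat0 seg0.
- by rewrite pcat1 seg1.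
Qed.

End plane_paths.

Section punctured_plane.
Local Open Scope complex_scope.
Variables (R : realType) (r : seq R).
Local Notation C := R[i].
Local Notation mix := (@mixC R).
Local Notation mixp := (mixC_mixing R).

Definition punctures : seq C := [seq a%:C | a <- r].
Definition punctured : set C := [set z | z \notin punctures].
Local Notation B := punctured.

(* [gap x j]: exactly [j] punctures lie to the left of [x]. *)
Definition gap_index (x : R) : nat := count (fun a => a < x) r.
Definition gap (j : nat) : set R := [set x | x \notin r /\ gap_index x = j].

Lemma punctured_im z : Im z != 0 -> B z.
Proof.
move=> z0; apply/negP => /mapP[a _ za].
by move: z0; rewrite za /= eqxx.
Qed.

Lemma punctured_re z : Re z \notin r -> B z.
Proof. by move=> zr; apply/negP => /mapP[a ar za]; rewrite za /= ar in zr. Qed.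

Lemma punctured_real z : Im z = 0 -> B z -> Re z \notin r.
Proof.
case: z => a b /= -> Bz; apply/negP => ar; move: Bz; rewrite /B/= => /negP; apply.
by apply/mapP; exists a.
Qed.

Lemma open_punctured : open B.
Proof.
have -> : B = [set z | 0 < \big[Num.min/1]_(a <- r) norm1 (z - a%:C)].
  apply/seteqP; split=> z; rewrite /B/= /punctures.
    elim: (r) => [|a s IH]; first by rewrite big_nil.
    rewrite inE negb_or big_cons lt_min => /andP[za /IH->]; rewrite andbT.
    by rewrite lt_def norm1_ge0 norm1_eq0 subr_eq0 za.
  elim: (r) => [|a s IH] //; rewrite inE negb_or big_cons lt_min => /andP[za /IH->].
  by rewrite andbT -subr_eq0 -norm1_eq0 gt_eqF.
apply: open_preimage_lt; first by contc.
elim: (r) => [|a s IH].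
  rewrite (_ : (fun x => _) = fun=> 1); first by contc.
  by apply/funext => z; rewrite big_nil.
rewrite (_ : (fun x => _) =
  fun x => Num.min (norm1 (x - a%:C)) (\big[Num.min/1]_(a <- s) norm1 (x - a%:C))).
  by contc.
by apply/funext => z; rewrite big_cons.
Qed.

Lemma gap_convex j x y t : gap j x -> gap j y -> 0 <= t <= 1 -> gap j ((1 - t) * x + t * y).
Proof.
wlog xy : x y t / x <= y => [H|].
  have [xy|/ltW yx] := leP x y; first exact: H.
  move=> gx gy t01; rewrite addrC -{1}(subKr 1 t).
  by apply: H => //; lra.
move=> [xr <-] [yr yE] t01; set z := _ + _.
have [xz zy] : x <= z /\ z <= y by rewrite /z; split; nra.
have mono (u v : R) : u <= v -> subpred (fun a => a < u) (fun a => a < v).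
  by move=> uv a /lt_le_trans; exact.
have Ez : gap_index z = gap_index x.
  apply/eqP; rewrite eqn_leq -{1}yE; apply/andP; split; apply: sub_count; exact: mono.
split=> //; apply/negP => zr.
have [ze|zne] := eqVneq z y; first by rewrite ze (negbTE yr) in zr.
have zy' : z < y by rewrite lt_neqAle zne.
suff : (gap_index z < gap_index y)%N by rewrite Ez yE ltnn.
have : (0 < count (fun a : R => (z <= a)%R && (a < y)%R) r)%N.
  by rewrite -has_count; apply/hasP; exists z; rewrite // lexx zy'.
rewrite -(ltn_add2l (gap_index z)) addn0 => /leq_trans; apply.
rewrite /gap_index -count_predUI (eq_count (a2 := fun a => a < y)).
  rewrite (eq_count (a1 := predI _ _) (a2 := pred0)) ?count_pred0 ?addn0//.
  by move=> a /=; rewrite leNgt; case: (a < z).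
move=> a /=; rewrite leNgt; case: (ltP a z) => //= az.
by rewrite (lt_trans az).
Qed.

Lemma gap_exists j : sorted <%R r -> (j <= size r)%N -> exists x, gap j x.
Proof.
have H (a : R) (s : seq R) i : path <%R a s -> (i <= size s)%N ->
    exists x, [/\ a < x, x \notin s & count (fun b => b < x) s = i].
  elim: s a i => [|b s IH] a i /=; first by rewrite leqn0 => _ /eqP->; exists (a + 1); split=> //; lra.
  move=> /andP[ab bs]; case: i => [_|i iS].
    exists ((a + b) / 2).
    have all_lt : all (fun c => (a + b) / 2 < c) (b :: s).
      rewrite /=; apply/andP; split; first lra.
      apply/allP => c cs; apply: (@lt_trans _ _ b); first lra.
      by have /allP/(_ _ cs) := order_path_min lt_trans bs.
    split; first lra.
      by apply/negP => /(allP all_lt); rewrite ltxx.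
    apply/eqP; rewrite -leqn0 leqNgt -[(_ < _)%N]/(0 < count _ (b :: s))%N -has_count -all_predC.
    by apply: sub_all all_lt => c /=; rewrite -leNgt => /ltW.
  have [x [bx xs <-]] := IH b i bs iS; exists x; split; first exact: lt_trans ab bx.
    by rewrite inE negb_or xs andbT gt_eqF.
  by rewrite bx.
move=> rs js; suff [x [? ?]] : exists x, x \notin r /\ count (fun a => a < x) r = j.
  by exists x.
case: (r) rs js => [_|a s as_ js]; first by rewrite leqn0 => /eqP->; exists 0.
(* The sentinel [a - 1] lies left of all punctures, so that gap 0 is found like the others. *)
have p1 : path <%R (a - 1) (a :: s).
  by move: as_; rewrite /= => ->; rewrite andbT; lra.
by have [x [_ ? ?]] := H _ _ _ p1 js; exists x.
Qed.

Definition upper : set C := [set z | 0 < Im z].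
Definition lower : set C := [set z | Im z < 0].
Definition strip (c e : R) : set C := [set z | `|Re z - c| < e].

(** As the punctures are real, these convex open sets cover their complement. A strip stays away
    from the punctures, hence lies over a single gap, and every passage between the half planes is
    labelled by a gap. *)
Definition plane_cover (U : set C) : Prop :=
  [\/ U = upper, U = lower |
     exists c e, [/\ 0 < e, forall a, a \in r -> e <= `|a - c| & U = strip c e]].

Lemma strip_gap c e z : (forall a, a \in r -> e <= `|a - c|) -> strip c e z ->
  gap (gap_index c) (Re z).
Proof.
move=> ce zc; split.
  by apply/negP => /ce; rewrite leNgt => /negP; apply.
apply: eq_in_count => a /ce; move: zc; rewrite /strip/= ltr_norml => /andP[z1 z2].
by rewrite ler_normr => /orP[ac|ac]; apply/idP/idP => az; lra.
Qed.

Lemma plane_cover_open U : plane_cover U -> open U.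
Proof.
case=> [->|->|[c [e [_ _ ->]]]]; apply: open_preimage_lt; by contc.
Qed.

Lemma plane_cover_convex U : plane_cover U -> convexs mix U.
Proof.
case=> [->|->|[c [e [_ _ ->]]]] x y t; rewrite /upper /lower /strip/= ?Im_mixC ?Re_mixC.
- exact: convex_comb_gt.
- exact: convex_comb_lt.
- rewrite !ltr_norml !(ltrBrDr, ltrBlDr) => /andP[x1 x2] /andP[y1 y2] t01.
  by rewrite convex_comb_gt ?convex_comb_lt.
Qed.

Lemma plane_cover_sub U : plane_cover U -> U `<=` B.
Proof.
case=> [->|->|[c [e [e0 ce ->]]]] z.
- by rewrite /upper/= => z0; apply: punctured_im; rewrite gt_eqF.
- by rewrite /lower/= => z0; apply: punctured_im; rewrite lt_eqF.
- by move=> /(strip_gap ce)[zr _]; exact: punctured_re.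
Qed.

Lemma plane_cover_cover z : B z -> exists2 U, plane_cover U & U z.
Proof.
move=> Bz; case: (ltgtP (Im z) 0) => z0.
- by exists lower => //; exact: Or32.
- by exists upper => //; exact: Or31.
- have zr := punctured_real z0 Bz.
  suff [e e0 ez] : exists2 e, 0 < e & forall a, a \in r -> e <= `|a - Re z|.
    exists (strip (Re z) e); last by rewrite /strip/= subrr normr0.
    by apply: Or33; exists (Re z), e.
  elim: (r) zr => [|a s IH]; first by exists 1.
  rewrite inE negb_or => /andP[za /IH[e e0 es]].
  exists (Num.min e `|a - Re z|).
    by rewrite lt_min e0 normr_gt0 subr_eq0 eq_sym.
  move=> b; rewrite inE => /orP[/eqP->|/es be]; rewrite ge_min ?lexx ?orbT//.
  by rewrite be.
Qed.

Section crossing.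
Local Open Scope group_scope.
Variables (G : groupType) (X : nat -> G).

(* [X j] is picked up on entering the lower half plane through the [j]-th gap. *)
Definition crossing (y z : C) : G :=
  match (Im y < 0)%R, (Im z < 0)%R with
  | false, true => X (gap_index (Re z))
  | true, false => (X (gap_index (Re y)))^-1
  | _, _ => 1
  end.

Lemma crossing_cocycle U x y z : plane_cover U -> (U `&` B) x -> (U `&` B) y ->
  (U `&` B) z -> crossing x y * crossing y z = crossing x z.
Proof.
rewrite /crossing; case=> [->|->|[c [e [_ ce ->]]]] [/= Ux _] [/= Uy _] [/= Uz _].
- by rewrite !ltNge (ltW Ux) (ltW Uy) (ltW Uz) /= mul1g.
- by rewrite Ux Uy Uz mul1g.
- have [_ ->] := strip_gap ce Ux; have [_ ->] := strip_gap ce Uy.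
  have [_ ->] := strip_gap ce Uz.
  by do 3!case: ifP => _; rewrite ?mul1g ?mulg1 ?mulgV ?mulVg.
Qed.

(** A noncommutative winding number: the word in the [X j] that records the successive passages of
    [p] through the gaps. *)
Definition winding (p : R -> C) : G := approx_value B plane_cover crossing p.

Lemma winding_weight : weight B winding.
Proof.
apply: approx_value_weight.
- exact: plane_cover_open.
- exact: plane_cover_cover.
- exact: crossing_cocycle.
Qed.

(** The vertices can be taken on [p] itself, so that knowledge of the values of [p] bears on the
    crossings. *)
Lemma winding_chain p : is_path B p -> exists n (y : nat -> C),
  [/\ forall i, (i < n)%N -> exists2 U, plane_cover U & U (y i) /\ U (y i.+1),
      forall i, exists t, y i = p t, y 0%N = p 0%R /\ y n = p 1%R &
      winding p = \prod_(0 <= i < n) crossing (y i) (y i.+1)].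
Proof.
move=> hp.
have [n [g [U [z [n0 sU cz [z0 zn] gE]]]]] := approx_exists (G := G) crossing
  plane_cover_open plane_cover_cover (fun V _ h => h) hp (hp.2 0%R) (hp.2 1%R).
pose y i := p (i%:R / n%:R)%R.
have nn0 : (0 < n%:R :> R)%R by rewrite ltr0n.
have iS i : (i%:R / n%:R <= i.+1%:R / n%:R :> R)%R.
  by rewrite ler_pM2r ?invr_gt0// ler_nat.
have Uy i : (i < n)%N -> U i (y i) /\ U i (y i.+1).
  by move=> iN; split; apply: (sU i iN).2; rewrite lexx iS.
have [y0 yn] : y 0%N = p 0%R /\ y n = p 1%R.
  by rewrite /y mul0r divff// lt0r_neq0.
exists n, y; split=> //.
- by move=> i iN; exists (U i); [exact: (sU i iN).1|exact: Uy].
- by move=> i; exists (i%:R / n%:R)%R.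
- apply: (approx_valueE plane_cover_open plane_cover_cover (fun V _ h => h)
    crossing_cocycle hp) => //.
  exists U, y; split; [exact: n0|exact: sU| |by []|by []].
  by split=> [i _|]; [exact: hp.2|exact: Uy].
Qed.

Lemma winding_mem (Z : G -> Prop) p : Z 1 -> (forall g h, Z g -> Z h -> Z (g * h)) ->
  (forall j, (j <= size r)%N -> Z (X j) /\ Z (X j)^-1) -> is_path B p -> Z (winding p).
Proof.
move=> Z1 ZM ZX /winding_chain[n [y [_ _ _ ->]]].
elim/big_ind: _ => // i _; rewrite /crossing.
by do 2!case: ifP => _ //; apply ZX; rewrite /gap_index count_size.
Qed.

(** Where [crossing] is a coboundary along [p], the product telescopes. This evaluates the winding
    of explicit segments. *)
Lemma winding_potential p (v : C -> G) : is_path B p ->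
  (forall U y z, plane_cover U -> U y -> U z -> (exists s, y = p s) ->
     (exists s, z = p s) -> crossing y z = (v y)^-1 * v z) ->
  winding p = (v (p 0%R))^-1 * v (p 1%R).
Proof.
move=> hp H; have [n [y [Uy py [<- <-] ->]]] := winding_chain hp.
elim: n Uy => [|n IH] Uy; first by rewrite big_geq// mulVg.
rewrite big_nat_recr//= IH; last by move=> i iN; apply: Uy; exact: ltnW.
have [U cU [U1 U2]] := Uy n (ltnSn n).
by rewrite (H U)// mulgA mulgK.
Qed.

End crossing.

Section plane_weight.
Local Open Scope group_scope.
Variables (G : groupType) (W : (R -> C) -> G) (u0 : C).
Hypotheses (wW : weight B W) (u0_upper : upper u0).

Definition below : C := 0 -i* 1%R.

(** Half of a loop: [through c * (through c')^-1] is the weight of the loop based at [u0] that goes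
    down at [c] and comes back at [c']. *)
Definition through (c : R) : G := W (seg mix u0 c%:C) * W (seg mix c%:C below).

Definition upper_gap j : set C := [set z | (0 < Im z)%R \/ Im z = 0%R /\ gap j (Re z)].
Definition lower_gap j : set C := [set z | (Im z < 0)%R \/ Im z = 0%R /\ gap j (Re z)].
Definition strip_of_gap j : set C := [set z | gap j (Re z)].

Lemma upper_gap_convex j : convexs mix (upper_gap j).
Proof.
move=> x y t Ux Uy t01; rewrite /upper_gap/= Im_mixC Re_mixC.
case: Ux => [x0|[x0 gx]]; case: Uy => [y0|[y0 gy]].
- by left; nra.
- have [t1|t1] := eqVneq t 1%R; last by left; move: t1 => /eqP; nra.
  by right; rewrite t1 y0 subrr !mul0r !mul1r !add0r.
- have [t1|t1] := eqVneq t 0%R; last by left; move: t1 => /eqP; nra.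
  by right; rewrite t1 x0 subr0 !mul0r !mul1r !addr0.
- by right; rewrite x0 y0 !mulr0 addr0; split=> //; exact: gap_convex.
Qed.

Lemma lower_gap_convex j : convexs mix (lower_gap j).
Proof.
move=> x y t Ux Uy t01; rewrite /lower_gap/= Im_mixC Re_mixC.
case: Ux => [x0|[x0 gx]]; case: Uy => [y0|[y0 gy]].
- by left; nra.
- have [t1|t1] := eqVneq t 1%R; last by left; move: t1 => /eqP; nra.
  by right; rewrite t1 y0 subrr !mul0r !mul1r !add0r.
- have [t1|t1] := eqVneq t 0%R; last by left; move: t1 => /eqP; nra.
  by right; rewrite t1 x0 subr0 !mul0r !mul1r !addr0.
- by right; rewrite x0 y0 !mulr0 addr0; split=> //; exact: gap_convex.
Qed.

Lemma strip_of_gap_convex j : convexs mix (strip_of_gap j).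
Proof. by move=> x y t gx gy t01; rewrite /strip_of_gap/= Re_mixC; exact: gap_convex. Qed.

Lemma upper_gap_sub j : upper_gap j `<=` B.
Proof.
by move=> z [z0|[_ [zr _]]]; [apply: punctured_im; rewrite gt_eqF|exact: punctured_re].
Qed.

Lemma lower_gap_sub j : lower_gap j `<=` B.
Proof.
by move=> z [z0|[_ [zr _]]]; [apply: punctured_im; rewrite lt_eqF|exact: punctured_re].
Qed.

Lemma strip_of_gap_sub j : strip_of_gap j `<=` B.
Proof. by move=> z [zr _]; exact: punctured_re. Qed.

Lemma upper_triangle j x y z : upper_gap j x -> upper_gap j y -> upper_gap j z ->
  W (seg mix x y) * W (seg mix y z) = W (seg mix x z).
Proof. exact: (weight_triangle mixp wW (@upper_gap_convex j) (@upper_gap_sub j)). Qed.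

Lemma lower_triangle j x y z : lower_gap j x -> lower_gap j y -> lower_gap j z ->
  W (seg mix x y) * W (seg mix y z) = W (seg mix x z).
Proof. exact: (weight_triangle mixp wW (@lower_gap_convex j) (@lower_gap_sub j)). Qed.

Lemma strip_triangle j x y z : strip_of_gap j x -> strip_of_gap j y -> strip_of_gap j z ->
  W (seg mix x y) * W (seg mix y z) = W (seg mix x z).
Proof. exact: (weight_triangle mixp wW (@strip_of_gap_convex j) (@strip_of_gap_sub j)). Qed.

Lemma through_gap j c y z : gap j c -> (0 <= Im y)%R -> (Im z < 0)%R ->
  gap j (Re y) -> gap j (Re z) ->
  W (seg mix u0 y) * W (seg mix y z) * W (seg mix z below) = through c.
Proof.
move=> gc y0 z0 gy gz.
have Uc : upper_gap j c%:C by right.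
have Lc : lower_gap j c%:C by right.
have Uu : upper_gap j u0 by left.
have Uy : upper_gap j y by move: y0; rewrite le_eqVlt => /orP[/eqP/esym ?|?]; [right|left].
have Lz : lower_gap j z by left.
have Lb : lower_gap j below by left; rewrite /= ltrN10.
rewrite /through -(upper_triangle Uu Uc Uy) -(lower_triangle Lc Lz Lb).
rewrite -(@strip_triangle j y c%:C z)// !mulgA; congr (_ * _ * _).
rewrite -mulgA (@strip_triangle j c%:C y c%:C)//.
by rewrite (weight_segxx mixp wW) ?mulg1//; exact: upper_gap_sub Uc.
Qed.

Lemma through_eq j c c' : gap j c -> gap j c' -> through c = through c'.
Proof.
move=> gc gc'.
have c0 : (Im (c -i* 1%R) < 0)%R by rewrite /= ltrN10.
have H k : gap j k -> W (seg mix u0 c%:C) * W (seg mix c%:C (c -i* 1%R)) *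
    W (seg mix (c -i* 1%R) below) = through k.
  by move=> gk; apply: (@through_gap j k) => //=.
by rewrite -(H c)// -(H c').
Qed.

Variable m : nat -> R.
Hypothesis gap_m : forall j, (j <= size r)%N -> gap j (m j).

Definition through_loop j : G := through (m j) * (through (m 0%N))^-1.

(** Reference paths from [u0], reaching the lower half plane through gap 0. They act as a maximal
    tree, which makes the generator of gap 0 trivial. *)
Let tail (y : C) : G :=
  if (Im y < 0)%R then through (m 0%N) * W (seg mix below y) else W (seg mix u0 y).

Lemma tail_crossing U y z : plane_cover U -> (U `&` B) y -> (U `&` B) z ->
  tail y * W (seg mix y z) * (tail z)^-1 = crossing through_loop y z.
Proof.
have wV V x x' : convexs mix V -> V `<=` B -> V x -> V x' ->
    W (seg mix x x') = (W (seg mix x' x))^-1 by exact: (weight_segV mixp wW).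
have lower_below : lower below by rewrite /lower/= ltrN10.
have upperP : plane_cover upper by exact: Or31.
have lowerP : plane_cover lower by exact: Or32.
have lowerE x x' : lower x -> lower x' ->
    tail x * W (seg mix x x') * (tail x')^-1 = 1.
  move=> lx lx'.
  have E := weight_triangle mixp wW (plane_cover_convex lowerP) (plane_cover_sub lowerP)
    lower_below lx lx'.
  by rewrite /tail lx lx' -(mulgA (through _)) E mulgV.
have crossE c e x x' : (0 < e)%R -> (forall a, a \in r -> (e <= `|a - c|)%R) ->
    strip c e x -> strip c e x' -> (0 <= Im x)%R -> (Im x' < 0)%R ->
    tail x * W (seg mix x x') * (tail x')^-1 = through_loop (gap_index (Re x')).
  move=> e0 ce sx sx' x0 x'0; rewrite /tail x'0 ltNge x0 /=.
  rewrite invgM -(wV lower)//; last 2 first.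
  - exact: plane_cover_convex.
  - exact: plane_cover_sub.
  have [gx gx'] := (strip_gap ce sx, strip_gap ce sx').
  have mj : gap (gap_index c) (m (gap_index c)) by apply: gap_m; exact: count_size.
  rewrite !mulgA (through_gap mj x0 x'0 gx gx') /through_loop.
  by rewrite gx'.2.
case=> [->|->|[c [e [e0 ce ->]]]] [/= Uy By] [/= Uz Bz].
- rewrite /tail /crossing !ltNge (ltW Uy) (ltW Uz) /=.
  rewrite (weight_triangle mixp wW (plane_cover_convex upperP) (plane_cover_sub upperP))//.
  by rewrite mulgV.
- by rewrite lowerE// /crossing; move: Uy Uz; rewrite /lower/= => -> ->.
rewrite /crossing; case: ltP => y0; case: ltP => z0.
- exact: lowerE.
- rewrite -(crossE c e z y)//.
  rewrite !invgM invgK mulgA (wV (strip_of_gap (gap_index c)) z y) ?invgK//.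
  + exact: strip_of_gap_convex.
  + exact: strip_of_gap_sub.
  + exact: strip_gap Uz.
  + exact: strip_gap Uy.
- exact: (crossE c e).
- have uy x : (0 <= Im x)%R -> strip c e x -> upper_gap (gap_index c) x.
    rewrite le_eqVlt => /orP[/eqP/esym x0 sx|]; last by left.
    by right; split=> //; exact: strip_gap sx.
  rewrite /tail !ltNge y0 z0 /= (@upper_triangle (gap_index c) u0 y z) ?mulgV//.
  + by left.
  + exact: uy.
  + exact: uy.
Qed.

(** A segment closed up by reference paths is worth its crossing, and along a chain from [u0] to
    [u0] the reference paths cancel. Hence the loops that go down in gap [j] and return in gap 0
    determine every weight on loops at [u0]. *)
Lemma weight_winding p : is_path B p -> p 0%R = u0 -> p 1%R = u0 ->
  W p = winding through_loop p.
Proof.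
move=> hp p0 p1; pose c := crossing through_loop.
have [n [g ag]] := approx_exists (G := G) c plane_cover_open plane_cover_cover
  (fun V _ h => h) hp (hp.2 0%R) (hp.2 1%R).
rewrite /winding (approx_valueE plane_cover_open plane_cover_cover (fun V _ h => h)
  (@crossing_cocycle _ through_loop) hp ag).
have [U [y [n0 sU [Dy Uy] [y0 yn] ->]]] := ag.
have ag' : approx B plane_cover (fun x y => W (seg mix x y)) n p
    (chain_value (fun x y => W (seg mix x y)) n y).
  by exists U, y; split.
rewrite (weight_approx mixp wW plane_cover_convex plane_cover_sub (fun x h => h) hp ag').
have t0 : tail u0 = 1.
  rewrite /tail ltNge (ltW u0_upper) /= (weight_segxx mixp wW)//.
  by apply: punctured_im; rewrite gt_eqF.
suff H k : (k <= n)%N -> tail (y 0%N) * chain_value (fun x y => W (seg mix x y)) k y *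
    (tail (y k))^-1 = chain_value c k y.
  by have := H n (leqnn n); rewrite y0 yn p0 p1 t0 invg1 mul1g mulg1.
elim: k => [|k IH] kn; first by rewrite /chain_value !big_geq// mulg1 mulgV.
rewrite /chain_value !big_nat_recr//= -/(chain_value _ k y) -/(chain_value c k y).
have [Uk Uk'] := Uy k kn.
rewrite -IH ?(ltnW kn)// -[c (y k) _]/(crossing through_loop _ _).
rewrite -(@tail_crossing (U k) (y k) (y k.+1)).
- by rewrite !mulgA mulgVK.
- exact: (sU k kn).1.
- by split=> //; apply: Dy; exact: ltnW.
- by split=> //; exact: Dy.
Qed.

End plane_weight.
End punctured_plane.

(** * Weights that model a fundamental group *)

Section class_group.
Variables (R : realType) (T : topologicalType) (O : set T).

Definition path_connected := forall x y, O x -> O y ->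
  exists p : R -> T, [/\ is_path O p, p 0 = x & p 1 = y].

Definition separating (G : groupType) (W : (R -> T) -> G) :=
  forall p q, is_path O p -> is_path O q -> p 0 = q 0 -> p 1 = q 1 ->
    W p = W q -> homotopic O p q.

(** Together with [weight] and [separating], this makes [G] a model of the fundamental group of [O]
    at [x]. *)
Definition loops_onto (x : T) (G : groupType) (W : (R -> T) -> G) :=
  forall g, exists p, [/\ is_path O p, p 0 = x, p 1 = x & W p = g].

Lemma chart_class_weight (X : topologicalType) (e : X -> T) (d : T -> X) (x0 : X) :
  chart O e d -> path_connected ->
  exists W : (R -> T) -> fundamental_group R x0,
    [/\ weight O W, separating W & loops_onto (e x0) W].
Proof.
move=> ch pc; have [ce Oe eK dK _] := ch.
have beta_ex x : exists q : {path unit_interval R from x0 to x in X}, True.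
  have [p [hp p0 p1]] := pc (e x0) (e x) (Oe _) (Oe _).
  have cb := bundle_continuous ch hp.
  have b0 : d (p (val (zero : unit_interval R))) = x0 by rewrite val_zero p0 eK.
  have b1 : d (p (val (one : unit_interval R))) = x by rewrite val_one p1 eK.
  by exists (mk_path cb b0 b1).
pose ebeta x := sval (cid (beta_ex x)).
exists (class_weight ebeta ch); split.
- exact: class_weightP.
- by move=> p q hp hq p0 p1 /(class_weight_inj hp hq p0 p1).
- exact: class_weight_surj.
Qed.

Definition subset_inv (x0 : set_type O) (y : T) : set_type O :=
  if pselect (O y) is left Oy then exist (fun y => y \in O) y (mem_set Oy) else x0.

Lemma subset_chart (x0 : set_type O) :
  chart O (val : set_type O -> T) (subset_inv x0).
Proof.
rewrite /subset_inv; split.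
- exact: initial_continuous.
- by move=> x; exact: set_valP.
- move=> x; case: pselect => [Ox|]; first exact: val_inj.
  by case; exact: set_valP.
- by move=> y; rewrite inE => Oy; case: pselect.
- move=> Z f cf Of; apply/continuousP => _ [V oV <-].
  rewrite (_ : _ @^-1` _ = f @^-1` V); first by apply: open_comp => // z _; exact: cf.
  by apply/seteqP; split=> z /=; case: pselect => // /(_ (Of z)).
Qed.

Lemma class_group x0 : O x0 -> path_connected ->
  exists (G : groupType) (W : (R -> T) -> G),
    [/\ weight O W, separating W & loops_onto x0 W].
Proof.
move=> Ox0 pc; pose x : set_type O := exist (fun y => y \in O) x0 (mem_set Ox0).
have [W HW] := chart_class_weight x (subset_chart x) pc.
by exists (fundamental_group R x), W.
Qed.

Lemma separating1 (G : groupType) (W : (R -> T) -> G) p x : weight O W ->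
  separating W -> is_path O p -> p 0 = x -> p 1 = x -> W p = 1%g ->
  homotopic O p (fun=> x).
Proof.
move=> wW sW hp p0 p1 Wp; have Ox : O x by rewrite -p0; exact: hp.2.
apply: sW => //; first exact: is_path_cst.
by rewrite Wp (weight_cst wW).
Qed.

End class_group.

(** * Free groups by their universal property *)

Section free_on.
Local Open Scope group_scope.

(** Generation is stated as an induction principle and freeness as the existence of extensions, a
    form shared by [free_group k] and by the integers, free of rank 1. *)
Definition free_on k (F : groupType) (x : 'I_k -> F) :=
  (forall P : F -> Prop, P 1 -> (forall i, P (x i)) ->
     (forall g h, P g -> P h -> P (g * h)) -> (forall g, P g -> P g^-1) ->
     forall g, P g) /\
  (forall (G : groupType) (y : 'I_k -> G), exists psi : F -> G,
     (forall g h, psi (g * h) = psi g * psi h) /\ forall i, psi (x i) = y i).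

(** Gap 0, through which the reference paths return, gets the trivial value; the remaining [k] gaps
    between and beyond [k] punctures get the generators. *)
Definition shift_gen k (F : groupType) (x : 'I_k -> F) (j : nat) : F :=
  if j is i.+1 then (if insub i is Some i' then x i' else 1) else 1.

Lemma free_group_free_on k :
  free_on (fun i : 'I_k => word_class [:: (i, true)]).
Proof.
split=> [P P1 Px PM PV|G y].
  elim/word_class_ind; elim=> [|[i b] u IH]; first exact: P1.
  rewrite -cat1s -free_mul_class; apply: PM => //.
  case: b; first exact: Px.
  by have := PV _ (Px i); rewrite [_^-1]free_inv_class.
pose ev (u : seq ('I_k * bool)) : G :=
  \prod_(a <- u) (if a.2 then y a.1 else (y a.1)^-1).
have ev_equiv u v : free_equiv u v -> ev u = ev v.
  elim=> {u v} [u v i b|//|u v _ ->//|u v w _ -> _ ->//].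
  rewrite /ev !big_cat /= !big_cons big_nil mulg1; congr (_ * _).
  by case: b => /=; rewrite ?mulgV ?mulVg mul1g.
exists (fun g => ev (repr g)); split=> [|i]; last first.
  by rewrite (ev_equiv _ _ (repr_word_class _)) /ev big_cons big_nil mulg1.
elim/word_class_ind=> u; elim/word_class_ind=> v.
rewrite [_ * _]free_mul_class !(ev_equiv _ _ (repr_word_class _)).
by rewrite /ev big_cat.
Qed.

Lemma int_free_on :
  free_on (fun _ : 'I_1 => 1%R : Algebra.to_multiplicative int).
Proof.
split=> [P P1 Px PM PV g|G y].
  have Pn (n : nat) : P (n%:Z : Algebra.to_multiplicative int).
    elim: n => [|n IH]; first exact: P1.
    by rewrite -add1n PoszD; exact: (PM _ _ (Px ord0) IH).
  by case: g => n; [exact: Pn|rewrite NegzE; exact: (PV _ (Pn n.+1))].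
pose a := y ord0.
pose f (z : int) : G := match z with Posz n => a ^+ n | Negz n => (a ^+ n.+1)^-1 end.
have f1 (z : int) : f (z + 1)%R = f z * a.
  case: z => [n|[|n]].
  - by rewrite -PoszD addn1 /= expgSr.
  - by rewrite (_ : Negz 0 + 1 = 0)%R //= mulVg.
  - rewrite (_ : Negz n.+1 + 1 = Negz n)%R; last by rewrite !NegzE -addn1 PoszD; ring.
    by rewrite /= [in RHS]expgS invgM mulgVK.
have fn (z : int) (n : nat) : f (z + n%:Z)%R = f z * f n%:Z.
  elim: n => [|n IH]; first by rewrite addr0 mulg1.
  by rewrite -addn1 PoszD addrA f1 IH -mulgA [f (_ + 1)%R]f1.
exists f; split=> [g h|i]; last by rewrite (ord1 i).
rewrite -[(g * h)%g]/(g + h)%R.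
case: h => n; first exact: fn.
apply: (@mulIg _ (f n.+1%:Z)); rewrite -fn NegzE subrK -mulgA.
by rewrite -fn addNr mulg1.
Qed.

End free_on.

(** * The fundamental group of the punctured plane *)

Section punctured_plane_group.
Local Open Scope complex_scope.
Local Open Scope group_scope.
Variables (R : realType) (r : seq R).
Local Notation C := R[i].
Local Notation B := (punctured r).
Local Notation mix := (@mixC R).
Local Notation mixp := (mixC_mixing R).
Hypothesis sorted_r : sorted <%R r.

Lemma punctured_path_connected : path_connected R B.
Proof.
move=> x y Bx By.
have [|p [hp p0 p1]] := @plane_avoid R (punctures r) setT x y openT _ I I Bx By.
  by [].
by exists p; split=> //; apply: is_path_sub hp => z [].
Qed.

Lemma gap_points : exists m : nat -> R, forall j, (j <= size r)%N -> gap r j (m j).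
Proof.
have /choice[m mP] j : exists x, (j <= size r)%N -> gap r j x.
  have [jr|jr] := leqP j (size r); last by exists 0%R.
  by have [x gx] := gap_exists sorted_r jr; exists x.
by exists m.
Qed.

Definition loop_through (u0 : C) (c c' : R) : R -> C :=
  pcat (pcat (seg mix u0 c%:C) (seg mix c%:C (below R)))
       (preverse (pcat (seg mix u0 c'%:C) (seg mix c'%:C (below R)))).

Lemma loop_throughP u0 c c' j j' : upper u0 -> gap r j c -> gap r j' c' ->
  [/\ is_path B (loop_through u0 c c'), loop_through u0 c c' 0%R = u0,
      loop_through u0 c c' 1%R = u0 &
      forall (G : groupType) (W : (R -> C) -> G), weight B W ->
        W (loop_through u0 c c') = through W u0 c * (through W u0 c')^-1].
Proof.
move=> u0P gc gc'.
have H x i : gap r i x -> [/\ is_path B (seg mix u0 x%:C),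
    is_path B (seg mix x%:C (below R)) &
    is_path B (pcat (seg mix u0 x%:C) (seg mix x%:C (below R)))].
  move=> gx; have h1 : is_path B (seg mix u0 x%:C).
    apply: (is_path_sub (@upper_gap_sub _ r i)).
    by apply: (is_path_seg mixp (@upper_gap_convex _ r i)); [left|right].
  have h2 : is_path B (seg mix x%:C (below R)).
    apply: (is_path_sub (@lower_gap_sub _ r i)).
    apply: (is_path_seg mixp (@lower_gap_convex _ r i)); [by right|left].
    by rewrite /= ltrN10.
  by split=> //; apply: is_path_pcat; rewrite ?seg0 ?seg1//; exact: mixp.
have [h1 h2 h3] := H _ _ gc; have [h1' h2' h3'] := H _ _ gc'.
have e1 x : pcat (seg mix u0 x%:C) (seg mix x%:C (below R)) 1%R = below R.
  by rewrite pcat1 seg1//; exact: mixp.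
have e0 x : pcat (seg mix u0 x%:C) (seg mix x%:C (below R)) 0%R = u0.
  by rewrite pcat0 seg0//; exact: mixp.
have h4 := is_path_preverse h3'.
split.
- by apply: is_path_pcat => //; rewrite e1 preverse0 e1.
- by rewrite /loop_through pcat0 e0.
- by rewrite /loop_through pcat1 preverse1 e0.
- move=> G W wW; rewrite /loop_through wW.2//; last by rewrite e1 preverse0 e1.
  by rewrite (weight_preverse wW)// !wW.2// ?seg0 ?seg1//; exact: mixp.
Qed.

Section winding_group.
Variables (k : nat) (F : groupType) (x : 'I_k -> F).
Hypothesis size_r : size r = k.
Hypothesis xfree : free_on x.
Local Notation wind := (winding r (shift_gen x)).

(** After a detour through [c - i], only the vertical piece from [c] to [c - i] enters the lower
    half plane, and it does so in gap [j]. *)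
Lemma winding_through u0 j c : upper u0 -> gap r j c -> through wind u0 c = shift_gen x j.
Proof.
move=> u0P gc; have wW := winding_weight r (shift_gen x).
have lower_c : lower_gap r j (c -i* 1%R) by left; rewrite /= ltrN10.
have lower_b : lower_gap r j (below R) by left; rewrite /= ltrN10.
have real_c : lower_gap r j c%:C by right.
rewrite /through -(lower_triangle wW real_c lower_c lower_b).
have up1 : wind (seg mix u0 c%:C) = 1.
  have hp : is_path (upper_gap r j) (seg mix u0 c%:C).
    by apply: (is_path_seg mixp (@upper_gap_convex _ r j)); [left|right].
  rewrite (winding_potential (v := fun=> 1)) ?invg1 ?mulg1//.
    exact: is_path_sub (@upper_gap_sub _ r j) hp.
  move=> U y z _ _ _ [s ->] [s' ->]; rewrite /crossing.
  have pos t : (Im (seg mix u0 c%:C t) < 0)%R = false.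
    by apply/negbTE; rewrite -leNgt; case: (hp.2 t) => [/ltW//|[->]].
  by rewrite !pos.
have low1 : wind (seg mix (c -i* 1%R) (below R)) = 1.
  have cl : convexs mix (@lower R) by apply: (@plane_cover_convex _ r); exact: Or32.
  have hp : is_path (@lower R) (seg mix (c -i* 1%R) (below R)).
    by apply: (is_path_seg mixp cl); rewrite /lower/= ltrN10.
  rewrite (winding_potential (v := fun=> 1)) ?invg1 ?mulg1//.
    by apply: is_path_sub hp; apply: plane_cover_sub; exact: Or32.
  move=> U y z _ _ _ [s ->] [s' ->]; rewrite /crossing.
  by rewrite (hp.2 s) (hp.2 s').
rewrite up1 low1 mul1g mulg1.
have hp : is_path (strip_of_gap r j) (seg mix c%:C (c -i* 1%R)).
  by apply: (is_path_seg mixp (@strip_of_gap_convex _ r j)).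
pose v (z : C) : F := if (Im z < 0)%R then shift_gen x j else 1.
rewrite (winding_potential (v := v)).
- rewrite !seg0 ?seg1; try exact: mixp.
  by rewrite /v /= ltxx ltrN10 invg1 mul1g.
- exact: is_path_sub (@strip_of_gap_sub _ r j) hp.
- move=> U y z _ _ _ [s ->] [s' ->]; rewrite /crossing /v.
  have [_ ->] := hp.2 s; have [_ ->] := hp.2 s'.
  by do 2!case: ifP => _; rewrite ?invg1 ?mulg1 ?mul1g ?mulVg.
Qed.

Lemma winding_onto_upper u0 : upper u0 -> loops_onto B u0 wind.
Proof.
move=> u0P; have wW := winding_weight r (shift_gen x).
have Bu0 : B u0 by apply: punctured_im; rewrite gt_eqF.
have [m gm] := gap_points.
apply: xfree.1.
- by exists (fun=> u0); split=> //; [exact: is_path_cst|exact: (weight_cst wW)].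
- move=> i; have iS : (i.+1 <= size r)%N by rewrite size_r.
  have [hp p0 p1 Wp] := loop_throughP u0P (gm _ iS) (gm _ (leq0n _)).
  exists (loop_through u0 (m i.+1) (m 0%N)); split=> //.
  rewrite Wp// (winding_through u0P (gm _ iS)).
  rewrite (winding_through u0P (gm _ (leq0n _))).
  by rewrite /= invg1 mulg1 insubT// => H; congr x; exact: val_inj.
- move=> g h [p [hp p0 p1 <-]] [q [hq q0 q1 <-]].
  exists (pcat p q); rewrite pcat0 pcat1 wW.2 ?p1 ?q0//.
  by split=> //; apply: is_path_pcat; rewrite ?p1.
- move=> g [p [hp p0 p1 <-]]; exists (preverse p).
  by rewrite preverse0 preverse1 (weight_preverse wW)//; split=> //; exact: is_path_preverse.
Qed.

(** Take a separating weight [W]. It is itself a winding, with values [through_loop]; freeness gives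
    a morphism [psi] sending the generators to these values, so [W p] is the image of [wind p] and
    hence trivial. *)
Lemma winding_trivial_upper u0 p : upper u0 -> is_path B p -> p 0%R = u0 ->
  p 1%R = u0 -> wind p = 1 -> homotopic B p (fun=> u0).
Proof.
move=> u0P hp p0 p1 wp.
have Bu0 : B u0 by apply: punctured_im; rewrite gt_eqF.
have [G [W [wW sW _]]] := class_group Bu0 punctured_path_connected.
have [m gm] := gap_points.
apply: (separating1 wW sW) => //.
rewrite (weight_winding wW u0P gm hp p0 p1).
have [psi [psiM psix]] := xfree.2 G (fun i => through_loop W u0 m i.+1).
have psi1 : psi 1 = 1.
  by apply: (@mulgI _ (psi 1)); rewrite -psiM !mulg1.
have psiX j : (j <= size r)%N -> through_loop W u0 m j = psi (shift_gen x j).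
  case: j => [_|j jr]; first by rewrite /= psi1 /through_loop mulgV.
  by rewrite /= insubT ?size_r// -?size_r// => H; rewrite psix.
rewrite -psi1 -wp.
(* One chain computes the windings of [p] for all choices of values, so that [psi] can be applied
   factor by factor; the trivial cocycle serves only to obtain the chain. *)
have [n [g [U [y [n0 sU cy ye _]]]]] := approx_exists (G := G) (crossing r (fun=> 1))
  (@plane_cover_open _ r) (@plane_cover_cover _ r) (fun V _ h => h) hp (hp.2 0%R) (hp.2 1%R).
have ag (E : groupType) (Y : nat -> E) :
    winding r Y p = chain_value (crossing r Y) n y.
  apply: (approx_valueE (@plane_cover_open _ r) (@plane_cover_cover _ r)
    (fun V _ h => h) (@crossing_cocycle _ r _ Y) hp).
  by exists U, y; split; [exact: n0|exact: sU|exact: cy|exact: ye|].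
rewrite !ag /chain_value (big_morph psi psiM psi1); apply: eq_bigr => i _.
have psiV g' : psi g'^-1 = (psi g')^-1.
  by apply: (@mulgI _ (psi g')); rewrite -psiM !mulgV.
rewrite /crossing; do 2!case: ifP => _ //.
  by rewrite psiX ?psiV// /gap_index count_size.
by rewrite psiX// /gap_index count_size.
Qed.

Lemma winding_onto u1 : B u1 -> loops_onto B u1 wind.
Proof.
move=> Bu1 g; pose u0 : C := 0 +i* 1%R.
have u0P : upper u0 by rewrite /upper/= ltr01.
have Bu0 : B u0 by apply: punctured_im; rewrite gt_eqF.
have wW := winding_weight r (shift_gen x).
have [b [hb b0 b1]] := punctured_path_connected Bu0 Bu1.
have [p [hp p0 p1 Wp]] := winding_onto_upper u0P (wind b * g * (wind b)^-1).
have hbV := is_path_preverse hb.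
have h1 : is_path B (pcat (preverse b) p) by apply: is_path_pcat; rewrite ?preverse1 ?b0.
exists (pcat (pcat (preverse b) p) b); split.
- by apply: is_path_pcat; rewrite ?pcat1 ?p1.
- by rewrite !pcat0 preverse0.
- by rewrite pcat1.
- rewrite !wW.2 ?pcat1 ?p1 ?b0 ?preverse1 ?p0//.
  by rewrite (weight_preverse wW)// Wp !mulgA mulVg mul1g mulgVK.
Qed.

Lemma winding_trivial u1 p : is_path B p -> p 0%R = u1 -> p 1%R = u1 ->
  wind p = 1 -> homotopic B p (fun=> u1).
Proof.
move=> hp p0 p1 wp; pose u0 : C := 0 +i* 1%R.
have u0P : upper u0 by rewrite /upper/= ltr01.
have Bu0 : B u0 by apply: punctured_im; rewrite gt_eqF.
have Bu1 : B u1 by rewrite -p0; exact: hp.2.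
have wW := winding_weight r (shift_gen x).
have [b [hb b0 b1]] := punctured_path_connected Bu0 Bu1.
have hbV := is_path_preverse hb.
have h1 : is_path B (pcat b p) by apply: is_path_pcat; rewrite ?b1.
have h2 : is_path B (pcat (pcat b p) (preverse b)).
  by apply: is_path_pcat; rewrite ?pcat1 ?preverse0 ?p1.
have [G [W [wW' sW _]]] := class_group Bu0 punctured_path_connected.
have hW : W (pcat (pcat b p) (preverse b)) = 1.
  rewrite -(weight_cst wW' Bu0); apply: wW'.1 => //; first exact: is_path_cst.
  apply: winding_trivial_upper => //; first by rewrite !pcat0.
    by rewrite pcat1 preverse1.
  rewrite !wW.2 ?pcat1 ?preverse0 ?p1 ?b1//.
  by rewrite (weight_preverse wW)// wp mulg1 mulgV.
apply: (separating1 wW' sW) => //.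
move: hW; rewrite !wW'.2 ?pcat1 ?preverse0 ?p1 ?b1// (weight_preverse wW')//.
by move=> /divg1_eq H; apply: (@mulgI _ (W b)); rewrite mulg1.
Qed.

End winding_group.
End punctured_plane_group.

(** * Induction along a subdivided path *)

Section path_induction.
Local Open Scope group_scope.
Variables (R : realType) (T : topologicalType) (O O' : set T).
Variables (G : groupType) (W : (R -> T) -> G).
Hypotheses (OO' : O `<=` O') (wW : weight O' W).
Variable UU : set (set T).
Hypothesis UU_open : forall U, UU U -> open U.
Hypothesis UU_cover : forall x, O x -> exists2 U, UU U & U x.

Lemma small_subpaths p : is_path O p -> exists n U (q : nat -> R -> T),
  [/\ (0 < n)%N, subordinate UU n p U,
      forall i, (i < n)%N -> [/\ is_path (U i `&` O) (q i),
        q i 0%R = p (i%:R / n%:R)%R & q i 1%R = p (i.+1%:R / n%:R)%R] &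
      W p = \prod_(0 <= i < n) W (q i)].
Proof.
move=> hp.
(* Only the subdivision is wanted here, hence the trivial cocycle. *)
have [n [g [U [y [n0 sU _ _ _]]]]] := approx_exists (G := G) (fun _ _ => 1)
  UU_open UU_cover (fun V _ h => h) hp (hp.2 0%R) (hp.2 1%R).
have nn0 : (0 < n%:R :> R)%R by rewrite ltr0n.
pose q i t := psub p (i%:R / n%:R)%R (i.+1%:R / n%:R)%R (clip t).
have hq i : (i < n)%N -> is_path (U i `&` O) (q i).
  move=> iN; split=> [|t]; last split.
  - apply: cont_comp (is_path_psub (i%:R / n%:R)%R (i.+1%:R / n%:R)%R hp).1.
    by apply: cont_clip; exact: cont_id.
  - have iS : (i%:R / n%:R <= i.+1%:R / n%:R :> R)%R.
      by rewrite ler_pM2r ?invr_gt0// ler_nat.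
    apply: (sU i iN).2; have /andP[c0 c1] := clip01 t.
    by apply/andP; split; [nra|nra].
  - exact: hp.2.
exists n, U, q; split=> //.
- move=> i iN; split; first exact: hq.
    by rewrite /q clip0 psub0.
  by rewrite /q clip1 psub1.
- rewrite (weight_subdiv wW (is_path_sub OO' hp) n0).
  apply: eq_big_nat => i /andP[_ iN]; apply: (weight_ext wW).
  + exact/is_path_psub/(is_path_sub OO').
  + by apply: is_path_sub (hq i iN) => x [_ /OO'].
  + by move=> t t01; rewrite /q clip_id.
Qed.

(** [W] lives on [O'] while the cover only has to reach [O]: the induction runs over the points off
    the fibers above [K], or over the image of the section alone. *)
Lemma path_induction (Pr : T -> G -> Prop) :
  (forall U q g, UU U -> is_path (U `&` O) q -> Pr (q 0%R) g -> Pr (q 1%R) (g * W q)) ->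
  forall p g, is_path O p -> Pr (p 0%R) g -> Pr (p 1%R) (g * W p).
Proof.
move=> HU p g hp Pg; have [n [U [q [n0 sU hq ->]]]] := small_subpaths hp.
suff H k : (k <= n)%N -> Pr (p (k%:R / n%:R)%R) (g * \prod_(0 <= i < k) W (q i)).
  by have := H n (leqnn n); rewrite divff// pnatr_eq0 -lt0n.
elim: k => [|k IH] kn; first by rewrite big_geq// mulg1 mul0r.
have [hqk q0 q1] := hq k kn; rewrite big_nat_recr//= mulgA -q1.
by apply: HU hqk _; [exact: (sU k kn).1|rewrite q0; exact: IH (ltnW kn)].
Qed.

End path_induction.

Lemma finite_lower_bound (R : realType) (J : finType) (F : J -> R) :
  (forall j, 0 < F j) -> exists2 d, 0 < d & forall j, d <= F j.
Proof.
move=> F0; suff H (s : seq J) : exists2 d, 0 < d & forall j, j \in s -> d <= F j.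
  by have [d d0 dF] := H (enum J); exists d => // j; apply: dF; rewrite mem_enum.
elim: s => [|j s [d d0 ds]]; first by exists 1.
exists (Num.min d (F j)); first by rewrite lt_min d0 F0.
by move=> i; rewrite inE ge_min => /orP[/eqP->|/ds->]; rewrite ?lexx ?orbT.
Qed.

Lemma disk_avoid (R : realType) (s : seq R[i]) (z : R[i]) (e : R) : 0 < e ->
  exists2 w, disk z e w & w \notin s.
Proof.
move=> e0; have [x /andP[x0 xe] xs] := real_avoid [seq Re (w - z) | w <- s] e0.
exists (z + (real_complex R x)).
  by rewrite /disk/= addrAC subrr add0r norm1_real gtr0_norm.
apply/negP => zs; move: xs => /negP; apply; apply/mapP; exists (z + real_complex R x) => //.
by rewrite addrAC subrr add0r.
Qed.

(* The complement of the graphs [v = g j u] and of the vertical lines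
   [u = a], [a \in r]. *)
(** * Complements of graphs and vertical lines *)

Section fibered.
Local Open Scope complex_scope.
Variables (R : realType) (J : finType) (g : J -> R[i] -> R[i]) (r : seq R) (K : seq R[i]).
Local Notation C := R[i].
Local Notation B := (punctured r).
Local Notation mix := (@mixC R).
Local Notation mixp := (mixC_mixing R).
Hypothesis cg : forall j, continuous (g j).
Hypothesis gK : forall u i j, u \notin K -> g i u = g j u -> i = j.

Definition fiber (u : C) : set C := [set v | forall j, v <> g j u].
Definition graphs_compl : set (C * C) := [set x | fiber x.1 x.2].
Definition lines_compl : set (C * C) := [set x | graphs_compl x /\ B x.1].
Local Notation X' := graphs_compl.
Local Notation X := lines_compl.

(** The roof is separated from the graphs by its real part, which exceeds each [|Re (g j u)|]. It
    depends on [u] because the graphs are unbounded in general. *)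
Definition roof (u : C) : C := (1 + \sum_j `|Re (g j u)|)%:C.
Definition sect (u : C) : C * C := (u, roof u).
Definition in_fiber (u : C) (tau : R -> C) (t : R) : C * C := (u, tau t).

Lemma roof_fiber u : fiber u (roof u).
Proof.
move=> j /(congr1 (@complex.Re R)) /=; apply/eqP; rewrite gt_eqF//.
rewrite (bigD1 j)//=; apply: le_lt_trans (ler_norm _) _.
by rewrite addrCA -[ltLHS]addr0 ltrD2l ltr_wpDr// sumr_ge0.
Qed.

Lemma cont_roof : continuous roof.
Proof.
apply: cont_real_complex; apply: contD; first exact: contC.
elim: (index_enum J) => [|j s IH].
  by rewrite (_ : (fun z => _) = fun=> 0); [exact: contC|apply/funext => z; rewrite big_nil].
rewrite (_ : (fun z => _) = fun z => `|Re (g j z)| + \sum_(i <- s) `|Re (g i z)|).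
  apply: contD; [apply: cont_norm; apply: cont_Re; exact: cg|exact: IH].
by apply/funext => z; rewrite big_cons.
Qed.

Lemma cont_sect : continuous sect.
Proof. by apply: cont_pair; [exact: cont_id|exact: cont_roof]. Qed.

Lemma sect_lines_compl u : B u -> X (sect u).
Proof. by move=> Bu; split=> //; exact: roof_fiber. Qed.

Lemma open_graphs_compl : open X'.
Proof.
have -> : X' = [set x | 0 < \prod_j norm1 (x.2 - g j x.1)].
  apply/seteqP; split=> -[u v] /=.
    move=> uv; apply: prodr_gt0 => j _; rewrite lt_def norm1_ge0 norm1_eq0 subr_eq0.
    by rewrite andbT; apply/eqP; exact: uv.
  move=> + j vE; apply/negP; rewrite -leNgt.
  by rewrite (bigD1 j)//= -[v in v - _]/((u, v).2) vE subrr norm10 mul0r.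
apply: open_preimage_lt; first exact: contC.
elim: (index_enum J) => [|j s IH].
  by rewrite (_ : (fun z => _) = fun=> 1); [exact: contC|apply/funext => z; rewrite big_nil].
rewrite (_ : (fun z => _) =
  fun z => norm1 (z.2 - g j z.1) * \prod_(i <- s) norm1 (z.2 - g i z.1)).
  apply: contM IH; apply: cont_norm1; apply: contDC; first by contc.
  apply: contNC; apply: (@cont_comp _ _ _ (fun z : C * C => z.1) (g j)) (@cg j).
  by contc.
by apply/funext => z; rewrite big_cons.
Qed.

Lemma open_lines_compl : open X.
Proof.
apply: openI; first exact: open_graphs_compl.
apply: open_comp (@open_punctured _ r) => x _.
by apply: (@cont_fst (C * C)%type C C (fun x => x)); exact: cont_id.
Qed.

(** The roof counts as one more strand, so that [drag] carries the section to itself. *)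
Definition strand (o : option J) : C -> C := if o is Some j then g j else roof.

Lemma cont_strand o : continuous (strand o).
Proof. by case: o => [j|]; [exact: cg|exact: cont_roof]. Qed.

Lemma strand_inj u o o' : u \notin K -> strand o u = strand o' u -> o = o'.
Proof.
case: o o' => [j|] [j'|] //= uK; first by move/(gK uK) ->.
  by move=> E; have := @roof_fiber u j; rewrite E.
by move=> /roof_fiber.
Qed.

(* Follows each strand [o] from [u] to [u'], and fixes the points at distance
   more than [d] from all strands. *)
Definition drag (d : R) (u u' v : C) : C :=
  v + \sum_o (Num.max 0 (1 - norm1 (v - strand o u) / d))%:C * (strand o u' - strand o u).

Lemma drag_id d u v : drag d u u v = v.
Proof. by rewrite /drag big1 ?addr0// => o _; rewrite subrr mulr0. Qed.

Lemma cont_drag (Z : topologicalType) d (u u' v : Z -> C) :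
  continuous u -> continuous u' -> continuous v ->
  continuous (fun z => drag d (u z) (u' z) (v z)).
Proof.
move=> cu cu' cv; apply: contDC; [exact: cv|]; apply: cont_sumC => o; apply: contMC.
  apply: cont_real_complex; apply: cont_max; first exact: contC.
  apply: contD; first exact: contC; apply: contN; apply: contM; last exact: contC.
  apply: cont_norm1; apply: contDC; [exact: cv|]; apply: contNC.
  exact: (cont_comp cu (@cont_strand o)).
apply: contDC; first exact: (cont_comp cu' (@cont_strand o)).
by apply: contNC; exact: (cont_comp cu (@cont_strand o)).
Qed.

(** Strands move by less than [d] and stay more than [5 * d] apart, so at most one summand of [drag]
    acts on a given point. If a point at distance [n < d] from its strand were dragged onto that
    strand, moved by [w], then [n = n / d * norm1 w] with [norm1 w < d], so [n = 0] and the point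
    was on the strand from the start. *)
Lemma drag_local u1 : u1 \notin K -> exists d e, [/\ 0 < d, 0 < e &
  forall u u', disk u1 e u -> disk u1 e u' ->
    drag d u u' (roof u) = roof u' /\
    forall v, fiber u v -> fiber u' (drag d u u' v)].
Proof.
move=> u1K.
have [D D0 HD] : exists2 D, 0 < D & forall o o', o != o' ->
    D <= norm1 (strand o u1 - strand o' u1).
  have [|D D0 HD] := @finite_lower_bound R (option J * option J)%type
    (fun x => if x.1 == x.2 then 1 else norm1 (strand x.1 u1 - strand x.2 u1)).
    move=> [o o'] /=; case: eqVneq => // oo.
    rewrite lt_def norm1_ge0 norm1_eq0 subr_eq0 andbT.
    by apply/eqP => /(strand_inj u1K)/eqP; rewrite (negbTE oo).
  exists D => // o o' oo; have := HD (o, o'); rewrite /=.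
  by rewrite (negbTE oo).
(* Strands are at least [6 * d] apart over [u1] and stay within [d / 2] of their position there;
   this leaves the margin [5 * d]. *)
pose d := D / 6; have d0 : 0 < d by rewrite divr_gt0.
have De : D = 6 * d by rewrite /d mulrC divfK.
have /choice[E HE] o : exists e, 0 < e /\ forall u, disk u1 e u ->
    norm1 (strand o u - strand o u1) < d / 2.
  have : nbhs u1 (strand o @^-1` disk (strand o u1) (d / 2)).
    apply: cont_strand; apply: open_nbhs_nbhs; split; first exact: open_disk.
    by apply: disk_center; rewrite divr_gt0.
  by move=> /nbhs_norm1[e e0 He]; exists e.
have [e e0 He] := finite_lower_bound (fun o => (HE o).1).
exists d, e; split=> // u u' ue u'e.
have near o w : disk u1 e w -> norm1 (strand o w - strand o u1) < d / 2.
  by move=> we; apply: (HE o).2; exact: disk_le (He o) _ we.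
have move_lt o : norm1 (strand o u' - strand o u) < d.
  apply: le_lt_trans (norm1_dist_triangle (strand o u1) _ _) _.
  by rewrite [X in _ + X]norm1B [ltRHS]splitr ltrD// near.
have apart o o' w w' : disk u1 e w -> disk u1 e w' -> o != o' ->
    5 * d < norm1 (strand o w - strand o' w').
  move=> we we' oo; have := HD o o' oo; rewrite De => H6.
  have T1 := norm1_dist_triangle (strand o w) (strand o u1) (strand o' u1).
  have T2 := norm1_dist_triangle (strand o' w') (strand o w) (strand o' u1).
  have N1 := near o w we; have N2 := near o' w' we'.
  by have := norm1B (strand o w) (strand o u1); lra.
have drag_near o v : norm1 (v - strand o u) < d -> drag d u u' v =
    v + (1 - norm1 (v - strand o u) / d)%:C * (strand o u' - strand o u).
  move=> vo; rewrite /drag (bigD1 o)//= big1 ?addr0; last first.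
    move=> o' oo; rewrite max_l ?mul0r// subr_le0 ler_pdivlMr// mul1r.
    have T := norm1_dist_triangle v (strand o' u) (strand o u).
    have A := apart o' o u u ue ue oo.
    by have := norm1B v (strand o' u); lra.
  by rewrite max_r// subr_ge0 ler_pdivrMr// mul1r ltW.
split.
  rewrite (drag_near None) /= ?subrr ?norm10//.
  by rewrite mul0r subr0 mul1r addrC subrK.
move=> v vu j; have [[o vo]|far] := pselect (exists o, norm1 (v - strand o u) < d).
  rewrite (drag_near o v vo); set w := strand o u' - strand o u.
  set n := norm1 (v - strand o u) in vo *.
  have n0 : 0 <= n by exact: norm1_ge0.
  have [oj|oj] := eqVneq o (Some j).
    rewrite -[g j u']/(strand (Some j) u') -oj => Eq.
    have Ew : v - strand o u = (n / d)%:C * w.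
      have -> : v = strand o u' - (1 - n / d)%:C * w by rewrite -Eq addrK.
      by rewrite /w rmorphB/= rmorph1; ring.
    have := congr1 (@norm1 R) Ew; rewrite norm1M -/n ger0_norm ?divr_ge0// ?ltW//.
    have wd : norm1 w < d by exact: move_lt.
    have [n_0 _|n_0] := eqVneq n 0.
      move/eqP: n_0; rewrite /n norm1_eq0 subr_eq0 oj /= => /eqP vj.
      exact: (vu j vj).
    move=> /(congr1 ( *%R^~ d)) /=; rewrite mulrAC divfK ?lt0r_neq0//.
    by move=> /(mulfI n_0) dE; rewrite -dE ltxx in wd.
  move=> Eq; have A := apart o (Some j) u u' ue u'e oj.
  have T := norm1_dist_triangle v (strand o u) (g j u').
  have V : norm1 (v - g j u') < d.
    rewrite -Eq opprD addrA subrr add0r norm1N norm1M.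
    have wd : norm1 w < d by exact: move_lt.
    apply: le_lt_trans wd; rewrite -[leRHS]mul1r ler_wpM2r ?norm1_ge0//.
    have nd : n / d < 1 by rewrite ltr_pdivrMr// mul1r.
    have nd0 : 0 <= n / d by rewrite divr_ge0// ltW.
    by rewrite ler_norml; apply/andP; split; lra.
  by rewrite /= in A; have := norm1B v (strand o u); rewrite -/n => ?; lra.
have drag_far : drag d u u' v = v.
  rewrite /drag big1 ?addr0// => o _; rewrite max_l ?mul0r//.
  rewrite subr_le0 ler_pdivlMr// mul1r leNgt; apply/negP => vo.
  by apply: far; exists o.
rewrite drag_far => vj; apply: far; exists (Some j).
by rewrite vj; exact: move_lt.
Qed.

(* Along a path [q] in [U], fiber paths issued from the section slide from the
   fiber of [q 0] to that of [q 1], unchanged when [q] is a loop. *)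
Definition transports (U : set (C * C)) :=
  forall (G : groupType) (W : (R -> C * C) -> G), weight X W ->
  forall q tau, is_path (U `&` X) q ->
    is_path (fiber (q 0).1) tau -> tau 0 = roof (q 0).1 -> tau 1 = (q 0).2 ->
  (exists tau', [/\ is_path (fiber (q 1).1) tau', tau' 0 = roof (q 1).1,
      tau' 1 = (q 1).2 &
      (W (in_fiber (q 0%R).1 tau) * W q =
       W (fun t => sect (q t).1) * W (in_fiber (q 1%R).1 tau'))%g]) /\
  (q 0 = q 1 ->
      (W (in_fiber (q 0%R).1 tau) * W q =
       W (fun t => sect (q t).1) * W (in_fiber (q 0%R).1 tau))%g).

(** Two squares are glued: [H] drags [tau] over the projection of [q], and [L] joins the dragged
    endpoint to [q] by vertical segments inside a box where no graph passes. When [q] is a loop,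
    [drag] from a fiber to itself is the identity and [tau] is unchanged. The center [x1] may lie on
    a vertical line: [drag] acts on second coordinates only, so [q] may wind around that line. *)
Lemma transport x1 : X' x1 -> x1.1 \notin K -> exists2 e, 0 < e &
  [/\ box x1 e `<=` X', (forall x, box x1 e x -> x.1 \notin K) & transports (box x1 e)].
Proof.
move=> X'x1 x1K.
have [d [e1 [d0 e1_0 Hdrag]]] := drag_local x1K.
have [e2 e2_0 He2] := open_box_sub open_graphs_compl X'x1.
(* [drag] is the identity at the center, so by continuity it keeps points near the center inside the
   disk of radius [e2]. *)
have [e3 e3_0 He3] : exists2 e3, 0 < e3 & forall u u' v, disk x1.1 e3 u ->
    disk x1.1 e3 u' -> disk x1.2 e3 v -> disk x1.2 e2 (drag d u u' v).
  have cD : continuous (fun z : (C * C) * C => drag d z.1.1 z.1.2 z.2).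
    by apply: cont_drag; contc.
  have : nbhs (x1.1, x1.1, x1.2)
      ((fun z : (C * C) * C => drag d z.1.1 z.1.2 z.2) @^-1` disk x1.2 e2).
    apply: cD; apply: open_nbhs_nbhs; split; first exact: open_disk.
    by rewrite /= drag_id; exact: disk_center.
  case=> -[/= U V] [/= [[/= U1 U2] [/= nU1 nU2] U12] nV] UV.
  move: nU1 nU2 nV => /nbhs_norm1[a a0 Ha] /nbhs_norm1[b b0 Hb] /nbhs_norm1[c c0 Hc].
  exists (Num.min a (Num.min b c)); first by rewrite !lt_min a0 b0.
  rewrite /disk/= => u u' v; rewrite !lt_min => /and3P[ua _ _] /and3P[_ u'b _] /and3P[_ _ vc].
  by apply: (UV (u, u', v)); split; [apply: U12; split; [exact: Ha|exact: Hb]|exact: Hc].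
have [e4 e4_0 He4] : exists2 e4, 0 < e4 & forall u, disk x1.1 e4 u -> u \notin K.
  have oK : open [set u | u \notin K].
    have -> : [set u | u \notin K] = ~` [set u | u \in K].
      by apply/seteqP; split=> u /= /negP.
    rewrite openC; apply: (@accessible_finite_set_closed C).1.
      exact: hausdorff_accessible (@norm_hausdorff C C^o).
    exact: finite_seq.
  by have [e e0 He] := open_disk_sub oK x1K; exists e => // u /He.
pose e := Num.min (Num.min e1 e2) (Num.min e3 e4).
have [le1 le2 le3 le4] : [/\ e <= e1, e <= e2, e <= e3 & e <= e4].
  by rewrite /e !ge_min !lexx !orbT.
exists e; first by rewrite !lt_min e1_0 e2_0 e3_0.
split=> [x /(box_le le2)/He2//|x [/(disk_le le4)/He4//]|].
move=> G W wW q tau hq htau tau0 tau1.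
set u := (q 0).1; pose b t := (q t).1.
have cb : continuous b by apply: cont_fst; exact: hq.1.
have [Xq bq] : (forall t, X (q t)) /\ (forall t, box x1 e (q t)).
  by split=> t; have [] := hq.2 t.
have be t : disk x1.1 e (b t) by have [] := bq t.
have be1 t : disk x1.1 e1 (b t) by exact: disk_le le1 _ (be t).
have be3 t : disk x1.1 e3 (b t) by exact: disk_le le3 _ (be t).
pose H (z : R * R) : C * C := (b z.1, drag d u (b z.1) (tau z.2)).
have cH : continuous H.
  apply: cont_pair; first by apply: cont_comp cb; contc.
  apply: cont_drag; first exact: contC.
    by apply: cont_comp cb; contc.
  by apply: cont_comp htau.1; contc.
have XH z : X (H z).
  split; last by have [_] := Xq z.1.
  by have [_] := Hdrag u (b z.1) (be1 0) (be1 z.1); apply; exact: htau.2.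
have S1 := weight_square wW cH XH.
have qt z : disk x1.2 e2 (drag d u (b z) (q 0).2).
  by apply: He3 => //; [exact: be3|have [_] := bq 0; exact: disk_le].
pose L (z : R * R) : C * C :=
  (b z.1, mix (clip z.2) (drag d u (b z.1) (q 0).2) (q z.1).2).
have cL : continuous L.
  apply: cont_pair; first by apply: cont_comp cb; contc.
  apply: (cont_mix mixp); first by apply: cont_clip; contc.
    apply: cont_drag; first exact: contC; last exact: contC.
    by apply: cont_comp cb; contc.
  by apply: cont_snd; apply: cont_comp hq.1; contc.
have XL z : X (L z).
  split; last by have [_] := Xq z.1.
  apply: He2; split; first exact: disk_le le2 _ (be z.1).
  apply: disk_convex (clip01 z.2); first exact: qt.
  by have [_] := bq z.1; exact: disk_le.
have S2 := weight_square wW cL XL.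
have [_ m0 m1 mm] := mixp.
set w := drag d u (b 1) (q 0).2.
pose tau1' t := drag d u (b 1) (tau t).
have E1 : (fun t => H (0, t)) = in_fiber u tau.
  by apply/funext => t; rewrite /H /= drag_id.
have E2 : (fun t => H (t, 0)) = fun t => sect (q t).1.
  apply/funext => t; rewrite /H /= tau0.
  by have [-> _] := Hdrag u (b t) (be1 0) (be1 t).
have E3 : (fun t => H (1, t)) = in_fiber (q 1).1 tau1' by [].
have E4 : (fun t => H (t, 1)) = fun t => L (t, 0).
  by apply/funext => t; rewrite /H /L /= clip0 m0 tau1.
have E5 : (fun t => L (t, 1)) = q.
  by apply/funext => t; rewrite /L /= clip1 m1 /b; case: (q t).
have E6 : (fun t => L (0, t)) = fun=> q 0.
  by apply/funext => t; rewrite /L /= drag_id mm /b; case: (q 0).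
have E7 : (fun t => L (1, t)) = in_fiber (q 1).1 (seg mix w (q 1).2) by [].
have Wq : (W q = W (fun t => H (t, 1%R)) * W (in_fiber (q 1%R).1 (seg mix w (q 1%R).2)))%g.
  by move: S2; rewrite E5 E6 E7 -E4 (weight_cst wW)// mul1g.
have key : (W (in_fiber u tau) * W q = W (fun t => sect (q t).1) *
    W (in_fiber (q 1%R).1 tau1') * W (in_fiber (q 1%R).1 (seg mix w (q 1%R).2)))%g.
  by rewrite Wq mulgA -E1 S1 E2 E3.
have hX s : is_path (fiber (q 1).1) s -> is_path X (in_fiber (q 1).1 s).
  move=> [cs fs]; split=> [|t]; first by apply: cont_pair; [exact: contC|].
  by split; [exact: fs|have [_] := Xq 1].
have h1 : is_path (fiber (q 1).1) tau1'.
  split=> [|t]; last first.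
    by have [_] := Hdrag u (b 1) (be1 0) (be1 1); apply; exact: htau.2.
  by apply: cont_drag; [exact: contC|exact: contC|exact: htau.1].
have h2 : is_path (fiber (q 1).1) (seg mix w (q 1).2).
  split=> [|t]; last by have [] := XL (1, t).
  by apply: (cont_mix mixp); [apply: cont_clip; contc|exact: contC|exact: contC].
split.
  have t1 : tau1' 1 = seg mix w (q 1).2 0 by rewrite (seg0 mixp) /tau1' tau1.
  exists (pcat tau1' (seg mix w (q 1).2)); split.
  - exact: is_path_pcat.
  - rewrite pcat0 /tau1' tau0.
    by have [-> _] := Hdrag u (b 1) (be1 0) (be1 1).
  - by rewrite pcat1 (seg1 mixp).
  - rewrite key -mulgA -(wW.2 _ _ (hX _ h1) (hX _ h2)); last by rewrite /in_fiber t1.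
    by congr (_ * W _)%g; apply/funext => t; rewrite /in_fiber /pcat; case: ifP.
move=> q01; rewrite key /w /tau1' /b -q01 -/u drag_id (segxx mixp).
rewrite [X in (_ * X)%g](weight_cst wW) ?mulg1.
  by congr (_ * W _)%g; apply/funext => t; rewrite /in_fiber drag_id.
by have [] := Xq 0; rewrite /u; case: (q 0).
Qed.

End fibered.

(** * Base and fiber components of loops *)

Section decomposition.
Local Open Scope complex_scope.
Variables (R : realType) (J : finType) (g : J -> R[i] -> R[i]) (r : seq R) (K : seq R[i]).
Local Notation C := R[i].
Local Notation B := (punctured r).
Local Notation mix := (@mixC R).
Local Notation mixp := (mixC_mixing R).
Local Notation X' := (graphs_compl g).
Local Notation X := (lines_compl g r).
Local Notation sect := (sect g).
Local Notation roof := (roof g).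
Local Notation fiber := (fiber g).
Hypothesis cg : forall j, continuous (g j).
Hypothesis gK : forall u i j, u \notin K -> g i u = g j u -> i = j.
Hypothesis sorted_r : sorted <%R r.
Hypothesis rK : forall a, a \in r -> a%:C \notin K.

Definition joins (T : topologicalType) (O : set T) (p : R -> T) (x y : T) :=
  [/\ is_path O p, p 0 = x & p 1 = y].

Definition regular : set (C * C) := [set x | X x /\ x.1 \notin K].

Variable u0 : C.
Hypothesis u0_upper : upper u0.
Hypothesis u0K : u0 \notin K.
Hypothesis u0_generic : forall a t, a \in r -> 0 <= t <= 1 -> mixC t u0 a%:C \notin K.

Variables (G : groupType) (W : (R -> C * C) -> G).
Hypothesis wW : weight X W.

Lemma sect_weight : weight B (fun b => W (sect \o b)).
Proof.
have cs := cont_sect cg; have sB u : B u -> X (sect u) by exact: sect_lines_compl.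
split=> b b' hb hb'.
  move=> bb; apply: wW.1; [exact: is_path_map hb|exact: is_path_map hb'|].
  exact: homotopic_comp bb.
move=> b1; rewrite -wW.2; [|exact: is_path_map hb|exact: is_path_map hb'|].
  by congr W; apply/funext => t; rewrite /pcat /=; case: ifP.
by rewrite /= b1.
Qed.

Lemma is_path_in_fiber u tau : B u -> is_path (fiber u) tau -> is_path X (in_fiber u tau).
Proof.
move=> Bu [ct ft]; split=> [|t]; first by apply: cont_pair; [exact: contC|].
by split; [exact: ft|].
Qed.

Definition decomposed (x : C * C) (h : G) := exists b tau,
  [/\ joins B b u0 x.1, joins (fiber x.1) tau (roof x.1) x.2 &
      h = (W (sect \o b) * W (in_fiber x.1 tau))%g].

Definition transport_cover (U : set (C * C)) := exists x e,
  [/\ 0 < e, U = box x e, U `<=` X', (forall y, U y -> y.1 \notin K) & transports g r U].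

Lemma transport_cover_open U : transport_cover U -> open U.
Proof. by move=> [x [e [_ -> _ _ _]]]; exact: open_box. Qed.

Lemma transport_cover_cover x : regular x -> exists2 U, transport_cover U & U x.
Proof.
move=> [[X'x _] xK]; have [e e0 [eX' eK eT]] := transport r cg gK X'x xK.
by exists (box x e); [exists x, e|exact: box_center].
Qed.

Lemma regular_sub : regular `<=` X.
Proof. by move=> x []. Qed.

(** By transport, the fiber factor slides past each small piece of [q], whose projection is appended
    to the base factor. *)
Lemma decomposed_regular q h : is_path regular q -> decomposed (q 0) h ->
  decomposed (q 1) (h * W q)%g.
Proof.
move=> hq; apply: (path_induction regular_sub wW transport_cover_open
  transport_cover_cover) => // U {hq}q {}h [x [e [_ UE UX' UK UT]]] hq.
have hqX : is_path (U `&` X) q by apply: is_path_sub hq => y [Uy []].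
move=> [b [tau [[hb b0 b1] [htau tau0 tau1] ->]]].
have [[tau' [htau' tau'0 tau'1 E]] _] := UT _ _ wW q tau hqX htau tau0 tau1.
have hbq : is_path B (fun t => (q t).1).
  by split=> [|t]; [apply: cont_fst; exact: hq.1|have [_ []] := hqX.2 t].
exists (pcat b (fun t => (q t).1)), tau'; split.
- by split; [exact: is_path_pcat|rewrite pcat0|rewrite pcat1].
- by [].
- by rewrite sect_weight.2// -!mulgA E.
Qed.

(** The first coordinate bypasses [F] in the plane, the second follows a segment. Two boxes are
    allowed in order to compare paths in different members of a cover; [F] will be [K] or the
    punctures. *)
Lemma avoid_fibers (x y : C * C) z e z' e' (F : seq C) :
  (box z e `&` box z' e') x -> (box z e `&` box z' e') y -> x.1 \notin F -> y.1 \notin F ->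
  exists q, joins [set w | (box z e `&` box z' e') w /\ w.1 \notin F] q x y.
Proof.
move=> [[x1 x2] [x1' x2']] [[y1 y2] [y1' y2']] xF yF.
have [||||p [hp p0 p1]] := @plane_avoid R F (disk z.1 e `&` disk z'.1 e') x.1 y.1 _ _ _ _ xF yF.
- by apply: openI; exact: open_disk.
- by apply: convexsI; exact: disk_convex.
- by [].
- by [].
have cD : convexs mix (disk z.2 e `&` disk z'.2 e').
  by apply: convexsI; exact: disk_convex.
have hs := is_path_seg mixp cD (conj x2 x2') (conj y2 y2').
exists (fun t => (p t, seg mix x.2 y.2 t)); split.
- split=> [|t]; first by apply: cont_pair; [exact: hp.1|exact: hs.1].
  by have [[pt1 pt1'] ptF] := hp.2 t; have [st1 st1'] := hs.2 t; do !split.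
- by rewrite p0 (seg0 mixp); case: (x).
- by rewrite p1 (seg1 mixp); case: (y).
Qed.

Definition box_cover (U : set (C * C)) := exists x e,
  [/\ 0 < e, U = box x e & U `<=` X].

Lemma box_cover_cover x : X x -> exists2 U, box_cover U & U x.
Proof.
move=> Xx; have [e e0 He] := open_box_sub (@open_lines_compl _ _ _ r cg) Xx.
by exists (box x e); [exists x, e|exact: box_center].
Qed.

(** Transport fails over [K], which [p] may meet. So [p] is replaced by a polygon with vertices off
    [K], and each edge, inside a convex box, by a path of the same weight that avoids the fibers
    over [K]. *)
Lemma decomposed_path p : is_path X p -> p 0 = sect u0 -> (p 1).1 \notin K ->
  decomposed (p 1) (W p).
Proof.
move=> hp p0 p1.
have Bu0 : B u0 by apply: punctured_im; rewrite gt_eqF.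
have cvx U : box_cover U -> convexs (@mix2 R) U.
  by move=> [x [e [_ -> _]]]; exact: box_convex.
have opn U : box_cover U -> open U by move=> [x [e [_ -> _]]]; exact: open_box.
have sub U : box_cover U -> U `<=` X by move=> [x [e [_ ? ]]].
have dense V : open V -> V `&` X !=set0 -> V `&` regular !=set0.
  move=> oV [x [Vx Xx]].
  have [e e0 He] := open_box_sub (openI oV (@open_lines_compl _ _ _ r cg)) (conj Vx Xx).
  have [w we wK] := disk_avoid K x.1 e0.
  have [Vw Xw] : (V `&` X) (w, x.2) by apply: He; split=> //; exact: disk_center.
  by exists (w, x.2).
have R0 : regular (p 0) by split; [exact: hp.2|rewrite p0].
have R1 : regular (p 1) by split; [exact: hp.2|].
have [n [U [y [Uc [Dy Uy] [y0 yn] ->]]]] := weight_chain (mix2_mixing R) wW opn cvx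
  box_cover_cover sub regular_sub dense hp R0 R1.
rewrite -yn; suff H k : (k <= n)%N ->
    decomposed (y k) (\prod_(0 <= i < k) W (seg (@mix2 R) (y i) (y i.+1)))%g.
  exact: H.
elim: k => [_|k IH kn].
  rewrite big_geq// y0 p0; exists (fun=> u0), (fun=> roof u0); split.
  - by split=> //; exact: is_path_cst.
  - by split=> //; apply: is_path_cst; exact: roof_fiber.
  - have E : W (fun=> sect u0) = 1%g by apply: (weight_cst wW); exact: sect_lines_compl.
    by rewrite -[W (sect \o _)]/(W (fun=> sect u0)) -[W (in_fiber _ _)]/(W (fun=> sect u0)) E mulg1.
rewrite big_nat_recr//=; have [Uk Uk'] := Uy k kn.
have [_ yK] := Dy k (ltnW kn); have [_ yK'] := Dy k.+1 kn.
have [x [e [e0 UE UX]]] := Uc k kn.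
have [q [hq q0 q1]] : exists q, joins [set w | (box x e `&` box x e) w /\ w.1 \notin K]
    q (y k) (y k.+1).
  by apply: avoid_fibers => //; rewrite setIid -UE.
have hqU : is_path (U k) q by apply: is_path_sub hq => w [[? _] _]; rewrite UE.
have -> : W (seg (@mix2 R) (y k) (y k.+1)) = W q.
  apply: (weight_convex (mix2_mixing R) wW (cvx _ (Uc k kn)) UX) => //.
  + exact: (is_path_seg (mix2_mixing R) (cvx _ (Uc k kn)) Uk Uk').
  + by rewrite (seg0 (mix2_mixing R)).
  + by rewrite (seg1 (mix2_mixing R)).
rewrite -q1; apply: decomposed_regular; last by rewrite q0; apply: IH; exact: ltnW.
by apply: is_path_sub hq => w [[? _] ?]; split=> //; apply: UX; rewrite UE.
Qed.

Section commutation.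
Variable tau0 : R -> C.
Hypothesis htau0 : joins (fiber u0) tau0 (roof u0) (roof u0).
Local Notation h := (W (in_fiber u0 tau0)).
Local Notation S := (fun b => W (sect \o b)).

(** Transport along the section itself: the piece of path equals the section over its projection, so
    the fiber loop ends as a fiber loop. *)
Lemma slide_sect b : is_path (B `&` [set u | u \notin K]) b -> b 0 = u0 ->
  exists tau, joins (fiber (b 1)) tau (roof (b 1)) (roof (b 1)) /\
    (h * S b = S b * W (in_fiber (b 1%R) tau))%g.
Proof.
move=> hb b0.
pose O := [set x | regular x /\ x = sect x.1].
pose Pr (x : C * C) (k : G) := exists tau,
  joins (fiber x.1) tau (roof x.1) (roof x.1) /\
  (h * k = k * W (in_fiber x.1 tau))%g.
have hsb : is_path O (sect \o b).
  split=> [|t]; first exact: cont_comp hb.1 (cont_sect cg).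
  have [Bb bK] := hb.2 t; split=> //; split=> //; exact: sect_lines_compl.
have OX : O `<=` X by move=> x [[]].
have cov x : O x -> exists2 U, transport_cover U & U x.
  by move=> [Rx _]; exact: transport_cover_cover.
have := @path_induction _ _ O X _ W OX wW _ transport_cover_open cov Pr _
  (sect \o b) 1%g hsb.
rewrite mul1g; apply; last first.
  exists tau0; rewrite /= b0; split=> //.
  by rewrite mulg1 mul1g.
move=> U q k [x [e [_ UE UX' UK UT]]] hq [tau [[htau t0 t1] E]].
have hqX : is_path (U `&` X) q by apply: is_path_sub hq => z [Uz /OX].
have q02 : roof (q 0).1 = (q 0).2.
  by have [_ [_ ->]] := hq.2 0.
have q12 : roof (q 1).1 = (q 1).2.
  by have [_ [_ ->]] := hq.2 1.
have t1' : tau 1 = (q 0).2 by rewrite t1.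
have [[tau' [htau' s0 s1 E']] _] := UT _ _ wW q tau hqX htau t0 t1'.
exists tau'; split; first by split; [| |rewrite q12].
have qE : (fun t => sect (q t).1) = q.
  by apply/funext => t; have [_ [_ {2}->]] := hq.2 t.
by rewrite mulgA E -!mulgA E' qE.
Qed.

(** Since [a] is not in [K], fiber loops are unchanged by transport along small loops around
    [u = a]. The loop through the two gaps next to [a] is a segment from [u0] to a nearby [ul], a
    small loop [l] at [ul], and the way back; the fiber loop is slid to [ul], commutes with [l]
    there, and is slid back. *)
Lemma commute_around a c c' : a \in r -> gap r (gap_index r a) c ->
  gap r (gap_index r a).+1 c' ->
  (h * (through S u0 c' * (through S u0 c)^-1) =
   through S u0 c' * (through S u0 c)^-1 * h)%g.
Proof.
move=> ar gc gc'; set j := gap_index r a in gc gc'.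
have wS := sect_weight.
have Xa : X' (sect a%:C) by exact: roof_fiber.
have [e e0 [eX' eK eT]] := transport r cg gK Xa (rK ar).
have [d d0 Hd] : exists2 d, 0 < d & forall u, disk a%:C d u -> box (sect a%:C) e (sect u).
  have : nbhs a%:C (sect @^-1` box (sect a%:C) e).
    apply: (cont_sect cg); apply: open_nbhs_nbhs; split; first exact: open_box.
    exact: box_center.
  by move=> /nbhs_norm1[d d0 Hd]; exists d.
have [f f0 Hf] : exists2 f, 0 < f & forall b, b \in r -> b != a -> f <= `|b - a|.
  elim: (r) => [|b s [f f0 IH]]; first by exists 1.
  exists (Num.min f (if b == a then 1 else `|b - a|)).
    rewrite lt_min f0; case: eqVneq => [_|ba]; first exact: ltr01.
    by rewrite normr_gt0 subr_eq0.
  move=> b'; rewrite inE => /orP[/eqP->|/IH b's] b'a; rewrite ge_min.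
    by rewrite (negbTE b'a) lexx orbT.
  by rewrite b's.
(* [eps < d] keeps the small loop inside the disk, [eps < f] keeps the other punctures away from
   it. *)
pose eps := Num.min d f / 2.
have mf0 : 0 < Num.min d f by rewrite lt_min d0.
have [eps0 epsd epsf] : [/\ 0 < eps, eps < d & eps < f].
  have [m1 m2] : Num.min d f <= d /\ Num.min d f <= f by rewrite !ge_min !lexx orbT.
  by rewrite /eps; split; lra.
have cnt (x : R) : `|x - a| = eps -> x \notin r /\
    forall b, b \in r -> b != a -> (b < x) = (b < a).
  move=> xa; split=> [|b br ba].
    apply/negP => xr; have [xa'|xa'] := eqVneq x a.
      by move: xa; rewrite xa' subrr normr0 => E; rewrite -E ltxx in eps0.
    by have := Hf x xr xa'; rewrite xa leNgt epsf.
  have := Hf b br ba; move: xa => /eqP; rewrite eqr_norml ltW//= => /andP[/orP xa _].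
  rewrite ler_normr => /orP fb; apply/idP/idP => bx.
    by case: xa => /eqP xa; case: fb => fb; lra.
  by case: xa => /eqP xa; case: fb => fb; lra.
have uniq_r : uniq r by exact: lt_sorted_uniq sorted_r.
have gl : gap r j (a - eps).
  have [|nr H] := cnt (a - eps); first by rewrite addrAC subrr sub0r normrN gtr0_norm.
  split=> //; apply: eq_in_count => b br; have [->|ba] := eqVneq b a.
    by rewrite ltxx; apply/negbTE; rewrite -leNgt; lra.
  exact: H.
have gr : gap r j.+1 (a + eps).
  have [|nr H] := cnt (a + eps); first by rewrite addrAC subrr add0r gtr0_norm.
  have c1 : count_mem a r = 1%N by rewrite count_uniq_mem// ar.
  split=> //; rewrite /j /gap_index -addn1 -c1 -count_predUI.
  rewrite (eq_count (a1 := predI _ _) (a2 := pred0)) ?count_pred0 ?addn0; last first.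
    by move=> b /=; case: eqVneq => [->|//]; rewrite ?ltxx ?andbF// andbC.
  apply: eq_in_count => b br /=; have [->|ba] := eqVneq b a.
    by rewrite orbT ltrDl.
  by rewrite orbF; exact: H.
rewrite (through_eq wS u0_upper gc' gr) (through_eq wS u0_upper gc gl).
pose N := norm1 (u0 - a%:C); have N0 : 0 <= N by exact: norm1_ge0.
(* [ul] will be [a + s * (u0 - a)]; as [s * N < d], it lies in the disk around [a]. *)
pose s := d / (d + N).
have dN : 0 < d + N by rewrite ltr_pwDl.
have [s0 s1] : 0 < s /\ s <= 1.
  by rewrite /s; split; [rewrite divr_gt0|rewrite ler_pdivrMr// mul1r lerDl].
have sN : s * N < d.
  by rewrite /s mulrAC ltr_pdivrMr// ltr_pM2l// ltrDr.
pose ul := mixC (1 - s) u0 a%:C.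
pose c1 : C := (a + eps)%:C; pose c0 : C := (a - eps)%:C; pose nl : C := a -i* eps.
have ul_im : 0 < Im ul.
  by rewrite /ul Im_mixC /= mulr0 addr0 subKr mulr_gt0.
have Dul : disk a%:C d ul.
  rewrite /disk/= (_ : ul - a%:C = s%:C * (u0 - a%:C)).
    by rewrite norm1M gtr0_norm.
  by rewrite /ul /mixC subKr rmorphB/= rmorph1; ring.
have [Dc1 Dc0 Dnl] : [/\ disk a%:C d c1, disk a%:C d c0 & disk a%:C d nl].
  split; rewrite /disk/= /norm1/=.
  - by rewrite subr0 normr0 addr0 addrAC subrr add0r gtr0_norm.
  - by rewrite subr0 normr0 addr0 addrAC subrr add0r normrN gtr0_norm.
  - by rewrite subrr normr0 add0r subr0 normrN gtr0_norm.
have [Uu U1 Uul1] : [/\ upper_gap r j.+1 u0, upper_gap r j.+1 c1 & upper_gap r j.+1 ul].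
  by split; [left|right|left].
have [Uu' U0 Uul0] : [/\ upper_gap r j u0, upper_gap r j c0 & upper_gap r j ul].
  by split; [left|right|left].
have nl_im : Im nl < 0 by rewrite /= oppr_lt0.
have [L1 Ln1 Lb1] : [/\ lower_gap r j.+1 c1, lower_gap r j.+1 nl & lower_gap r j.+1 (below R)].
  by split; [right|left|left; rewrite /= ltrN10].
have [L0 Ln0 Lb0] : [/\ lower_gap r j c0, lower_gap r j nl & lower_gap r j (below R)].
  by split; [right|left|left; rewrite /= ltrN10].
pose Sg x y := S (seg mix x y).
have segB i V x y : convexs mix V -> V `<=` B -> V x -> V y -> disk a%:C d x ->
    disk a%:C d y -> (i = i :> nat) -> is_path (B `&` disk a%:C d) (seg mix x y).
  move=> cV VB Vx Vy dx dy _; split=> [|t]; first exact: (is_path_seg mixp cV Vx Vy).1.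
  split; first by apply: VB; exact: (is_path_seg mixp cV Vx Vy).2.
  exact: (is_path_seg mixp (@disk_convex _ _ _) dx dy).2.
have p1 := segB 0%N _ _ _ (@upper_gap_convex _ r j.+1) (@upper_gap_sub _ r j.+1) Uul1 U1 Dul Dc1 erefl.
have p2 := segB 0%N _ _ _ (@lower_gap_convex _ r j.+1) (@lower_gap_sub _ r j.+1) L1 Ln1 Dc1 Dnl erefl.
have p3 := segB 0%N _ _ _ (@lower_gap_convex _ r j) (@lower_gap_sub _ r j) Ln0 L0 Dnl Dc0 erefl.
have p4 := segB 0%N _ _ _ (@upper_gap_convex _ r j) (@upper_gap_sub _ r j) U0 Uul0 Dc0 Dul erefl.
have h12 := is_path_pcat p1 p2 (etrans (seg1 mixp _ _) (esym (seg0 mixp _ _))).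
have h34 := is_path_pcat p3 p4 (etrans (seg1 mixp _ _) (esym (seg0 mixp _ _))).
pose l := pcat (pcat (seg mix ul c1) (seg mix c1 nl)) (pcat (seg mix nl c0) (seg mix c0 ul)).
have e12 : pcat (seg mix ul c1) (seg mix c1 nl) 1 = nl by rewrite pcat1 (seg1 mixp).
have e34 : pcat (seg mix nl c0) (seg mix c0 ul) 0 = nl by rewrite pcat0 (seg0 mixp).
have hl : is_path (B `&` disk a%:C d) l by apply: is_path_pcat; rewrite // e12 e34.
have BD : B `&` disk a%:C d `<=` B by move=> x [].
have l0 : l 0 = ul by rewrite /l !pcat0 (seg0 mixp).
have l1 : l 1 = ul by rewrite /l !pcat1 (seg1 mixp).
have SlE : S l = (Sg ul c1 * Sg c1 nl * (Sg nl c0 * Sg c0 ul))%g.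
  rewrite (wS.2 _ _ (is_path_sub BD h12) (is_path_sub BD h34)) ?e12 ?e34//.
  rewrite (wS.2 _ _ (is_path_sub BD p1) (is_path_sub BD p2)) ?(seg1 mixp) ?(seg0 mixp)//.
  by rewrite (wS.2 _ _ (is_path_sub BD p3) (is_path_sub BD p4)) ?(seg1 mixp) ?(seg0 mixp).
(* Inserting [ul] on the way to both gaps and [nl] on the way to [below] makes the outer parts
   cancel, up to a conjugation. *)
have ratioE : (through S u0 (a + eps) * (through S u0 (a - eps))^-1 =
    Sg u0 ul * S l * (Sg u0 ul)^-1)%g.
  rewrite /through -(upper_triangle wS Uu Uul1 U1) -(lower_triangle wS L1 Ln1 Lb1).
  rewrite -(upper_triangle wS Uu' Uul0 U0) -(lower_triangle wS L0 Ln0 Lb0).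
  rewrite SlE /Sg (weight_segV mixp wS (@lower_gap_convex _ r j) (@lower_gap_sub _ r j) Ln0 L0).
  rewrite (weight_segV mixp wS (@upper_gap_convex _ r j) (@upper_gap_sub _ r j) U0 Uul0).
  by rewrite !invgM !mulgA mulgK.
have upper_cvx : convexs mix (@upper R).
  by apply: (@plane_cover_convex _ r); exact: Or31.
have hseg : is_path (B `&` [set u | u \notin K]) (seg mix u0 ul).
  have hs := is_path_seg mixp upper_cvx u0_upper ul_im.
  split=> [|t]; first exact: hs.1.
  split; first by apply: punctured_im; rewrite gt_eqF//; exact: hs.2.
  (* The segment to [ul] is a part of the segment from [u0] to [a], which avoids [K] by the choice
     of [u0]. *)
  rewrite /= (_ : seg mix u0 ul t = mixC (clip t * (1 - s)) u0 a%:C).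
    have /andP[t0 t1] := clip01 t; apply: u0_generic => //; apply/andP; split; nra.
  rewrite /seg /ul /mixC.
  by rewrite !(rmorphB, rmorphM, rmorph1)/=; ring.
have [tau [htau E]] := slide_sect hseg (seg0 mixp _ _).
rewrite (seg1 mixp) in htau E; have [ht t0 t1] := htau.
have hq : is_path (box (sect a%:C) e `&` X) (sect \o l).
  split=> [|t]; first exact: cont_comp hl.1 (cont_sect cg).
  have [Bl Dl] := hl.2 t; split; first exact: Hd.
  exact: sect_lines_compl.
have [_ comm] := eT _ _ wW _ tau hq (eq_ind_r (fun u => is_path (fiber u) tau) ht l0)
  (etrans t0 (congr1 roof (esym l0))) (etrans t1 (congr1 roof (esym l0))).
have {comm} := comm (congr1 sect (etrans l0 (esym l1))).
rewrite -[(fun t => _)]/(sect \o l) [(_ \o _) 0%R]/= l0 => comm.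
set V := W (in_fiber ul tau) in E comm.
have E' : (V * (Sg u0 ul)^-1 = (Sg u0 ul)^-1 * h)%g.
  by apply: (@mulgI _ (Sg u0 ul)); rewrite mulVKg mulgA -E mulgK.
by rewrite ratioE mulgA mulgA E -2!mulgA (mulgA V) comm -!mulgA E'.
Qed.

(** The weight of the section over [b] is a product of values [through_loop] and their inverses.
    Passing from gap [j] to gap [j.+1] multiplies such a value by a loop around one puncture, to
    which [commute_around] applies. *)
Lemma commute_sect b : joins B b u0 u0 -> (h * S b = S b * h)%g.
Proof.
move=> [hb b0 b1]; have wS := sect_weight.
have [m gm] := gap_points sorted_r.
rewrite (weight_winding wS u0_upper gm hb b0 b1).
pose Z k := (h * k = k * h)%g.
have Z1 : Z 1%g by rewrite /Z mulg1 mul1g.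
have ZM k l : Z k -> Z l -> Z (k * l)%g by rewrite /Z => Zk Zl; rewrite mulgA Zk -mulgA Zl mulgA.
have ZV k : Z k -> Z k^-1%g.
  by rewrite /Z => Zk; apply: (@mulgI _ k); rewrite mulVKg mulgA -Zk mulgK.
have ZX j : (j <= size r)%N -> Z (through_loop S u0 m j).
  elim: j => [_|j IH jr]; first by rewrite /through_loop mulgV.
  have ar : nth 0 r j \in r by rewrite mem_nth.
  have aj : gap_index r (nth 0 r j) = j by exact: count_lt_nth.
  have cj : gap r (gap_index r (nth 0 r j)) (m j) by rewrite aj; apply: gm; exact: ltnW.
  have cj' : gap r (gap_index r (nth 0 r j)).+1 (m j.+1) by rewrite aj; exact: gm.
  have := ZM _ _ (commute_around ar cj cj') (IH (ltnW jr)).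
  by rewrite /through_loop mulgA mulgVK.
apply: (winding_mem (Z := Z)) => // j jr; split; first exact: ZX.
exact/ZV/ZX.
Qed.

End commutation.
End decomposition.

(** * Filling in the vertical lines *)

Section filling.
Local Open Scope complex_scope.
Local Open Scope group_scope.
Variables (R : realType) (J : finType) (g : J -> R[i] -> R[i]) (r : seq R) (K : seq R[i]).
Local Notation C := R[i].
Local Notation B := (punctured r).
Local Notation X' := (graphs_compl g).
Local Notation X := (lines_compl g r).
Local Notation sect := (sect g).
Local Notation roof := (roof g).
Local Notation fiber := (fiber g).
Hypothesis cg : forall j, continuous (g j).
Hypothesis gK : forall u i j, u \notin K -> g i u = g j u -> i = j.
Hypothesis sorted_r : sorted <%R r.
Hypothesis rK : forall a, a \in r -> a%:C \notin K.
Hypothesis pcX : path_connected R X.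

(** The base point is [x + i]. A point [k] of [K] on the segment from it to [a] satisfies
    [Im k = 1 - t] and [Re k = (1 - t) * x + t * a], which excludes one value of [x]; the case
    [t = 1] is [a] itself, which is not in [K]. *)
Lemma generic_base_point : exists u0 : C, [/\ upper u0, u0 \notin K &
  forall a t, a \in r -> (0 <= t <= 1)%R -> mixC t u0 a%:C \notin K].
Proof.
have [x _ xF] := real_avoid ([seq Re k | k <- K] ++
  [seq (Re k - (1 - Im k) * a) / Im k | k <- K, a <- r])%R (ltr01 : (0 < 1 :> R)%R).
move: xF; rewrite mem_cat negb_or => /andP[xK xrK].
exists (x +i* 1%R); split; first exact: ltr01.
  by apply/negP => xk; move: xK => /negP; apply; apply/mapP; exists (x +i* 1%R).
move=> a t ar t01; apply/negP => kK; set k := mixC _ _ _ in kK.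
have kIm : Im k = (1 - t)%R by rewrite /k Im_mixC /= mulr1 mulr0 addr0.
have kRe : Re k = ((1 - t) * x + t * a)%R by rewrite /k Re_mixC.
have [t1|t1] := eqVneq t 1%R.
  have := rK ar; rewrite (_ : a%:C = k) ?kK// /k t1.
  by have [_ _ -> _] := mixC_mixing R.
clearbody k.
move: xrK => /negP; apply; apply/allpairsP; exists (k, a); split=> //=.
have t1' : (1 - t != 0)%R by rewrite subr_eq0 eq_sym.
by rewrite kIm kRe; field.
Qed.

Variable u0 : C.
Hypothesis u0_upper : upper u0.
Hypothesis u0K : u0 \notin K.
Hypothesis u0_generic :
  forall a t, a \in r -> (0 <= t <= 1)%R -> mixC t u0 a%:C \notin K.
Local Notation x0 := (sect u0).

Variables (G : groupType) (W : (R -> C * C) -> G).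
Hypotheses (wW : weight X W) (sW : separating X W) (oW : loops_onto X x0 W).

Lemma base_punctured : B u0.
Proof. by apply: punctured_im; rewrite gt_eqF. Qed.
Let Bu0 := base_punctured.

Definition proj (p : R -> C * C) (t : R) : C * C := sect (p t).1.

Lemma cont_sect_fst : continuous (fun x : C * C => sect x.1).
Proof. by apply: (cont_comp _ (cont_sect cg)); contc. Qed.

Lemma is_path_proj p : is_path X p -> is_path X (proj p).
Proof.
apply: (is_path_map cont_sect_fst) => x [_ Bx]; exact: sect_lines_compl.
Qed.

Lemma is_path_fst (p : R -> C * C) : is_path X p -> is_path B (fun t => (p t).1).
Proof. by move=> [cp Xp]; split=> [|t]; [exact: cont_fst|have [] := Xp t]. Qed.

Lemma proj_homotopic p q : homotopic X p q -> homotopic X (proj p) (proj q).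
Proof.
apply: (homotopic_comp cont_sect_fst) => x [_ Bx]; exact: sect_lines_compl.
Qed.

(** [e] is induced by the retraction of [X] onto the section. As [G] is only known through [W], it
    is defined on chosen loops, and [separating] makes it independent of the choice. *)
Lemma retraction_exists : exists e : G -> G, forall p, joins X p x0 x0 -> e (W p) = W (proj p).
Proof.
have /choice[rep repP] := oW; exists (fun k => W (proj (rep k))) => p [hp p0 p1].
have [hq q0 q1 Wq] := repP (W p).
apply: wW.1; [exact: is_path_proj|exact: is_path_proj|].
by apply/proj_homotopic/sW; rewrite ?p0 ?p1.
Qed.

Variable e : G -> G.
Hypothesis eE : forall p, joins X p x0 x0 -> e (W p) = W (proj p).

Lemma joins_pcat (T : topologicalType) (O : set T) (p q : R -> T) x y z :
  joins O p x y -> joins O q y z -> joins O (pcat p q) x z.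
Proof.
move=> [hp p0 p1] [hq q0 q1]; split; last by rewrite pcat1.
  by apply: is_path_pcat; rewrite ?p1.
by rewrite pcat0.
Qed.

Lemma joins_rev (T : topologicalType) (O : set T) (p : R -> T) x y :
  joins O p x y -> joins O (preverse p) y x.
Proof.
by move=> [hp p0 p1]; split; [exact: is_path_preverse|rewrite preverse0|rewrite preverse1].
Qed.

Lemma proj_pcat p q : proj (pcat p q) = pcat (proj p) (proj q).
Proof. by apply/funext => t; rewrite /proj /pcat; case: ifP. Qed.

Lemma retractionM k l : e (k * l) = e k * e l.
Proof.
have [p [hp p0 p1 <-]] := oW k; have [q [hq q0 q1 <-]] := oW l.
have [jp jq] : joins X p x0 x0 /\ joins X q x0 x0 by [].
have j : proj p 1%R = proj q 0%R by rewrite /proj p1 q0.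
rewrite -wW.2 ?p1 ?q0// (eE (joins_pcat jp jq)) (eE jp) (eE jq) proj_pcat.
by rewrite (wW.2 _ _ (is_path_proj hp) (is_path_proj hq) j).
Qed.

Lemma sect_loop (b : R -> C) : joins B b u0 u0 -> joins X (sect \o b) x0 x0.
Proof.
move=> [hb b0 b1]; split; rewrite /= ?b0 ?b1//.
apply: (is_path_map (cont_sect cg)) hb => u; exact: sect_lines_compl.
Qed.

Lemma retraction_sect (b : R -> C) : joins B b u0 u0 -> e (W (sect \o b)) = W (sect \o b).
Proof. by move=> /sect_loop/eE. Qed.

(** [proj] collapses the fiber factor to a constant path, so that [e] retains the base factor. *)
Lemma loop_decomposition k : exists b tau,
  [/\ joins B b u0 u0, joins (fiber u0) tau (roof u0) (roof u0),
      k = W (sect \o b) * W (in_fiber u0 tau) & e k = W (sect \o b)].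
Proof.
have [p [hp p0 p1 <-]] := oW k.
have [|b [tau [hb htau Wp]]] := decomposed_path cg gK u0_upper u0K wW hp p0.
  by rewrite p1.
rewrite p1 in hb htau Wp; exists b, tau; split=> //.
have [ht t0 t1] := htau.
have hf := is_path_in_fiber Bu0 ht.
have [hs s0 s1] := sect_loop hb.
have hc : joins X (pcat (sect \o b) (in_fiber u0 tau)) x0 x0.
  by apply: joins_pcat; split; rewrite ?s0 ?s1 /in_fiber ?t0 ?t1.
have j : (sect \o b) 1%R = in_fiber u0 tau 0%R by rewrite s1 /in_fiber t0.
have j' : proj (sect \o b) 1%R = proj (in_fiber u0 tau) 0%R by rewrite /proj j.
rewrite Wp -(wW.2 _ _ hs hf j) (eE hc) proj_pcat.
rewrite (wW.2 _ _ (is_path_proj hs) (is_path_proj hf) j').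
rewrite -[proj (in_fiber _ _)]/(fun=> x0) [X in _ * X](weight_cst wW) ?mulg1//.
exact: sect_lines_compl.
Qed.

Definition vertical (k : G) : G := (e k)^-1 * k.

(** For a mere endomorphism [e], the map [vertical] would only be a crossed morphism; it is
    multiplicative because the fiber factor of [k] commutes with [e l]. *)
Lemma verticalM k l : vertical (k * l) = vertical k * vertical l.
Proof.
have [b [tau [hb htau kE ek]]] := loop_decomposition k.
have [b' [tau' [hb' _ _ el]]] := loop_decomposition l.
have vk : vertical k = W (in_fiber u0 tau) by rewrite /vertical ek kE mulKg.
have C1 := commute_sect cg gK sorted_r rK u0_upper u0_generic wW htau hb'.
rewrite /vertical retractionM invgM -mulgA (mulgA _ k) -/(vertical k) vk el mulgA.
rewrite mulgA; congr (_ * _); apply: (@mulgI _ (W (sect \o b'))).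
by rewrite mulgA mulgV mul1g mulgA -C1 mulgK.
Qed.

Lemma vertical1 : vertical 1 = 1.
Proof. by apply: (@mulgI _ (vertical 1)); rewrite -verticalM !mulg1. Qed.

Lemma verticalV k : vertical k^-1 = (vertical k)^-1.
Proof. by apply: (@mulgI _ (vertical k)); rewrite -verticalM !mulgV vertical1. Qed.

(** Two kinds of boxes cover [X']. Off [K], boxes with transport, which may meet vertical lines;
    over [K], where there is no vertical line by [rK], boxes contained in [X]. *)
Definition fill_cover (U : set (C * C)) := transport_cover g r K U \/ box_cover g r U.

Lemma fill_coverP U : fill_cover U ->
  exists x d, [/\ (0 < d)%R, U = box x d & U `<=` X'].
Proof.
by case=> [[x [d [d0 UE UX _ _]]]|[x [d [d0 UE UX]]]]; exists x, d; split=> // y /UX[].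
Qed.

Lemma fill_cover_open U : fill_cover U -> open U.
Proof. by move=> /fill_coverP[x [d [_ -> _]]]; exact: open_box. Qed.

Lemma fill_cover_cover x : X' x -> exists2 U, fill_cover U & U x.
Proof.
move=> X'x; case: (boolP (x.1 \in K)) => [xK|xK].
  have [|U UU Ux] := @box_cover_cover _ _ _ r cg x; last by exists U => //; right.
  split=> //; apply/negP => /mapP[a ar xa].
  by have := rK ar; rewrite -xa xK.
have [d d0 [dX' dK dT]] := @transport _ _ _ r K cg gK x X'x xK.
by exists (box x d); [left; exists x, d|exact: box_center].
Qed.

Lemma fill_dense V : open V -> V `&` X' !=set0 -> V `&` X !=set0.
Proof.
move=> oV [x [Vx X'x]].
have [d d0 Hd] := open_box_sub (openI oV (open_graphs_compl cg)) (conj Vx X'x).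
have [w wd wr] := disk_avoid (punctures r) x.1 d0.
have [Vw X'w] : (V `&` X') (w, x.2) by apply: Hd; split=> //; exact: disk_center.
by exists (w, x.2).
Qed.

(** In a box of [X] the loop is contractible. In a transport box it commutes with the fiber factor
    of a path from the base point, so its conjugate by that path lies on the section, where
    [vertical] is trivial. *)
Lemma vertical_small_loop U (l : R -> C * C) y : fill_cover U -> joins (U `&` X) l y y ->
  vertical (W l) = 1.
Proof.
case=> [[x [d [d0 _ UX' UK UT]]]|[x [d [d0 UE UX]]]] [hl l0 l1]; last first.
  have hU : is_path U l by apply: is_path_sub hl => z [].
  have Uy : U y by rewrite -l0; exact: hU.2.
  have cU : convexs (@mix2 R) U by rewrite UE; exact: box_convex.
  have -> : W l = W (fun=> y).
    exact: (weight_convex (mix2_mixing R) wW cU UX hU (is_path_cst R Uy) l0 l1).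
  by rewrite (weight_cst wW (UX _ Uy)) vertical1.
have [Uy Xy] : (U `&` X) y by rewrite -l0; exact: hl.2.
have Xx0 : X x0 by exact: sect_lines_compl.
have [be [hbe be0 be1]] := pcX Xx0 Xy.
have [|b [tau [hb [ht t0 t1] Wbe]]] := decomposed_path cg gK u0_upper u0K wW hbe be0.
  by rewrite be1; exact: UK.
rewrite be1 in hb ht t0 t1 Wbe.
have hlX : is_path X l by apply: is_path_sub hl => z [].
have [_ comm] : _ /\ _ := UT _ _ wW l tau hl
  (eq_ind_r (fun z => is_path (fiber z.1) tau) ht l0)
  (etrans t0 (congr1 (fun z => roof z.1) (esym l0)))
  (etrans t1 (congr1 snd (esym l0))).
have {comm} := comm (etrans l0 (esym l1)).
rewrite l0 -[(fun t => _)]/(proj l) => comm.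
have hlB : joins B (fun t => (l t).1) y.1 y.1.
  by split; [exact: is_path_fst|rewrite l0|rewrite l1].
have hbl : joins B (pcat (pcat b (fun t => (l t).1)) (preverse b)) u0 u0.
  exact: joins_pcat (joins_pcat hb hlB) (joins_rev hb).
have sB := sect_weight cg wW.
have key : W be * W l * (W be)^-1 =
    W (sect \o (pcat (pcat b (fun t => (l t).1)) (preverse b))).
  have [[hb' b0 b1] [hl' l0' l1']] := (hb, hlB).
  have [hbl' _ bl1] := joins_pcat hb hlB.
  rewrite [RHS]sB.2//; last first.
  - by rewrite bl1 preverse0 b1.
  - exact: is_path_preverse.
  rewrite sB.2 ?b1 ?l0'// (weight_preverse sB hb') Wbe invgM !mulgA.
  by rewrite -(mulgA _ (W (in_fiber _ _)) (W l)) comm !mulgA mulgK.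
have : vertical (W be * W l * (W be)^-1) = 1.
  by rewrite key /vertical retraction_sect// mulVg.
rewrite !verticalM verticalV => /divg1_eq E.
by apply: (@mulgI _ (vertical (W be))); rewrite E mulg1.
Qed.

(** Any two points of [X] common to both boxes are joined inside both by a path that avoids the
    punctured fibers; each given path is compared with it within its own box. *)
Lemma vertical_small_path U U' (q q' : R -> C * C) y z : fill_cover U -> fill_cover U' ->
  joins (U `&` X) q y z -> joins (U' `&` X) q' y z -> vertical (W q) = vertical (W q').
Proof.
move=> cU cU' hq hq'.
have [x [d [d0 UE UX]]] := fill_coverP cU.
have [x' [d' [d'0 UE' UX']]] := fill_coverP cU'.
have UXs V : V `&` X `<=` X by move=> w [].
have small V s s' : fill_cover V -> joins (V `&` X) s y z -> joins (V `&` X) s' y z ->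
    vertical (W s) = vertical (W s').
  move=> cV hs hs'; have [[h1 s0 s1] [h2 s0' s1']] := (hs, hs').
  apply: (@mulIg _ (vertical (W s'))^-1); rewrite mulgV.
  have hr := is_path_preverse h2.
  rewrite -verticalV -(weight_preverse wW (is_path_sub (@UXs V) h2)) -verticalM.
  rewrite -(wW.2 _ _ (is_path_sub (@UXs V) h1) (is_path_sub (@UXs V) hr)).
    by apply: (vertical_small_loop cV (y := y)); exact: joins_pcat (joins_rev hs').
  by rewrite preverse0 s1 s1'.
have [[Uy [_ By]] [Uz [_ Bz]]] : (U `&` X) y /\ (U `&` X) z.
  by have [[_ hU] <- <-] := hq; split; [exact: (hU 0%R)|exact: (hU 1%R)].
have [Uy' Uz'] : U' y /\ U' z.
  by have [[_ hU] <- <-] := hq'; split; [exact: (hU 0%R).1|exact: (hU 1%R).1].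
have [q'' [hq'' q0 q1]] : exists q'' : R -> C * C, joins
    [set w | (box x d `&` box x' d') w /\ w.1 \notin punctures r] q'' y z.
  by apply: avoid_fibers => //; rewrite -UE -UE'.
have hs : joins (U `&` X) q'' y z.
  split=> //; apply: is_path_sub hq'' => w [[w1 w2] wr]; rewrite -UE in w1.
  by split=> //; split=> //; exact: UX.
have hs' : joins (U' `&` X) q'' y z.
  split=> //; apply: is_path_sub hq'' => w [[w1 w2] wr]; rewrite -UE' in w2.
  by split=> //; split=> //; exact: UX'.
by rewrite (small _ _ _ cU hq hs) (small _ _ _ cU' hs' hq').
Qed.

(** The cocycle of the gluing argument. It is meaningful for two points of [X] in a common member of
    the cover of [X'], and 1 where no small path exists. *)
Definition fill_value (y z : C * C) : G :=
  xget 1 [set k | exists U q, [/\ fill_cover U, joins (U `&` X) q y z & k = vertical (W q)]].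

Lemma fill_valueE U (q : R -> C * C) y z : fill_cover U -> joins (U `&` X) q y z ->
  fill_value y z = vertical (W q).
Proof.
move=> cU hq; rewrite /fill_value.
have [|U' [q' [cU' hq' ->]]] := @xgetPex G 1
    [set k | exists U q, [/\ fill_cover U, joins (U `&` X) q y z & k = vertical (W q)]].
  by exists (vertical (W q)), U, q.
exact: vertical_small_path cU' cU hq' hq.
Qed.

Lemma fill_joins U y z : fill_cover U -> (U `&` X) y -> (U `&` X) z ->
  exists q : R -> C * C, joins (U `&` X) q y z.
Proof.
move=> cU [Uy [_ By]] [Uz [_ Bz]]; have [x [d [d0 UE UX]]] := fill_coverP cU.
have [q [hq q0 q1]] : exists q : R -> C * C, joins
    [set w | (box x d `&` box x d) w /\ w.1 \notin punctures r] q y z.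
  by apply: avoid_fibers => //; rewrite -UE.
exists q; split=> //; apply: is_path_sub hq => w [[w1 w2] wr]; rewrite -UE in w1.
by split=> //; split=> //; exact: UX.
Qed.

Lemma fill_cocycle U x y z : fill_cover U -> (U `&` X) x -> (U `&` X) y ->
  (U `&` X) z -> fill_value x y * fill_value y z = fill_value x z.
Proof.
move=> cU Ux Uy Uz; have [q hq] := fill_joins cU Ux Uy.
have [q' hq'] := fill_joins cU Uy Uz.
rewrite (fill_valueE cU hq) (fill_valueE cU hq') (fill_valueE cU (joins_pcat hq hq')).
have UXs : U `&` X `<=` X by move=> w [].
have [[h1 _ q1] [h2 q0' _]] := (hq, hq').
by rewrite -verticalM -wW.2 ?q1 ?q0'//; exact: is_path_sub UXs _.
Qed.

Lemma fill_approx (p : R -> C * C) : is_path X p ->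
  exists n, approx X fill_cover fill_value n p (vertical (W p)).
Proof.
move=> hp; have XX : X `<=` X by [].
have cov x : X x -> exists2 U, fill_cover U & U x by move=> [X'x _]; exact: fill_cover_cover.
have [n [U [q [n0 sU hq ->]]]] := small_subpaths XX wW fill_cover_open cov hp.
have nn0 : (0 < n%:R :> R)%R by rewrite ltr0n.
exists n, U, (fun i => p (i%:R / n%:R)%R); split=> //.
- split=> i iN; first exact: hp.2.
  have [[_ h] q0 q1] := hq i iN; rewrite -q0 -q1.
  by split; [have [] := h 0%R|have [] := h 1%R].
- by rewrite mul0r divff// lt0r_neq0.
- rewrite (big_morph vertical verticalM vertical1) /chain_value.
  apply: eq_big_nat => i /andP[_ iN]; have [h q0 q1] := hq i iN.
  by rewrite -(fill_valueE (sU i iN).1 (And3 h q0 q1)).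
Qed.

(** The null homotopy may cross the vertical lines, where [W] has no meaning; the cocycle
    [fill_value] on the dense subset [X] of [X'] suffices to evaluate both ends of the homotopy. *)
Lemma filling (p : R -> C * C) x1 : joins X p x1 x1 -> homotopic X' p (fun=> x1) ->
  vertical (W p) = 1.
Proof.
move=> [hp p0 p1] px1.
have Xx1 : X x1 by rewrite -p0; exact: hp.2.
have XX' : X `<=` X' by move=> x [].
have hc := is_path_cst R Xx1.
have [n ap] := fill_approx hp; have [m am] := fill_approx hc.
rewrite (approx_homotopic fill_cover_open fill_cover_cover fill_dense fill_cocycle
  (is_path_sub XX' hp) (is_path_sub XX' hc) px1 ap am).
by rewrite (weight_cst wW Xx1) vertical1.
Qed.

Lemma filling_trivial (p : R -> C * C) x1 : joins X p x1 x1 ->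
  homotopic B (fun t => (p t).1) (fun=> x1.1) -> homotopic X' p (fun=> x1) ->
  homotopic X p (fun=> x1).
Proof.
move=> hpj pB pX'; have [hp p0 p1] := hpj.
have Xx1 : X x1 by rewrite -p0; exact: hp.2.
apply: (separating1 wW sW) => //.
have Xx0 : X x0 by exact: sect_lines_compl.
have [be hbe] := pcX Xx0 Xx1; have [hbe' b0 b1] := hbe.
(* [e] is described on loops at the base point only, so [p] is conjugated by a path [be] to [x1]. *)
have hj := joins_pcat (joins_pcat hbe hpj) (joins_rev hbe).
have We : W (pcat (pcat be p) (preverse be)) = W be * W p * (W be)^-1.
  have [h _ h1] := joins_pcat hbe hpj.
  rewrite wW.2//; [|exact: is_path_preverse|by rewrite h1 preverse0 b1].
  by rewrite wW.2 ?b1 ?p0// (weight_preverse wW).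
have Wproj : W (proj p) = 1.
  rewrite -(weight_cst wW (sect_lines_compl g Xx1.2)); apply: wW.1.
  - exact: is_path_proj.
  - by apply: is_path_cst; exact: (sect_lines_compl g Xx1.2).
  - apply: homotopic_comp pB; first exact: cont_sect.
    by move=> u; exact: sect_lines_compl.
have e1 : e 1 = 1 by apply: (@mulgI _ (e 1)); rewrite -retractionM !mulg1.
have eV k : e k^-1 = (e k)^-1.
  by apply: (@mulgI _ (e k)); rewrite -retractionM !mulgV.
have ep : e (W p) = 1.
  have := eE hj; rewrite We !retractionM eV !proj_pcat.
  have [hpr h2 hbr] : [/\ is_path X (proj p), is_path X (proj be) &
      is_path X (proj (preverse be))].
    by split; apply: is_path_proj => //; exact: is_path_preverse.
  have j1 : proj be 1%R = proj p 0%R by rewrite /proj b1 p0.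
  have h3 := is_path_pcat h2 hpr j1.
  have j2 : pcat (proj be) (proj p) 1%R = proj (preverse be) 0%R.
    by rewrite pcat1 /proj p1 preverse0 b1.
  rewrite (wW.2 _ _ h3 hbr j2) (wW.2 _ _ h2 hpr j1) Wproj mulg1.
  rewrite -[proj (preverse be)]/(preverse (proj be)) (weight_preverse wW h2) mulgV.
  by move=> /divg1_eq E; apply: (@mulgI _ (e (W be))); rewrite E mulg1.
have := filling hpj pX'; rewrite /vertical ep invg1 mul1g.
exact.
Qed.

End filling.

Theorem fibered_trivial (R : realType) (J : finType) (g : J -> R[i] -> R[i]) (r : seq R)
    (K : seq R[i]) (p : R -> R[i] * R[i]) x1 :
  (forall j, continuous (g j)) ->
  (forall u i j, u \notin K -> g i u = g j u -> i = j) ->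
  sorted <%R r -> (forall a, a \in r -> real_complex R a \notin K) ->
  path_connected R (lines_compl g r) ->
  joins (lines_compl g r) p x1 x1 ->
  homotopic (punctured r) (fun t => (p t).1) (fun=> x1.1) ->
  homotopic (graphs_compl g) p (fun=> x1) ->
  homotopic (lines_compl g r) p (fun=> x1).
Proof.
move=> cg gK sr rK pcX.
have [u0 [u0P u0K u0g]] := @generic_base_point _ r K rK.
have X0 : lines_compl g r (sect g u0).
  by apply: sect_lines_compl; apply: punctured_im; rewrite gt_eqF.
have [G [W [wW sW oW]]] := class_group X0 pcX.
have [e eE] := retraction_exists cg wW sW oW.
exact: (filling_trivial cg gK sr rK pcX u0P u0K u0g wW sW oW eE).
Qed.

(** * Families of parallel lines *)

Section affine_arrangement.
Local Open Scope complex_scope.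
Variables (R : realType) (I : finType) (c a b : I -> R[i]) (r : I -> seq R).
Local Notation C := R[i].

Definition form (i : I) (x : C * C) : C := c i + a i * x.1 + b i * x.2.
Definition cross (i j : I) : C := a i * b j - a j * b i.

Hypothesis form_neq0 : forall i, (a i != 0) || (b i != 0).
Hypothesis cross_neq0 : forall i j, i != j -> cross i j != 0.
Hypothesis sorted_r : forall i, sorted <%R (r i).
Hypothesis no_triple : forall i j l x, i != j -> i != l -> j != l ->
  ~ punctured (r i) (form i x) -> ~ punctured (r j) (form j x) ->
  punctured (r l) (form l x).

Definition parallels_compl (s : seq I) : set (C * C) :=
  [set x | forall i, i \in s -> punctured (r i) (form i x)].
Local Notation X := parallels_compl.

Lemma cont_form i : continuous (form i).
Proof. by rewrite /form; contc. Qed.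

(** On the complex line through [x] and [y], each family either has constant form, hence is never
    met, or excludes finitely many parameters; the rest of the parameter plane is connected. *)
Lemma parallels_path_connected s : path_connected R (X s).
Proof.
move=> x y Xx Xy.
pose F : seq C := [seq (al - form i x) / (form i y - form i x) |
  i <- [seq i <- s | form i y != form i x], al <- punctures (r i)].
have inF i z : i \in s -> form i y != form i x -> ~ punctured (r i) z ->
    (z - form i x) / (form i y - form i x) \in F.
  move=> si yx /negP; rewrite negbK => zr; apply/allpairsPdep.
  by exists i, z; split; rewrite // mem_filter yx.
have memF z : z \in F -> exists i, [/\ i \in s, form i y != form i x &
    ~ punctured (r i) (form i x + z * (form i y - form i x))].
  move/allpairsPdep => [i [al [iF alr ->]]]; move: iF.
  rewrite mem_filter => /andP[yx si].
  exists i; split=> //; rewrite divfK ?subr_eq0// addrC subrK.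
  by rewrite /punctured/= alr.
have F0 : 0 \notin F.
  apply/negP => /memF[i [si _]]; rewrite mul0r addr0; apply; exact: Xx.
have F1 : 1 \notin F.
  by apply/negP => /memF[i [si _]]; rewrite mul1r addrC subrK; apply; exact: Xy.
have [|z [hz z0 z1]] := @plane_avoid R F setT 0 1 openT _ Logic.I Logic.I F0 F1.
  by [].
pose p t : C * C := (x.1 + z t * (y.1 - x.1), x.2 + z t * (y.2 - x.2)).
have formp i t : form i (p t) = form i x + z t * (form i y - form i x).
  by rewrite /form /p /=; ring.
exists p; split.
- split=> [|t].
    have cz := hz.1; rewrite /p; contc.
  move=> i si; apply: contrapT => bad; have [_ ztF] := hz.2 t.
  have [yx|yx] := eqVneq (form i y) (form i x).
    by apply: bad; rewrite formp yx subrr mulr0 addr0; exact: Xx.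
  have := inF _ _ si yx bad; rewrite formp addrAC subrr add0r mulfK ?subr_eq0//.
  by apply/negP.
- by rewrite /p z0 !mul0r !addr0 -surjective_pairing.
- by rewrite /p z1 !mul1r (addrC x.1) (addrC x.2) !subrK -surjective_pairing.
Qed.

Section one_family.
Variables (i : I) (s : seq I).
Hypothesis si : i \notin s.

(** [m * x.1 + n * x.2] is the coordinate function that completes [form i] to affine coordinates,
    [D] being the determinant. *)
Let m : C := if a i != 0 then 0 else 1.
Let n : C := if a i != 0 then 1 else 0.
Let D : C := a i * n - b i * m.

Lemma complement_neq0 : D != 0.
Proof.
rewrite /D /n /m; have := form_neq0 i; case: (a i != 0) / boolP => [ai _|_ /= bi].
  by rewrite mulr1 mulr0 subr0.
by rewrite mulr0 mulr1 sub0r oppr_eq0.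
Qed.
Let D0 := complement_neq0.

(* Coordinates [(u, v)] with [u = form i]. *)
Definition straighten (x : C * C) : C * C := (form i x, m * x.1 + n * x.2).
Definition unstraighten (y : C * C) : C * C :=
  (((y.1 - c i) * n - b i * y.2) / D, (a i * y.2 - m * (y.1 - c i)) / D).

Lemma straightenK : cancel straighten unstraighten.
Proof.
move=> [x1 x2]; rewrite /unstraighten /straighten /form /=; congr pair.
  rewrite (_ : _ - _ = x1 * D); first by rewrite mulfK.
  by rewrite /D; ring.
rewrite (_ : _ - _ = x2 * D); first by rewrite mulfK.
by rewrite /D; ring.
Qed.

Lemma cont_straighten : continuous straighten.
Proof. by rewrite /straighten /form; contc. Qed.

Lemma cont_unstraighten : continuous unstraighten.
Proof. by rewrite /unstraighten; contc. Qed.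

Lemma form_unstraighten j y : form j (unstraighten y) =
  c j + ((a j * n - b j * m) * (y.1 - c i) + cross i j * y.2) / D.
Proof. by rewrite /form /unstraighten /cross /=; field; exact: D0. Qed.

Lemma form_unstraighten_self y : form i (unstraighten y) = y.1.
Proof.
by rewrite form_unstraighten /cross subrr mul0r addr0 -/D mulrAC divff// mul1r addrC subrK.
Qed.

Definition other_line := {x : {j : I & 'I_(size (r j))} | tag x \in s}.

Definition level (l : other_line) : C :=
  (nth 0 (r (tag (val l))) (tagged (val l)))%:C.
(** Slope and intercept result from solving [form j = level] in [form_unstraighten] for the second
    coordinate, which [cross_neq0] allows. *)
Definition slope (l : other_line) : C :=
  let j := tag (val l) in - (a j * n - b j * m) / cross i j.
Definition intercept (l : other_line) : C :=
  let j := tag (val l) in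
  ((level l - c j) * D + (a j * n - b j * m) * c i) / cross i j.
Definition graph_of (l : other_line) (u : C) : C := intercept l + slope l * u.

Lemma other_line_neq (l : other_line) : i != tag (val l).
Proof. by apply: contraNneq si => ->; exact: valP l. Qed.

Lemma level_puncture (l : other_line) : level l \in punctures (r (tag (val l))).
Proof. by apply/mapP; exists (nth 0 (r (tag (val l))) (tagged (val l))); rewrite // mem_nth. Qed.

Lemma graph_ofE (l : other_line) u v : form (tag (val l)) (unstraighten (u, v)) - level l =
  (cross i (tag (val l)) / D) * (v - graph_of l u).
Proof.
have X0 := cross_neq0 (other_line_neq l).
by rewrite form_unstraighten /graph_of /slope /intercept /=; field; rewrite D0 X0.
Qed.

Lemma graph_of_level (l : other_line) u v :
  form (tag (val l)) (unstraighten (u, v)) = level l <-> v = graph_of l u.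
Proof.
have X0 := cross_neq0 (other_line_neq l).
split=> [E|->].
  have := graph_ofE l u v; rewrite E subrr => /esym/eqP.
  by rewrite !mulf_eq0 invr_eq0 (negbTE X0) (negbTE D0) /= subr_eq0 => /eqP.
by apply/eqP; rewrite -subr_eq0 graph_ofE subrr mulr0.
Qed.

Lemma cont_graph_of l : continuous (graph_of l).
Proof. by rewrite /graph_of; contc. Qed.

Lemma slope_inj (l l' : other_line) : slope l = slope l' -> tag (val l) = tag (val l').
Proof.
have [X0 X0'] := (cross_neq0 (other_line_neq l), cross_neq0 (other_line_neq l')).
rewrite /slope; set j := tag (val l) in X0 *; set j' := tag (val l') in X0' * => /eqP.
rewrite eqr_div// -subr_eq0 => E; apply: contraTeq isT => /cross_neq0 jj'.
(* This product is the difference of the two sides of the cross-multiplied equality of slopes. *)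
suff : - D * cross j j' = 0.
  by move=> /eqP; rewrite mulf_eq0 oppr_eq0 (negbTE D0) (negbTE jj').
by move/eqP: E => <-; rewrite /D /cross; ring.
Qed.

Lemma line_inj (l l' : other_line) u : tag (val l) = tag (val l') ->
  graph_of l u = graph_of l' u -> l = l'.
Proof.
move=> jj' /(graph_of_level l' u _) E'.
have E := (graph_of_level l u (graph_of l u)).2 erefl.
have {E E'} : level l = level l' by rewrite -E jj'.
case: l l' jj' => [[j k] jk] [[j' k'] jk'] /= jj'; subst j'.
rewrite /level /= => /(congr1 (@complex.Re R)) /= /eqP.
rewrite nth_uniq//; last exact: lt_sorted_uniq (sorted_r j).
by move=> /eqP/val_inj kk'; subst k'; exact: val_inj.
Qed.

(** The set [K] of this fibration. Distinct lines of equal slope belong to one family and never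
    meet, so only pairs of distinct slopes contribute. *)
Definition crossings : seq C :=
  [seq (intercept ll.2 - intercept ll.1) / (slope ll.1 - slope ll.2) |
     ll in [pred ll : other_line * other_line | slope ll.1 != slope ll.2]].

Lemma crossings_graph u (l l' : other_line) : u \notin crossings ->
  graph_of l u = graph_of l' u -> l = l'.
Proof.
move=> uK E; have [sl|sl] := eqVneq (slope l) (slope l').
  exact: line_inj (slope_inj sl) E.
case/negP: uK; rewrite /crossings; apply/fintype.imageP; exists (l, l') => //=.
apply: (@mulIf _ (slope l - slope l')); first by rewrite subr_eq0.
rewrite divfK ?subr_eq0//; move: E; rewrite /graph_of => /eqP.
rewrite -subr_eq0 => /eqP E; apply/eqP; rewrite -subr_eq0; apply/eqP.
by rewrite -[RHS]E; ring.
Qed.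

(** Two graphs of distinct slopes meeting over the puncture [al] would form, with the line
    [form i = al], a triple point of three families. *)
Lemma puncture_crossings al : al \in r i -> al%:C \notin crossings.
Proof.
move=> ar; apply/negP; rewrite /crossings => /fintype.imageP[[l l'] /= sl E].
have sl0 : slope l - slope l' != 0 by rewrite subr_eq0.
have G : graph_of l al%:C = graph_of l' al%:C.
  rewrite /graph_of E; apply/eqP; rewrite -subr_eq0.
  rewrite (_ : _ - _ = (intercept l - intercept l') +
    (intercept l' - intercept l) / (slope l - slope l') * (slope l - slope l')); last by ring.
  by apply/eqP; rewrite divfK//; ring.
have jj : tag (val l) != tag (val l').
  apply: contra_neq sl => jj; rewrite /slope jj//.
have P1 := (graph_of_level l al%:C _).2 erefl.
have P2 := (graph_of_level l' al%:C _).2 G.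
have bad (lx : other_line) x : form (tag (val lx)) x = level lx ->
    ~ punctured (r (tag (val lx))) (form (tag (val lx)) x).
  by move=> ->; rewrite /punctured/= level_puncture.
have := no_triple jj _ _ (bad _ _ P1) (bad _ _ P2) (l := i).
rewrite form_unstraighten_self /= => H; move: H.
move=> /(_ _ _)/negP; apply; rewrite ?[_ == i]eq_sym ?other_line_neq//.
by apply/mapP; exists al.
Qed.

Lemma graphs_straighten x : graphs_compl graph_of (straighten x) <-> X s x.
Proof.
have E : unstraighten ((straighten x).1, (straighten x).2) = x.
  by rewrite -surjective_pairing straightenK.
split=> [Gx j js|Xx l vg].
  apply/negP => /mapP[al alr fal].
  have idx : (index al (r j) < size (r j))%N by rewrite index_mem.
  pose l : other_line := exist _ (Tagged (fun j => 'I_(size (r j))) (Ordinal idx)) js.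
  apply: (Gx l); apply/graph_of_level; rewrite E.
  by rewrite /level /= nth_index.
have := Xx _ (valP l); rewrite /punctured/= => /negP; apply.
have := (graph_of_level l _ _).2 vg; rewrite E => ->; exact: level_puncture.
Qed.

Lemma lines_straighten x : lines_compl graph_of (r i) (straighten x) <-> X (i :: s) x.
Proof.
split=> [[/graphs_straighten Xx Bx] j|Xx].
  by rewrite inE => /orP[/eqP->|]; [|exact: Xx].
split; first by apply/graphs_straighten => j js; apply: Xx; rewrite inE js orbT.
by apply: Xx; rewrite inE eqxx.
Qed.

Lemma unstraightenK : cancel unstraighten straighten.
Proof.
move=> y; rewrite /straighten form_unstraighten_self; case: y => u v /=; congr pair.
by rewrite /D; field; exact: D0.
Qed.

Lemma graphs_unstraighten y : graphs_compl graph_of y <-> X s (unstraighten y).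
Proof. by rewrite -{1}[y]unstraightenK; exact: graphs_straighten. Qed.

Lemma lines_unstraighten y : lines_compl graph_of (r i) y <-> X (i :: s) (unstraighten y).
Proof. by rewrite -{1}[y]unstraightenK; exact: lines_straighten. Qed.

Lemma family_trivial (p : R -> C * C) x : joins (X (i :: s)) p x x ->
  homotopic (punctured (r i)) (form i \o p) (fun=> form i x) ->
  homotopic (X s) p (fun=> x) -> homotopic (X (i :: s)) p (fun=> x).
Proof.
move=> [hp p0 p1] pi ps.
have pc : path_connected R (lines_compl graph_of (r i)).
  move=> y z /lines_unstraighten Xy /lines_unstraighten Xz.
  have [q [hq q0 q1]] := parallels_path_connected Xy Xz.
  exists (straighten \o q); split; rewrite /= ?q0 ?q1 ?unstraightenK//.
  by apply: is_path_map cont_straighten _ hq => w /lines_straighten.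
have hs : joins (lines_compl graph_of (r i)) (straighten \o p) (straighten x) (straighten x).
  split; rewrite /= ?p0 ?p1//.
  by apply: is_path_map cont_straighten _ hp => w /lines_straighten.
have H := fibered_trivial cont_graph_of crossings_graph (sorted_r i) puncture_crossings
  pc hs pi.
have {H} : homotopic (lines_compl graph_of (r i)) (straighten \o p) (fun=> straighten x).
  apply: H; apply: (homotopic_comp cont_straighten) ps => w.
  by move/graphs_straighten.
move=> /(homotopic_comp cont_unstraighten (V := X (i :: s))) H.
have {H} := H (fun w => (lines_unstraighten w).1).
by apply: homotopic_ext => t _ /=; rewrite straightenK.
Qed.

(** [S] is defined over the whole plane, punctures of [r i] included, which makes the other
    components of a lifted loop contractible. *)
Lemma family_section : exists S : C -> C * C, [/\ continuous S,
  forall u, form i (S u) = u & forall u, X s (S u)].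
Proof.
have cgr := cont_graph_of.
exists (unstraighten \o sect graph_of); split.
- exact: (cont_comp (cont_sect cgr) cont_unstraighten).
- by move=> u; rewrite /= form_unstraighten_self.
- by move=> u; apply/graphs_unstraighten; exact: roof_fiber.
Qed.

End one_family.

Theorem arrangement_trivial s (p : R -> C * C) x : uniq s -> joins (X s) p x x ->
  (forall i, i \in s -> homotopic (punctured (r i)) (form i \o p) (fun=> form i x)) ->
  homotopic (X s) p (fun=> x).
Proof.
elim: s => [_|i s IH /= /andP[si us]] hp hf.
  have [hp' p0 p1] := hp; have Xx : X [::] x by [].
  have h0 : is_path (X [::]) (fun _ : R => x) by exact: is_path_cst.
  exact: (convex_homotopic (mix2_mixing R) (U := X [::]) _ hp' h0 p0 p1).
have sub : X (i :: s) `<=` X s by move=> y Xy j js; apply: Xy; rewrite inE js orbT.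
apply: family_trivial => //; first by apply: hf; rewrite inE eqxx.
apply: IH => //; last by move=> j js; apply: hf; rewrite inE js orbT.
by have [hp' p0 p1] := hp; split=> //; exact: is_path_sub sub hp'.
Qed.

Lemma arrangement_lift i s x bb : uniq s -> i \in s -> X s x ->
  joins (punctured (r i)) bb (form i x) (form i x) ->
  exists2 p : R -> C * C, joins (X s) p x x & forall (G : I -> groupType)
    (W : forall j, (R -> C) -> G j), (forall j, weight (punctured (r j)) (W j)) ->
    forall j, j \in s -> W j (form j \o p) = if j == i then W j bb else 1%g.
Proof.
move=> us si Xx hbb.
have iNs : i \notin rem i s by rewrite mem_rem_uniqF.
have [S [cS fS XS]] := family_section iNs.
have sE j : (j \in s) = (j == i) || (j \in rem i s).
  by rewrite (perm_mem (perm_to_rem si)) inE.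
have XSs u : punctured (r i) u -> X s (S u).
  move=> Bu j; rewrite sE => /orP[/eqP->|]; first by rewrite fS.
  exact: XS.
set u1 := form i x in hbb.
have Bu1 : punctured (r i) u1 by exact: Xx.
have [be hbe] := parallels_path_connected Xx (XSs _ Bu1).
have fX j : j \in s -> forall y, X s y -> punctured (r j) (form j y).
  by move=> js y; exact.
pose ep := form i \o be.
have hep : joins (punctured (r i)) ep u1 u1.
  have [h b0 b1] := hbe; split; rewrite /ep /= ?b0 ?b1 ?fS//.
  exact: is_path_map (@cont_form i) (fX _ si) h.
(* The path [be] from [x] to the section projects to a loop [ep]. Conjugating [bb] by [ep]
   beforehand compensates for the conjugation by [be] in the final loop. *)
pose b' := pcat (pcat (preverse ep) bb) ep.
have hb' : joins (punctured (r i)) b' u1 u1.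
  exact: joins_pcat (joins_pcat (joins_rev hep) hbb) hep.
have hS : joins (X s) (S \o b') (S u1) (S u1).
  have [h b0 b1] := hb'; split; rewrite /= ?b0 ?b1//.
  exact: is_path_map cS XSs h.
have hp := joins_pcat (joins_pcat hbe hS) (joins_rev hbe).
exists (pcat (pcat be (S \o b')) (preverse be)) => // G W wW j js.
have [[hbe' be0 be1] [hS' S0 S1]] := (hbe, hS).
have map_pcat (q q' : R -> C * C) : form j \o (pcat q q') = pcat (form j \o q) (form j \o q').
  by apply/funext => t; rewrite /= /pcat; case: ifP.
have fP (q : R -> C * C) : is_path (X s) q -> is_path (punctured (r j)) (form j \o q).
  by move=> hq; exact: is_path_map (@cont_form j) (fX _ js) hq.
have [h1 h2] := (fP _ hbe', fP _ hS').
have h3 : is_path (punctured (r j)) (preverse (form j \o be)) by exact: is_path_preverse.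
have j12 : (form j \o be) 1 = (form j \o (S \o b')) 0.
  by rewrite /= be1 -[S (b' 0)]/((S \o b') 0) S0.
have j23 : pcat (form j \o be) (form j \o (S \o b')) 1 = preverse (form j \o be) 0.
  by rewrite pcat1 /= preverse0 /= be1 -[S (b' 1)]/((S \o b') 1) S1.
rewrite !map_pcat -[form j \o preverse be]/(preverse (form j \o be)).
rewrite ((wW j).2 _ _ (is_path_pcat h1 h2 j12) h3 j23) ((wW j).2 _ _ h1 h2 j12).
rewrite (weight_preverse (wW j) h1).
case: eqVneq => [ji|ji].
  subst j; have -> : form i \o (S \o b') = b' by apply/funext => t; rewrite /= fS.
  have [hr r0 r1] := joins_rev hep; have [hb b0 b1] := hbb; have [he e0 e1] := hep.
  have [hrb rb0 rb1] := joins_pcat (joins_rev hep) hbb.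
  rewrite ((wW i).2 _ _ hrb he (etrans rb1 (esym e0))).
  rewrite ((wW i).2 _ _ hr hb (etrans r1 (esym b0))).
  by rewrite (weight_preverse (wW i) he) -/ep !mulgA mulgV mul1g mulgK.
have jr : j \in rem i s by move: js; rewrite sE (negbTE ji).
(* [form j \o S] avoids the punctures of [r j] on the whole plane, so [b'] may be contracted there,
   across the punctures of [r i]. *)
have -> : W j (form j \o (S \o b')) = 1%g.
  have Bj u : punctured (r j) (form j (S u)) by exact: XS.
  rewrite -(weight_cst (wW j) (Bj u1)); apply: (wW j).1 => //.
    exact: is_path_cst.
  have [[cb' _] b0 b1] := hb'.
  have : homotopic setT b' (fun=> u1).
    have hc : is_path setT b' by split.
    have h0 : is_path setT (fun _ : R => u1) by exact: is_path_cst.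
    exact: (convex_homotopic (mixC_mixing R) (U := setT) _ hc h0 b0 b1).
  apply: (homotopic_comp (f := fun u => form j (S u))) => [|u _]; last exact: Bj.
  exact: (cont_comp cS (@cont_form j)).
by rewrite mulg1 mulgV.
Qed.

Theorem arrangement_onto s x (bb : I -> R -> C) : uniq s -> X s x ->
  (forall i, joins (punctured (r i)) (bb i) (form i x) (form i x)) ->
  exists2 p : R -> C * C, joins (X s) p x x & forall (G : I -> groupType)
    (W : forall j, (R -> C) -> G j), (forall j, weight (punctured (r j)) (W j)) ->
    forall j, j \in s -> W j (form j \o p) = W j (bb j).
Proof.
move=> us Xx hbb.
suff H l : uniq l -> {subset l <= s} -> exists2 p : R -> C * C, joins (X s) p x x &
    forall (G : I -> groupType) (W : forall j, (R -> C) -> G j),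
    (forall j, weight (punctured (r j)) (W j)) -> forall j, j \in s ->
    W j (form j \o p) = if j \in l then W j (bb j) else 1%g.
  have [p hp Hp] := H s us (fun=> id); exists p => // G W wW j js.
  by rewrite Hp// js.
elim: l => [_ _|i l IH /= /andP[il ul] ls].
  exists (fun=> x); first by split=> //; exact: is_path_cst.
  by move=> G W wW j js; apply: (weight_cst (wW j)); exact: Xx.
have [p hp Hp] := IH ul (fun j jl => ls j (@mem_behead _ (i :: l) j jl)).
have is_ : i \in s by apply: ls; rewrite inE eqxx.
have [q hq Hq] := arrangement_lift us is_ Xx (hbb i).
exists (pcat q p); first exact: joins_pcat hp.
move=> G W wW j js; have [[hp' p0 p1] [hq' q0 q1]] := (hp, hq).
have -> : form j \o pcat q p = pcat (form j \o q) (form j \o p).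
  by apply/funext => t; rewrite /= /pcat; case: ifP.
have fP (w : R -> C * C) : is_path (X s) w -> is_path (punctured (r j)) (form j \o w).
  by move=> hw; apply: is_path_map (@cont_form j) _ hw => y; exact.
have jqp : (form j \o q) 1 = (form j \o p) 0 by rewrite /= q1 p0.
rewrite ((wW j).2 _ _ (fP _ hq') (fP _ hp') jqp).
rewrite (Hq G W wW j js) (Hp G W wW j js) inE.
by case: eqVneq => [->|_] /=; rewrite ?(negbTE il) ?mulg1 ?mul1g.
Qed.

End affine_arrangement.

(** * Affine charts of the projective plane *)

Section affine_chart.
Local Open Scope complex_scope.
Local Open Scope quotient_scope.
Variables (R : realType) (Q : 'M[R[i]]_3).
Hypothesis uQ : Q \in unitmx.
Local Notation C := R[i].

Definition homog (p : CP2 R) : 'rV[C]_3 := coordinates p *m Q.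

(* [affine_line 1 0 0] is the line at infinity of the chart below. *)
Definition affine_line (c a b : C) : set (CP2 R) :=
  [set p | c * homog p 0 0 + a * homog p 0 1 + b * homog p 0 2%:R = 0].

Lemma sum3 (V : nmodType) (F : 'I_3 -> V) : \sum_(i < 3) F i = F 0 + F 1 + F 2%:R.
Proof.
rewrite !big_ord_recr big_ord0 /= add0r.
by congr (F _ + F _ + F _); exact: val_inj.
Qed.

Lemma row3_eq (T : Type) (u v : 'rV[T]_3) : u 0 0 = v 0 0 -> u 0 1 = v 0 1 ->
  u 0 2%:R = v 0 2%:R -> u = v.
Proof.
move=> e0 e1 e2; apply/rowP; case=> [[|[|[|//]]] lt].
- by rewrite (_ : Ordinal lt = 0)//; exact: val_inj.
- by rewrite (_ : Ordinal lt = 1)//; exact: val_inj.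
- by rewrite (_ : Ordinal lt = 2%:R)//; exact: val_inj.
Qed.

Lemma coordinates_neq0 (p : CP2 R) : coordinates p != 0.
Proof. exact: set_valP (repr p : homogeneous R). Qed.

Lemma coordinates_pi (v : homogeneous R) :
  exists2 s : C, s != 0 & coordinates (\pi v : CP2 R) = s *: val v.
Proof.
have /eqmodP/asboolP[s s0 E] : repr (\pi v : CP2 R) = v %[mod_eq (proportional_equiv R)].
  exact: (@reprK _ (CP2 R)).
by exists s.
Qed.

Lemma homog_neq0 p : homog p != 0.
Proof.
apply: contra_neq (coordinates_neq0 p) => E.
by rewrite -[coordinates p](mulmxK uQ) -/(homog p) E mul0mx.
Qed.

Lemma homog_inj p q (s : C) : s != 0 -> homog p = s *: homog q -> p = q.
Proof.
move=> s0 E; rewrite -[p](@reprK _ (CP2 R)) -[q](@reprK _ (CP2 R)).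
apply/eqmodP/asboolP; exists s => //; change (coordinates p = s *: coordinates q).
by rewrite -[coordinates p](mulmxK uQ) -/(homog p) E -scalemxAl mulmxK.
Qed.

Lemma line_of_affine (u : 'rV[C]_3) : let h := invmx Q *m u^T in
  line_of u = affine_line (h 0 0) (h 1 0) (h 2%:R 0).
Proof.
move=> h; have E p : \sum_(i < 3) u 0 i * coordinates p 0 i =
    h 0 0 * homog p 0 0 + h 1 0 * homog p 0 1 + h 2%:R 0 * homog p 0 2%:R.
  transitivity ((homog p *m h) 0 0).
    rewrite /homog /h mulmxA mulmxK// mxE; apply: eq_bigr => i _.
    by rewrite mxE mulrC.
  by rewrite mxE sum3 ![homog p _ _ * _]mulrC.
by apply/seteqP; split=> p; rewrite /line_of /affine_line /= E.
Qed.

Lemma col3_neq0 (V : nmodType) (h : 'cV[V]_3) : h != 0 ->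
  [|| h 0 0 != 0, h 1 0 != 0 | h 2%:R 0 != 0].
Proof.
apply: contraTT; rewrite !negb_or !negbK => /and3P[/eqP h0 /eqP h1 /eqP h2].
apply/eqP/trmx_inj; rewrite trmx0.
by apply: row3_eq; rewrite [LHS]mxE [RHS]mxE.
Qed.

Lemma unit_mul_neq0 (K : fieldType) (M : 'M[K]_3) (u : 'rV[K]_3) : M \in unitmx ->
  u != 0 -> invmx M *m u^T != 0.
Proof.
move=> uM; apply: contra_neq => E.
by rewrite -[u]trmxK -[u^T](mulKVmx uM) E mulmx0 trmx0.
Qed.

Lemma projective_line_affine l : projective_line l ->
  exists c a b, [|| c != 0, a != 0 | b != 0] /\ l = affine_line c a b.
Proof.
move=> [u u0 ->]; rewrite line_of_affine; set h := invmx Q *m u^T.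
exists (h 0 0), (h 1 0), (h 2%:R 0); split=> //.
exact: col3_neq0 (unit_mul_neq0 uQ u0).
Qed.

Lemma affine_line_scale s c a b : s != 0 ->
  affine_line (s * c) (s * a) (s * b) = affine_line c a b.
Proof.
move=> s0; rewrite /affine_line; apply/seteqP; split=> p /=;
  rewrite -!mulrA -!mulrDr; first by move=> /eqP; rewrite mulf_eq0 (negbTE s0) => /eqP.
by move=> ->; rewrite mulr0.
Qed.

(* A point at infinity is determined by the direction [(a, b)] of a line
   through it. *)
Lemma infinite_point p q a b : (a != 0) || (b != 0) ->
  homog p 0 0 = 0 -> homog q 0 0 = 0 ->
  a * homog p 0 1 + b * homog p 0 2%:R = 0 ->
  a * homog q 0 1 + b * homog q 0 2%:R = 0 -> p = q.
Proof.
move=> ab0.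
have normal x : homog x 0 0 = 0 -> a * homog x 0 1 + b * homog x 0 2%:R = 0 ->
    exists s, [/\ s != 0, homog x 0 1 = s * - b & homog x 0 2%:R = s * a].
  move=> x0 xab.
  have [s s1 s2] : exists2 s, homog x 0 1 = s * - b & homog x 0 2%:R = s * a.
    case: (eqVneq a 0) ab0 xab => [-> /= b0|a0 _ /eqP].
      rewrite mul0r add0r => /eqP; rewrite mulf_eq0 (negbTE b0) /= => /eqP ->.
      by exists (- homog x 0 1 / b); rewrite ?mulr0//; field.
    rewrite addr_eq0 => /eqP E; exists (homog x 0 2%:R / a); last by field.
    by apply: (mulfI a0); rewrite E; field.
  exists s; split=> //; apply: contra_neq (homog_neq0 x) => sz.
  by apply: row3_eq; rewrite ?x0 ?s1 ?s2 ?sz ?mul0r mxE.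
move=> p0 q0 /(normal _ p0)[s [s0 s1 s2]] /(normal _ q0)[t [t0 t1 t2]].
apply: (@homog_inj _ _ (s / t)); first by rewrite mulf_neq0 ?invr_eq0.
by apply: row3_eq; rewrite [RHS]mxE ?p0 ?q0 ?s1 ?s2 ?t1 ?t2 ?mulr0//; field.
Qed.

Definition affine_coord (p : CP2 R) : C * C :=
  (homog p 0 1 / homog p 0 0, homog p 0 2%:R / homog p 0 0).

Definition affine_vec (y : C * C) : 'rV[C]_3 :=
  (\row_(i < 3) (if i == 0 then 1 else if i == 1 then y.1 else y.2)) *m invmx Q.

Lemma affine_vecE y : affine_vec y *m Q =
  \row_(i < 3) (if i == 0 then 1 else if i == 1 then y.1 else y.2).
Proof. by rewrite /affine_vec mulmxKV. Qed.

Lemma affine_vec_neq0 y : affine_vec y \in [set v : 'rV[C]_3 | v != 0].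
Proof.
rewrite inE /=; apply: contraTneq isT => E.
have := congr1 (fun v : 'rV[C]_3 => v 0 0) (affine_vecE y).
by rewrite E mul0mx !mxE /= => /esym/eqP; rewrite oner_eq0.
Qed.

Definition affine_rep (y : C * C) : homogeneous R :=
  exist (fun v => v \in [set v : 'rV[C]_3 | v != 0]) (affine_vec y) (affine_vec_neq0 y).

Definition affine_point (y : C * C) : CP2 R := \pi_(CP2 R) (affine_rep y).

Lemma homog_affine_point y : exists2 s : C, s != 0 &
  [/\ homog (affine_point y) 0 0 = s, homog (affine_point y) 0 1 = s * y.1 &
      homog (affine_point y) 0 2%:R = s * y.2].
Proof.
have [s s0 E] := coordinates_pi (affine_rep y).
exists s => //; rewrite /homog /affine_point E -scalemxAl /= affine_vecE.
by split; rewrite !mxE ?mulr1.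
Qed.

Lemma affine_point_infinity y : homog (affine_point y) 0 0 != 0.
Proof. by have [s s0 [-> _ _]] := homog_affine_point y. Qed.

Lemma affine_pointK : cancel affine_point affine_coord.
Proof.
move=> [y1 y2]; rewrite /affine_coord; have [s s0 [-> -> ->]] := homog_affine_point (y1, y2).
by rewrite ![s * _]mulrC !mulfK.
Qed.

Lemma affine_coordK p : homog p 0 0 != 0 -> affine_point (affine_coord p) = p.
Proof.
move=> p0; have [s s0 [e0 e1 e2]] := homog_affine_point (affine_coord p).
apply: (@homog_inj _ _ (s / homog p 0 0)); first by rewrite mulf_neq0 ?invr_eq0.
by apply: row3_eq; rewrite [RHS]mxE ?e0 ?e1 ?e2 /=; field.
Qed.

Lemma affine_lineE c a b p : homog p 0 0 != 0 ->
  affine_line c a b p <-> c + a * (affine_coord p).1 + b * (affine_coord p).2 = 0.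
Proof.
move=> p0; rewrite /affine_line /affine_coord /=; split=> [E|/(congr1 ( *%R^~ (homog p 0 0)))].
  by apply: (mulIf p0); rewrite mul0r -[RHS]E; field.
by rewrite mul0r => <-; field.
Qed.

Lemma continuous_mx (Z : topologicalType) (m n : nat) (f : Z -> 'M[C]_(m, n)) :
  (forall i j, continuous (fun z => f z i j)) -> continuous f.
Proof.
move=> cf z A [B Bz sB].
have : \forall w \near z, forall ij : 'I_m * 'I_n, B ij.1 ij.2 (f w ij.1 ij.2).
  by apply: filter_forall => ij; exact: cf (Bz _ _).
by apply: filterS => w Bw; apply: sB => i j; exact: (Bw (i, j)).
Qed.

Lemma cont_affine_point : continuous affine_point.
Proof.
apply: (cont_comp (f := affine_rep) (g := \pi_(CP2 R))); last exact: pi_continuous.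
apply/continuousP => _ [V oV <-]; rewrite -comp_preimage.
suff /continuousP H : continuous affine_vec by exact: H.
apply: continuous_mx => i j.
rewrite /affine_vec.
rewrite (_ : (fun z => _) = fun z : C * C => \sum_(k < 3)
  (if k == 0 then 1 else if k == 1 then z.1 else z.2) * invmx Q k j).
  apply: cont_sumC => k; case: (k == 0); first by contc.
  by case: (k == 1); contc.
by apply/funext => y /=; rewrite mxE; apply: eq_bigr => k _; rewrite mxE.
Qed.

(** Openness in the quotient is tested on nonzero vectors, where the affine coordinates are ratios
    insensitive to the chosen representative. *)
Lemma open_affine_coord (V : set (C * C)) : open V ->
  open [set p | homog p 0 0 != 0 /\ V (affine_coord p)].
Proof.
move=> oV.
pose h (u : 'rV[C]_3) j : C := (u *m Q) 0 j.
have ch j : continuous (fun u : 'rV[C]_3 => h u j).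
  rewrite (_ : (fun u => _) = fun u : 'rV[C]_3 => \sum_(k < 3) u 0 k * Q k j).
    apply: cont_sumC => k; apply: contMC; last exact: contC.
    exact: coord_continuous.
  by apply/funext => u; rewrite /h mxE.
have oW : open [set u : 'rV[C]_3 | h u 0 != 0 /\ V (h u 1 / h u 0, h u 2%:R / h u 0)].
  rewrite openE => u /= [u0 uV].
  have cV j : {for u, continuous (fun u => h u j / h u 0)}.
    have cj := ch j u; have c0 := ch 0 u.
    exact: cvgM cj (cvgV u0 c0).
  have n0 : \forall w \near u, h w 0 != 0.
    exact: (@cvgr_neq0 C C^o _ _ _ (fun w => h w 0) (h u 0) (ch 0 u) u0).
  have nV : \forall w \near u, V (h w 1 / h w 0, h w 2%:R / h w 0).
    have : nbhs (h u 1 / h u 0, h u 2%:R / h u 0) V by exact: open_nbhs_nbhs.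
    have cP : {for u, continuous (fun w => (h w 1 / h w 0, h w 2%:R / h w 0))}.
      exact: cvg_pair (cV 1) (cV 2%:R).
    by move=> /cP.
  by apply: filterS2 n0 nV.
have /continuousP cval : continuous (val : homogeneous R -> 'rV[C]_3).
  exact: initial_continuous.
change (open (\pi_(CP2 R) @^-1` [set p | homog p 0 0 != 0 /\ V (affine_coord p)])).
rewrite (_ : _ @^-1` _ = (val : homogeneous R -> 'rV[C]_3) @^-1`
  [set u : 'rV[C]_3 | h u 0 != 0 /\ V (h u 1 / h u 0, h u 2%:R / h u 0)]); first exact: cval.
have E v : exists2 s : C, s != 0 & forall j, homog (\pi_(CP2 R) v) 0 j = s * h (val v) j.
  have [s s0 E] := coordinates_pi v; exists s => // j.
  by rewrite /homog E -scalemxAl mxE.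
apply/seteqP; split=> v /=; have [s s0 Es] := E v; rewrite /affine_coord !Es mulf_eq0
  (negbTE s0) /= => -[h0 Vh]; split=> //; move: Vh; congr (V (_, _)); by field; rewrite ?h0.
Qed.

Lemma affine_chart (Y : set (CP2 R)) (O : set (C * C)) (x0 : set_type Y) :
  (forall p, Y p -> homog p 0 0 != 0) ->
  (forall p, homog p 0 0 != 0 -> Y p <-> O (affine_coord p)) ->
  chart O (fun x : set_type Y => affine_coord (val x))
    (fun y => subset_inv x0 (affine_point y)).
Proof.
move=> Yfin YO; have [_ valY valK invK cinv] := subset_chart x0.
have YO' y : Y (affine_point y) <-> O y.
  by rewrite YO ?affine_pointK//; exact: affine_point_infinity.
split=> [|x|x|y Oy|Z f cf Of].
- apply/continuousP => V oV; exists [set p | homog p 0 0 != 0 /\ V (affine_coord p)].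
    exact: open_affine_coord.
  apply/seteqP; split=> x /= => [[]//|Vx]; split=> //; exact/Yfin/valY.
- by apply/YO; [exact/Yfin/valY|exact: valY].
- by rewrite affine_coordK ?valK//; exact/Yfin/valY.
- by rewrite invK ?affine_pointK// inE YO' -in_setE.
- apply: (cinv Z (affine_point \o f)) => [|z]; first exact: cont_comp cf cont_affine_point.
  by apply/YO'; exact: Of.
Qed.

End affine_chart.

(** * The group of an affine arrangement *)

Section group_isomorphisms.
Local Open Scope group_scope.

Lemma group_isomorphic_intro (G H : groupType) (f : G -> H) :
  {morph f : g h / g * h} -> injective f -> (forall h, exists g, f g = h) ->
  group_isomorphic G H.
Proof.
move=> fM fI /choice[f' fK].
pose F : {multiplicative G -> H} := HB.pack f (isMultiplicative.Build G H f fM).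
by exists F, f' => [g|h]; [apply: fI; rewrite fK|exact: fK].
Qed.

Lemma group_isomorphic_trans (G H K : groupType) :
  group_isomorphic G H -> group_isomorphic H K -> group_isomorphic G K.
Proof.
move=> [f [f' fK f'K]] [g [g' gK g'K]].
apply: (@group_isomorphic_intro _ _ (g \o f)) => [x y|x y /= E|z].
- by rewrite /= !gmulfM.
- by rewrite -[x]fK -[y]fK -(gK (f x)) -(gK (f y)) E.
- by exists (f' (g' z)); rewrite /= f'K g'K.
Qed.

Lemma dffun_option (J : finType) (F : option J -> groupType) :
  group_isomorphic {dffun forall o, F o}
    ({dffun forall j, F (Some j)} * F None)%type.
Proof.
pose f (g : {dffun forall o, F o}) : {dffun forall j, F (Some j)} * F None :=
  ([ffun j => g (Some j)], g None).
apply: (@group_isomorphic_intro _ _ f) => [g h|g h [E EN]|[h hN]].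
- rewrite /f; congr pair; last by rewrite ffunE.
  by apply/ffunP => j; rewrite !ffunE.
- apply/ffunP => -[j|//].
  by have := congr1 (fun u : {dffun forall j, F (Some j)} => u j) E; rewrite /= !ffunE.
- exists [ffun o => if o is Some j as o return F o then h j else hN].
  by rewrite /f ffunE; congr pair; apply/ffunP => j; rewrite !ffunE.
Qed.

End group_isomorphisms.

Section arrangement_group.
Local Open Scope group_scope.
Variables (R : realType) (I : finType) (c a b : I -> R[i]) (r : I -> seq R).
Hypothesis form_neq0 : forall i, (a i != 0%R) || (b i != 0%R).
Hypothesis cross_neq0 : forall i j, i != j -> cross a b i j != 0%R.
Hypothesis sorted_r : forall i, sorted <%R (r i).
Hypothesis no_triple : forall i j l x, i != j -> i != l -> j != l ->
  ~ punctured (r i) (form c a b i x) -> ~ punctured (r j) (form c a b j x) ->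
  punctured (r l) (form c a b l x).
Variables (k : I -> nat) (F : I -> groupType) (gen : forall i, 'I_(k i) -> F i).
Hypothesis size_r : forall i, size (r i) = k i.
Hypothesis free_gen : forall i, free_on (@gen i).
Local Notation O := (parallels_compl c a b r (enum I)).

Theorem arrangement_group (X : topologicalType) (e : X -> R[i] * R[i])
    (d : R[i] * R[i] -> X) (x0 : X) : chart O e d ->
  group_isomorphic (fundamental_group R x0) {dffun forall i, F i}.
Proof.
move=> ch; have pc : path_connected R O by exact: parallels_path_connected.
have [W [wW sW oW]] := chart_class_weight x0 ch pc.
set y0 := e x0 in oW; have Oy0 : O y0 by have [_ + _ _ _] := ch; exact.
pose wi i := winding (r i) (shift_gen (@gen i)).
have wwi i : weight (punctured (r i)) (wi i) by exact: winding_weight.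
have /choice[l hl] := oW.
have formP i (p : R -> R[i] * R[i]) : is_path O p -> is_path (punctured (r i)) (form c a b i \o p).
  move=> hp; apply: (is_path_map (@cont_form _ _ c a b i) _ hp) => y; apply.
  by rewrite mem_enum.
have wi_W i p q : joins O p y0 y0 -> joins O q y0 y0 -> W p = W q ->
    wi i (form c a b i \o p) = wi i (form c a b i \o q).
  move=> [hp p0 p1] [hq q0 q1] Wpq; apply: (wwi i).1; [exact: formP|exact: formP|].
  apply: (homotopic_comp (@cont_form _ _ c a b i)) (sW _ _ hp hq _ _ Wpq); rewrite ?p0 ?p1//.
  by move=> y; apply; rewrite mem_enum.
have lj g : joins O (l g) y0 y0 by have [h0 h1 h2 _] := hl g; split.
have Wl g : W (l g) = g by have [] := hl g.
(* By [wi_W] the windings depend on the class [g] only, not on the chosen loop [l g]. *)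
pose f (g : fundamental_group R x0) : {dffun forall i, F i} :=
  [ffun i => wi i (form c a b i \o l g)].
have fM : {morph f : g h / g * h}.
  move=> g h; apply/ffunP => i; rewrite !ffunE.
  have [[hg g0 g1] [hh h0 h1]] := (lj g, lj h).
  have gh : l g 1%R = l h 0%R by rewrite g1 h0.
  rewrite (@wi_W i _ (pcat (l g) (l h))); [|exact: lj|exact: joins_pcat (lj g) (lj h)|].
    have -> : form c a b i \o pcat (l g) (l h) =
        pcat (form c a b i \o l g) (form c a b i \o l h).
      by apply/funext => t; rewrite /= /pcat; case: ifP.
    apply: (wwi i).2; [exact: formP|exact: formP|by rewrite /= gh].
  by rewrite (wW.2 _ _ hg hh gh) !Wl.
have f1 g : f g = 1 -> g = 1.
  move=> fg; have [hg g0 g1] := lj g.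
  have triv : homotopic O (l g) (fun=> y0).
    apply: (arrangement_trivial form_neq0 cross_neq0 sorted_r no_triple) => [|//|i _].
      exact: enum_uniq.
    apply: (winding_trivial (sorted_r i) (size_r i) (free_gen i)); rewrite /= ?g0 ?g1//.
      exact: formP.
    by have := congr1 (fun u : {dffun forall i, F i} => u i) fg; rewrite /= !ffunE.
  rewrite -[g]Wl -(weight_cst wW Oy0); apply: wW.1 => //; exact: is_path_cst.
apply: (@group_isomorphic_intro _ _ f) => // [g h E|u].
  apply/eqP; rewrite -divg_eq1; apply/eqP/f1.
  have := fM (g * h^-1) h; rewrite mulgVK E => fh.
  by apply: (mulIg (f h)); rewrite mul1g.
have Bi i : punctured (r i) (form c a b i y0) by apply: Oy0; rewrite mem_enum.
have /choice[bb hbb] i : exists p : R -> R[i],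
    joins (punctured (r i)) p (form c a b i y0) (form c a b i y0) /\ wi i p = u i.
  have [p [hp p0 p1 wp]] := winding_onto (sorted_r i) (size_r i) (free_gen i) (Bi i) (u i).
  by exists p; split.
have [p hp Hp] := arrangement_onto form_neq0 cross_neq0 (enum_uniq I) Oy0 (fun i => (hbb i).1).
exists (W p); apply/ffunP => i; rewrite ffunE (@wi_W i _ p)//.
by rewrite Hp ?mem_enum ?(hbb i).2.
Qed.

End arrangement_group.

(** * Arrangements with collinear multiple points *)

Section real_chart.
Local Open Scope complex_scope.
Variables (R : realType).
Local Notation RC := (map_mx (real_complex R)).

Lemma real_line_affine (Q : 'M[R]_3) (l : set (CP2 R)) : Q \in unitmx ->
  real_projective_line l -> exists c a b : R, [|| c != 0, a != 0 | b != 0] /\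
    l = affine_line (RC Q) c%:C a%:C b%:C.
Proof.
move=> uQ [u u0 ->]; rewrite (line_of_affine (Q := RC Q)) ?map_unitmx//.
rewrite -map_invmx map_trmx -map_mxM.
set h := invmx Q *m u^T; have h0 : h != 0 := unit_mul_neq0 uQ u0.
exists (h 0 0), (h 1 0), (h 2%:R 0); split; first exact: col3_neq0.
by move: h {h0} => h; rewrite !mxE.
Qed.

(** The rank decomposition of the row [u] supplies a real change of coordinates that turns [u] into
    a multiple of the first basis vector. As it is real, the other lines of the arrangement keep
    real equations. *)
Lemma line_at_infinity (l : set (CP2 R)) : real_projective_line l ->
  exists2 Q : 'M[R]_3, Q \in unitmx & l = affine_line (RC Q) 1 0 0.
Proof.
move=> [u u0 ->]; exists (row_ebase u)^T; first by rewrite unitmx_tr row_ebase_unit.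
set Q := (row_ebase u)^T; have uQ : Q \in unitmx by rewrite unitmx_tr row_ebase_unit.
rewrite (line_of_affine (Q := RC Q)) ?map_unitmx//.
rewrite -map_invmx map_trmx -map_mxM; set h := invmx Q *m u^T.
have hE : h = (col_ebase u *m pid_mx (\rank u))^T.
  by rewrite /h -[in u^T](mulmx_ebase u) trmx_mul mulKmx.
have h1 (i : 'I_3) : i != 0 -> h i 0 = 0.
  move=> i0; rewrite hE !mxE big_ord1 !mxE /= eq_sym.
  by rewrite (negbTE (i0 : (i : nat) != 0%N)) mulr0.
have := col3_neq0 (unit_mul_neq0 uQ u0); rewrite -/h (h1 1)// (h1 2%:R)// !eqxx /= !orbF => h0.
move: h h0 h1 {hE} => h h0 h1; rewrite /= !mxE (h1 1)// (h1 2%:R)//.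
have := affine_line_scale (RC Q) 1 0 0 (s := (h 0 0)%:C).
by rewrite mulr1 !mulr0 => <- //; rewrite fmorph_eq0.
Qed.

End real_chart.

Section collinear_arrangement.
Local Open Scope complex_scope.
Variables (R : realType) (A : set (set (CP2 R))) (t : nat) (P : 'I_t -> CP2 R).
Variables (k : 'I_t -> nat) (L H : set (CP2 R)) (Q0 : 'M[R]_3).
Local Notation C := R[i].
Local Notation Q := (map_mx (real_complex R) Q0).
Local Notation homog := (homog Q).
Local Notation line := (affine_line Q).
Hypotheses (uQ0 : Q0 \in unitmx) (L_infinity : L = line 1 0 0).
Hypotheses (finA : finite_set A) (realA : forall l, A l -> real_projective_line l).
Hypotheses (P_inj : injective P) (P_multiple : forall i, multiple_point A (P i)).
Hypothesis P_multiplicity : forall i, multiplicity A (P i) = (k i).+1.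
Hypotheses (AL : A L) (LP : forall i, L (P i)).
Hypothesis A_pencils : A = \bigcup_i pencil A (P i).
Hypothesis simple_crossing : forall i j l m p, i <> j ->
  pencil A (P i) l -> pencil A (P j) m -> l <> L -> m <> L ->
  l p -> m p -> simple_point A p /\ ~ L p.
Hypothesis nAH : ~ A H.
Hypothesis H_generic : forall l m p, A l -> A m -> l <> m -> l p -> m p -> ~ H p.

Lemma unit_real_matrix : Q \in unitmx. Proof. by rewrite map_unitmx. Qed.
Let uQ := unit_real_matrix.

Lemma at_infinity p : L p <-> homog p 0 0 = 0.
Proof. by rewrite L_infinity /affine_line /= mul1r !mul0r !addr0. Qed.

Lemma direction_neq0 c a b : [|| c != 0, a != 0 | b != 0] -> line c a b <> L ->
  (a != 0) || (b != 0).
Proof.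
move=> c0 lL; apply: contrapT => /negP; rewrite negb_or !negbK => /andP[/eqP a0 /eqP b0].
move: c0 lL; rewrite a0 b0 eqxx !orbF => c0; apply; rewrite L_infinity.
by have := affine_line_scale Q 1 0 0 c0; rewrite mulr1 !mulr0.
Qed.

Lemma finite_pencil p : finite_set (pencil A p).
Proof. by apply: sub_finite_set finA => l []. Qed.

Definition transversals i : {fset set (CP2 R)} := (fset_set (pencil A (P i)) `\ L)%fset.

Lemma transversalsP i l : l \in transversals i <-> [/\ A l, l (P i) & l <> L].
Proof.
rewrite /transversals in_fsetD1 in_fset_set; last exact: finite_pencil.
split=> [/andP[/eqP lL /set_mem[Al lP]]//|[Al lP /eqP lL]].
by rewrite lL; apply: mem_set.
Qed.

Lemma card_transversals i : #|` transversals i| = k i.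
Proof.
have := cardfsD1 L (fset_set (pencil A (P i))).
rewrite in_fset_set ?mem_set; [|by split; [exact: AL|exact: LP]|exact: finite_pencil].
by rewrite -[#|` fset_set _|]/(multiplicity A (P i)) P_multiplicity add1n => -[].
Qed.

Lemma transversal_exists i : exists l, l \in transversals i.
Proof.
have /fset0Pn// : transversals i != fset0.
rewrite -cardfs_gt0 card_transversals; have := P_multiple i.
by rewrite /multiple_point P_multiplicity; case: (k i).
Qed.

Lemma infinite_direction i c a b : line c a b (P i) ->
  a * homog (P i) 0 1 + b * homog (P i) 0 2%:R = 0.
Proof. by rewrite /affine_line /= ((at_infinity _).1 (LP i)) mulr0 add0r. Qed.

Lemma direction_exists i : exists ab : R * R, ((ab.1 != 0) || (ab.2 != 0)) /\
  ab.1%:C * homog (P i) 0 1 + ab.2%:C * homog (P i) 0 2%:R = 0.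
Proof.
have [l /transversalsP[Al lP lL]] := transversal_exists i.
have [c [a [b [c0 lE]]]] := real_line_affine uQ0 (realA Al).
exists (a, b); split=> /=; last by apply: (@infinite_direction i c%:C); rewrite -lE.
have := @direction_neq0 c%:C a%:C b%:C; rewrite !fmorph_eq0; apply=> //.
by rewrite -lE.
Qed.

Section directions.
Variable dir : 'I_t -> R * R.
Hypothesis dir_neq0 : forall i, ((dir i).1 != 0) || ((dir i).2 != 0).
Hypothesis dirP : forall i,
  (dir i).1%:C * homog (P i) 0 1 + (dir i).2%:C * homog (P i) 0 2%:R = 0.

Lemma dirC_neq0 i : ((dir i).1%:C != 0) || ((dir i).2%:C != 0).
Proof. by rewrite !fmorph_eq0. Qed.

(** If the determinant were nonzero, Cramer's rule would make all homogeneous coordinates of [P i]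
    vanish. Hence all transversals through [P i] share one direction up to scaling. *)
Lemma dir_determined i (a b : C) : a * homog (P i) 0 1 + b * homog (P i) 0 2%:R = 0 ->
  (dir i).1%:C * b - a * (dir i).2%:C = 0.
Proof.
move=> E; set D := _ - _; have D1 : D * homog (P i) 0 1 = 0.
  transitivity (b * ((dir i).1%:C * homog (P i) 0 1 + (dir i).2%:C * homog (P i) 0 2%:R) -
    (dir i).2%:C * (a * homog (P i) 0 1 + b * homog (P i) 0 2%:R)).
    by rewrite /D; ring.
  by rewrite E dirP !mulr0 subrr.
have D2 : D * homog (P i) 0 2%:R = 0.
  transitivity ((dir i).1%:C * (a * homog (P i) 0 1 + b * homog (P i) 0 2%:R) -
    a * ((dir i).1%:C * homog (P i) 0 1 + (dir i).2%:C * homog (P i) 0 2%:R)).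
    by rewrite /D; ring.
  by rewrite E dirP !mulr0 subrr.
apply: contrapT => /eqP D0; have /eqP := homog_neq0 uQ (P i); apply.
have zero z : D * z = 0 -> z = 0.
  by move=> /eqP; rewrite mulf_eq0 (negbTE D0) /= => /eqP.
by apply: row3_eq; rewrite [RHS]mxE; [exact/at_infinity|exact: zero|exact: zero].
Qed.

Lemma level_exists i l : exists al : R, l \in transversals i ->
  l = line (- al)%:C (dir i).1%:C (dir i).2%:C.
Proof.
case: (boolP (l \in transversals i)) => [/transversalsP[Al lP lL]|_]; last by exists 0.
have [c [a [b [c0 lE]]]] := real_line_affine uQ0 (realA Al).
have ab0 : (a != 0) || (b != 0).
  have := @direction_neq0 c%:C a%:C b%:C; rewrite !fmorph_eq0; apply=> //.
  by rewrite -lE.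
have : (dir i).1%:C * b%:C - a%:C * (dir i).2%:C = 0.
  by apply: dir_determined; apply: (@infinite_direction i c%:C); rewrite -lE.
rewrite -!rmorphM -rmorphB => /eqP; rewrite fmorph_eq0 subr_eq0 => /eqP E.
have [s [s0 sa sb]] : exists s, [/\ s != 0, a = s * (dir i).1 & b = s * (dir i).2].
  have [d0|d0] := eqVneq (dir i).1 0.
    have d2 : (dir i).2 != 0 by have := dir_neq0 i; rewrite d0 eqxx.
    have a0 : a = 0.
      by move: E; rewrite d0 mul0r => /esym/eqP; rewrite mulf_eq0 (negbTE d2) orbF => /eqP.
    exists (b / (dir i).2); rewrite d0 mulr0 divfK//; split=> //.
    by move: ab0; rewrite a0 eqxx /= => b0; rewrite mulf_neq0// invr_eq0.
  have bE : b = a / (dir i).1 * (dir i).2 by rewrite mulrAC -E mulrAC divff// mul1r.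
  exists (a / (dir i).1); rewrite divfK//; split=> //.
  rewrite mulf_neq0// ?invr_eq0//; apply: contraTneq ab0 => a0.
  by rewrite bE a0 !mul0r eqxx.
exists (- (c / s)) => _; rewrite lE opprK.
rewrite sa sb [X in line X%:C](_ : c = s * (c / s)); last by rewrite mulrC divfK.
by rewrite !rmorphM affine_line_scale// fmorph_eq0.
Qed.

Section levels.
Variable level : 'I_t -> set (CP2 R) -> R.
Hypothesis levelP : forall i l, l \in transversals i ->
  l = line (- level i l)%:C (dir i).1%:C (dir i).2%:C.
Variables h0 h1 h2 : C.
Hypotheses (h_neq0 : [|| h0 != 0, h1 != 0 | h2 != 0]) (HE : H = line h0 h1 h2).

(* The index [None] stands for [H]. *)
Definition coef_c (o : option 'I_t) : C := if o is Some i then 0 else h0.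
Definition coef_a (o : option 'I_t) : C := if o is Some i then (dir i).1%:C else h1.
Definition coef_b (o : option 'I_t) : C := if o is Some i then (dir i).2%:C else h2.
(** Real levels are required. The transversals have constant term 0 in [coef_c] and real levels,
    while the complex constant [h0] of [H] is kept in [coef_c], which leaves 0 as its only level. *)
Definition levels (o : option 'I_t) : seq R :=
  if o is Some i then sort <=%R [seq level i l | l <- transversals i] else [:: 0].

Local Notation hform := (form coef_c coef_a coef_b).

Lemma sorted_levels o : sorted <%R (levels o).
Proof.
case: o => [i|//]; rewrite /= sort_lt_sorted map_inj_in_uniq ?fset_uniq// => l m lT mT E.
by rewrite (levelP lT) (levelP mT) E.
Qed.

Lemma size_levels i : size (levels (Some i)) = k i.
Proof. by rewrite /= size_sort size_map -card_transversals. Qed.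

Lemma line_form c o p : homog p 0 0 != 0 ->
  line (coef_c o - c) (coef_a o) (coef_b o) p <-> hform o (affine_coord Q p) = c.
Proof.
move=> p0; rewrite affine_lineE// /form; split=> [E|<-]; last by ring.
by apply/eqP; rewrite -subr_eq0 -[X in _ == X]E; apply/eqP; ring.
Qed.

Lemma on_transversal i p : homog p 0 0 != 0 ->
  ~ punctured (levels (Some i)) (hform (Some i) (affine_coord Q p)) ->
  exists l, l \in transversals i /\ l p.
Proof.
move=> p0 /negP; rewrite negbK => /mapP[al]; rewrite mem_sort => /mapP[l lT ->] E.
exists l; split=> //; rewrite (levelP lT) rmorphN -sub0r.
exact/(line_form (level i l)%:C (Some i) p0).
Qed.

Lemma off_transversal i l p : homog p 0 0 != 0 -> l \in transversals i -> l p ->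
  ~ punctured (levels (Some i)) (hform (Some i) (affine_coord Q p)).
Proof.
move=> p0 lT; rewrite {1}(levelP lT) rmorphN -sub0r.
move=> /(line_form (level i l)%:C (Some i) p0) ->; apply/negP; rewrite negbK.
by apply/mapP; exists (level i l); rewrite // mem_sort; apply/mapP; exists l.
Qed.

Lemma on_generic p : homog p 0 0 != 0 ->
  punctured (levels None) (hform None (affine_coord Q p)) <-> ~ H p.
Proof.
move=> p0; have := line_form 0 None p0; rewrite /= subr0 -HE => ->.
by rewrite /punctured /punctures /= inE; split=> [/eqP|/eqP].
Qed.

Lemma coef_neq0 o : (coef_a o != 0) || (coef_b o != 0).
Proof.
case: o => [i|]; first exact: dirC_neq0.
by apply: direction_neq0 h_neq0 _; rewrite -HE => HL; apply: nAH; rewrite HL.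
Qed.

Lemma cross_dir i j : i != j ->
  (dir i).1%:C * homog (P j) 0 1 + (dir i).2%:C * homog (P j) 0 2%:R != 0.
Proof.
apply: contra_neq => E; apply: P_inj.
by apply: (infinite_point uQ (dirC_neq0 i)) => //; exact/at_infinity.
Qed.

Lemma transversal_disjoint i j l : i != j -> l \in transversals i -> ~ l (P j).
Proof.
move=> ij lT; rewrite (levelP lT) => /infinite_direction E.
by have := cross_dir ij; rewrite E eqxx.
Qed.

Lemma generic_not_at i : ~ H (P i).
Proof.
have [l /transversalsP[Al lP lL]] := transversal_exists i.
exact: (H_generic Al AL lL lP (LP i)).
Qed.

(* Two parallel directions would share their point at infinity. *)
Lemma coef_cross o o' : o != o' -> cross coef_a coef_b o o' != 0.
Proof.
have generic i : (dir i).1%:C * h2 - h1 * (dir i).2%:C != 0.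
  apply/negP => /eqP E; apply: (@generic_not_at i); rewrite HE /affine_line /=.
  rewrite ((at_infinity _).1 (LP i)) mulr0 add0r.
  have := dirP i; case/orP: (dirC_neq0 i) => d0 dE; apply: (mulfI d0); rewrite mulr0.
    transitivity (h1 * ((dir i).1%:C * homog (P i) 0 1 + (dir i).2%:C * homog (P i) 0 2%:R)
      + ((dir i).1%:C * h2 - h1 * (dir i).2%:C) * homog (P i) 0 2%:R); first by ring.
    by rewrite dE E mul0r mulr0 addr0.
  transitivity (h2 * ((dir i).1%:C * homog (P i) 0 1 + (dir i).2%:C * homog (P i) 0 2%:R)
    - ((dir i).1%:C * h2 - h1 * (dir i).2%:C) * homog (P i) 0 1); first by ring.
  by rewrite dE E mul0r mulr0 subr0.
case: o => [i|]; case: o' => [j|] //.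
- move=> ij; have {}ij : i != j by apply: contra_neq ij => ->.
  apply: contra_neq (cross_dir ij); rewrite /cross /= => E.
  have := dirP j; case/orP: (dirC_neq0 j) => d0 dE; apply: (mulfI d0); rewrite mulr0.
    transitivity ((dir i).1%:C * ((dir j).1%:C * homog (P j) 0 1 + (dir j).2%:C * homog (P j) 0 2%:R)
      - ((dir i).1%:C * (dir j).2%:C - (dir j).1%:C * (dir i).2%:C) * homog (P j) 0 2%:R).
      by ring.
    by rewrite dE E mul0r mulr0 subr0.
  transitivity ((dir i).2%:C * ((dir j).1%:C * homog (P j) 0 1 + (dir j).2%:C * homog (P j) 0 2%:R)
    + ((dir i).1%:C * (dir j).2%:C - (dir j).1%:C * (dir i).2%:C) * homog (P j) 0 1).
    by ring.
  by rewrite dE E mul0r mulr0 addr0.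
- by move=> _; exact: generic.
- move=> _; rewrite /cross /=; apply: contra_neq (generic j) => E.
  by apply/eqP; rewrite -oppr_eq0 -E; apply/eqP; ring.
Qed.

Lemma multiplicity_ge3 l m n p : A l -> A m -> A n -> l <> m -> l <> n -> m <> n ->
  l p -> m p -> n p -> (3 <= multiplicity A p)%N.
Proof.
move=> Al Am An lm ln mn lp mp np.
have sub : ([fset l; m; n] `<=` fset_set (pencil A p))%fset.
  apply/fsubsetP => x; rewrite !inE in_fset_set; last exact: finite_pencil.
  by move=> /orP[/orP[]|] /eqP ->; rewrite inE.
apply: leq_trans (fsubset_leq_card sub).
rewrite [[fset l; m; n]%fset]fsetUC cardfsU1 cardfs2 !inE.
have [-> -> ->] : [/\ (l == m) = false, (n == l) = false & (n == m) = false].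
  by split; apply/eqP => // E; [exact: ln|exact: mn].
by [].
Qed.

(** Three transversals of distinct pencils through one point would give it multiplicity at least 3,
    against [simple_crossing]; two of them meeting on [H] would contradict [H_generic]. *)
Lemma levels_no_triple o o' o'' y : o != o' -> o != o'' -> o' != o'' ->
  ~ punctured (levels o) (hform o y) -> ~ punctured (levels o') (hform o' y) ->
  punctured (levels o'') (hform o'' y).
Proof.
rewrite -(affine_pointK uQ y); set p := affine_point uQ y.
have p0 : homog p 0 0 != 0 := affine_point_infinity uQ y.
have distinct i j l m : i != j -> l \in transversals i -> m \in transversals j -> l <> m.
  move=> ij lT mT lm; apply: (transversal_disjoint ij lT); rewrite lm.
  by have /transversalsP[] := mT.
have two i j : Some i != Some j ->
    ~ punctured (levels (Some i)) (hform (Some i) (affine_coord Q p)) ->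
    ~ punctured (levels (Some j)) (hform (Some j) (affine_coord Q p)) ->
    punctured (levels None) (hform None (affine_coord Q p)).
  move=> ij /(on_transversal p0)[l [lT lp]] /(on_transversal p0)[m [mT mp]].
  apply/on_generic => //; have ij' : i != j by apply: contra_neq ij => ->.
  have [Al _ _] := (transversalsP i l).1 lT; have [Am _ _] := (transversalsP j m).1 mT.
  exact: (H_generic Al Am (distinct _ _ _ _ ij' lT mT)).
case: o => [i|]; case: o' => [j|]; case: o'' => [n|] // ij il jl bi bj.
- apply: contrapT => bn.
  have [[l [lT lp]] [m [mT mp]] [q [qT qp]]] :
    [/\ exists l, l \in transversals i /\ l p, exists l, l \in transversals j /\ l p &
        exists l, l \in transversals n /\ l p] by split; exact: on_transversal.
  have ij' : i != j by apply: contra_neq ij => ->.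
  have il' : i != n by apply: contra_neq il => ->.
  have jl' : j != n by apply: contra_neq jl => ->.
  have [Al lP lL] := (transversalsP i l).1 lT.
  have [Am mP mL] := (transversalsP j m).1 mT.
  have [Aq qP qL] := (transversalsP n q).1 qT.
  have [+ _] := simple_crossing (elimN eqP ij') (conj Al lP) (conj Am mP) lL mL lp mp.
  have := multiplicity_ge3 Al Am Aq (distinct _ _ _ _ ij' lT mT) (distinct _ _ _ _ il' lT qT)
    (distinct _ _ _ _ jl' mT qT) lp mp qp.
  by move=> + E; rewrite E.
- exact: two bi bj.
- by apply: contrapT => bn; apply: bj; exact: two bi bn.
- by apply: contrapT => bn; apply: bi; exact: two bj bn.
Qed.

Local Notation Y := (~` H `\` \bigcup_(l in A) l).
Local Notation O := (parallels_compl coef_c coef_a coef_b levels (enum {: option 'I_t})).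

Lemma complement_finite p : Y p -> homog p 0 0 != 0.
Proof. by move=> [_ Yp]; apply/eqP => /at_infinity Lp; apply: Yp; exists L. Qed.

Lemma complement_chart p : homog p 0 0 != 0 -> Y p <-> O (affine_coord Q p).
Proof.
move=> p0; split=> [[Hp Yp] [i|] _|Op].
- apply: contrapT => /(on_transversal p0)[l [/transversalsP[Al _ _] lp]].
  by apply: Yp; exists l.
- exact/on_generic.
have Oo o : punctured (levels o) (hform o (affine_coord Q p)) by apply: Op; rewrite mem_enum.
split; first exact/on_generic.
move=> [l Al lp]; have [lL|lL] := pselect (l = L).
  by move/eqP: p0; apply; apply/at_infinity; rewrite -lL.
move: (Al); rewrite {1}A_pencils => -[i _ [_ lP]].
have lT : l \in transversals i by apply/transversalsP.
exact: (off_transversal p0 lT lp) (Oo _).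
Qed.

Definition factor (o : option 'I_t) : groupType :=
  if o is Some i then free_group (k i) else Algebra.to_multiplicative int.

Theorem complement_group (x : set_type Y) :
  group_isomorphic (fundamental_group R x)
    ({dffun forall i : 'I_t, free_group (k i)} * Algebra.to_multiplicative int)%type.
Proof.
apply: group_isomorphic_trans (dffun_option factor).
pose rank (o : option 'I_t) := if o is Some i then k i else 1%N.
have [gen genP] : exists gen : forall o, 'I_(rank o) -> factor o, forall o, free_on (gen o).
  exists (fun o => match o return 'I_(rank o) -> factor o with
    | Some i => fun j : 'I_(k i) => word_class [:: (j, true)]
    | None => fun _ => 1%R : Algebra.to_multiplicative int end).
  by case=> [i|]; [exact: free_group_free_on|exact: int_free_on].
have sizeP o : size (levels o) = rank o by case: o => [i|//]; exact: size_levels.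
have ch := affine_chart uQ x complement_finite complement_chart.
exact: (arrangement_group coef_neq0 coef_cross sorted_levels levels_no_triple sizeP genP
  x ch).
Qed.

End levels.
End directions.
End collinear_arrangement.

Theorem theorem4p1p1 (R : realType) (A : set (set (CP2 R))) (t : nat)
    (P : 'I_t -> CP2 R) (k : 'I_t -> nat) (H : set (CP2 R)) :
  real_line_arrangement A ->
  (1 <= t)%N ->
  collinear_multiple_points A P k ->
  projective_line H ->
  ~ A H ->
  (forall (l m : set (CP2 R)) (p : CP2 R),
      A l -> A m -> l <> m -> l p -> m p -> (~` H) p) ->
  forall x : set_type (~` H `\` \bigcup_(l in A) l),
    group_isomorphic
      (fundamental_group R x)
      ({dffun forall i : 'I_t, free_group (k i)} * Algebra.to_multiplicative int)%type.
Proof.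
move=> [finA realA] _ [P_inj P_range P_mult [L [AL LP A_pencils simple]]] projH nAH Hgen x.
have [Q0 uQ0 LE] := line_at_infinity (realA L AL).
have P_multiple i : multiple_point A (P i) by rewrite -P_range; exists i.
have /choice[dir dirP] := direction_exists uQ0 LE finA realA P_multiple P_mult AL LP.
have /choice[level levelP] i :
  exists lev, forall l, l \in transversals A P L i -> l = affine_line
    (map_mx (real_complex R) Q0) (- lev l)%:C%C (dir i).1%:C%C (dir i).2%:C%C.
  have /choice[lev levP] := level_exists uQ0 LE finA realA LP (fun i => (dirP i).1)
    (fun i => (dirP i).2) i.
  by exists lev.
have uQ := unit_real_matrix uQ0.
have [h0 [h1 [h2 [h_neq0 HE]]]] := projective_line_affine uQ projH.
exact: (complement_group uQ0 LE finA P_inj P_multiple P_mult AL LP A_pencils simple nAH Hgen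
  (fun i => (dirP i).1) (fun i => (dirP i).2) levelP h_neq0 HE x).
Qed.
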